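(* (i) The function $y\mapsto\frac{\mathcal{Y}'(y)}{\mathcal{X}'(y)}$, $y>0$, has only one critical point, at $y=1$, and $$\Big(\frac{\mathcal{Y}'(y)}{\mathcal{X}'(y)}\Big)'<0\ \text{ for } y\in(0,1),\qquad \Big(\frac{\mathcal{Y}'(y)}{\mathcal{X}'(y)}\Big)'>0\ \text{ for } y\in(1,\infty).$$ (ii) The function $y\mapsto\frac{\mathcal{B}'(y)}{\mathcal{A}'(y)}$, $y>0$, has only one critical point, at $y=1$, and $$\Big(\frac{\mathcal{B}'(y)}{\mathcal{A}'(y)}\Big)'<0\ \text{ for } y\in(0,1),\qquad \Big(\frac{\mathcal{B}'(y)}{\mathcal{A}'(y)}\Big)'>0\ \text{ for } y\in(1,\infty).$$
   Context: For $y>0$: $\vartheta_2(y)=\sum_{n\in\mathbb{Z}}e^{-\pi(n-\frac12)^2y}$, $\vartheta_3(y)=\sum_{n\in\mathbb{Z}}e^{-\pi n^2y}$, and $\mathcal{X}(y)=\vartheta_3(y)\vartheta_3(\frac1y)$, $\mathcal{Y}(y)=2\big(\vartheta_3(4y)\vartheta_3(\frac4y)+\vartheta_2(4y)\vartheta_2(\frac4y)\big)$, $\mathcal{A}(y)=\sqrt2\,\vartheta_3(2y)\vartheta_3(\frac2y)$, $\mathcal{B}(y)=\sqrt2\,\vartheta_2(2y)\vartheta_2(\frac2y)$. All four functions are invariant under $y\mapsto1/y$, so their first derivatives vanish at $y=1$; the quotients are understood at $y=1$ as their continuous (smooth) extensions, with values $\mathcal{Y}''(1)/\mathcal{X}''(1)$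 and $\mathcal{B}''(1)/\mathcal{A}''(1)$. *)

(* Defs.v *)
From Stdlib Require Import Reals ZArith.
From Coquelicot Require Import Coquelicot.
Open Scope R_scope.

(* Sum over all integers: the halves n >= 0 and n <= -1 are summed separately. *)
Definition SeriesZ (a : Z -> R) : R :=
  Series (fun n : nat => a (Z.of_nat n)) +
  Series (fun n : nat => a (- Z.of_nat (S n))%Z).

Definition theta2 (y : R) : R :=
  SeriesZ (fun n => exp (- PI * (IZR n - 1 / 2) ^ 2 * y)).

Definition theta3 (y : R) : R :=
  SeriesZ (fun n => exp (- PI * (IZR n) ^ 2 * y)).

Definition calX (y : R) : R := theta3 y * theta3 (1 / y).

Definition calY (y : R) : R :=
  2 * (theta3 (4 * y) * theta3 (4 / y) + theta2 (4 * y) * theta2 (4 / y)).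

Definition calA (y : R) : R := sqrt 2 * theta3 (2 * y) * theta3 (2 / y).

Definition calB (y : R) : R := sqrt 2 * theta2 (2 * y) * theta2 (2 / y).

(* The quotient F'/G', extended at y = 1 (where F' and G' both vanish in the
   intended uses) by the value F''(1)/G''(1). *)
Definition derive_quotient (F G : R -> R) (y : R) : R :=
  if Req_EM_T y 1 then Derive_n F 2 1 / Derive_n G 2 1
  else Derive F y / Derive G y.

(* Main.v *)
(* Write F = theta3^2, g = theta4^2 / theta3^2, k = theta2^2 / theta3^2, so that
   g^2 + k^2 = 1, and let tau = ln (g / k). The duplication formulas (y -> 2 y) leave
   (ln g)' / theta2^4 invariant and scale the defect of the second order equation
   F_tautau = F / (4 cosh^2 tau) by a constant factor, so both dtau/dy = (pi / 2) F^2 and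
   that equation follow from the behaviour at infinity. The same argument, with the Gaussian
   integral as normalisation, gives the inversion formulas F(1/y) = y F(y), k(1/y) = g(y).

   Then X = sqrt y F, Y = (1 + sqrt (g k)) X, B = s X and A = (1 + s) X with
   s = (g + k - 1) / 2, and in the time tau everything is governed by T = tanh tau and by
   m = X_tau / X, v = 1 / (pi X^2), which satisfy the autonomous system
     T' = 1 - T^2,   m' = (1 - T^2) / 4 - v^2 - m^2,   v' = - 2 m v.
   Both derivatives in question are positive multiples of
     Gam = T m' - T m^2 + (T^2 / 2 - (1 - T^2)) m
   (plus a positive term for B' / A'). Gam vanishes to third order at tau = 0; its
   positivity for tau > 0 is a barrier argument: Gam satisfies a linear equation whose source
   is positive as long as m / T stays in a window that is obtained from explicit barriers
   for m. For T > 9/10 it is a direct estimate. The case y < 1 follows by symmetry. *)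
Require Import Defs.
From Stdlib Require Import Reals Ranalysis5 ZArith Lra Lia.
From Coquelicot Require Import Coquelicot.
Open Scope R_scope.

(** * Exponential series *)

(** Doubling alone cannot give the inversion formulas, because [1 / y] moves against [y -> 2 y]. One
    global fact, the size of [theta3] near 0, has to be added; two doubling orbits are then matched
    by their rate of growth.

    The common zero of numerator and denominator at [y = 1] is removed by [z = T / m]. Each of the
    four functions is [phi X] with [phi_tau = - kappa T], so its [tau] derivative is
    [X m (phi - kappa z)] and the factor [m] cancels in the quotients.

    The obstacle to positivity is that [m] tends to 0 only like [1 / (2 tau)], while [1 - T] decays
    exponentially: the cubic barriers in [T] cannot follow [m] up to [T = 1], whence the cut at
    9/10. The slopes 3/16 and 1/5 of the barriers enclose [m_tau = 1/4 - v^2] at [tau = 0], where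
    [v = - n] with [n = F_tau / F]. They come from the first and the second approximation to the
    Riccati equation of [n], integrated from infinity. *)

Lemma exp_le (x y : R) : x <= y -> exp x <= exp y.
Proof. intros [H| ->]; [left; apply exp_increasing; auto|right; auto]. Qed.

Lemma exp_mul_INR (x : R) (n : nat) : exp (x * INR n) = exp x ^ n.
Proof.
  induction n as [|n IH]; [simpl; rewrite Rmult_0_r; apply exp_0|].
  rewrite S_INR, Rmult_plus_distr_l, Rmult_1_r, exp_plus, IH; simpl; ring.
Qed.

(** Each factor [x] takes half of the remaining decay rate: [x * exp (- s x / 2) <= 2 / s], since
    [u <= exp u]. *)
Lemma pow_mul_exp_bounded (p : nat) (s : R) : 0 < s ->
  exists C, forall x, 0 <= x -> x ^ p * exp (- s * x) <= C.
Proof.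
  revert s; induction p as [|p IH]; intros s Hs.
  - exists 1; intros x Hx; rewrite pow_O, Rmult_1_l, <- exp_0.
    apply exp_le; nra.
  - destruct (IH (s / 2)) as [C HC]; [lra|].
    exists (C * (2 / s)); intros x Hx.
    replace (exp (- s * x)) with (exp (- (s / 2) * x) * exp (- (s / 2) * x))
      by (rewrite <- exp_plus; f_equal; field).
    replace (x ^ S p * _) with
      ((x ^ p * exp (- (s / 2) * x)) * (x * exp (- (s / 2) * x))) by (simpl; ring).
    assert (E : x * exp (- (s / 2) * x) <= 2 / s).
    { assert (H : s / 2 * x <= exp (s / 2 * x)).
      { pose proof (exp_ineq1_le (s / 2 * x)); lra. }
      assert (Hi : exp (- (s / 2) * x) * exp (s / 2 * x) = 1)
        by (rewrite <- exp_plus, <- exp_0; f_equal; ring).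
      pose proof (exp_pos (- (s / 2) * x)).
      apply Rmult_le_reg_l with (s / 2); [lra|].
      replace (s / 2 * (2 / s)) with 1 by (field; lra).
      rewrite <- Hi; nra. }
    apply Rmult_le_compat; auto.
    + apply Rmult_le_pos; [apply pow_le; auto|left; apply exp_pos].
    + apply Rmult_le_pos; [auto|left; apply exp_pos].
Qed.

(** Both signs come from [1 + u <= exp u], used at [x] and at [- x]. *)
Lemma exp_taylor1_bound (x : R) : Rabs (exp x - 1 - x) <= x ^ 2 * exp (Rabs x).
Proof.
  pose proof (exp_ineq1_le x) as H1.
  pose proof (exp_ineq1_le (- x)) as H2.
  assert (Hi : exp (- x) * exp x = 1)
    by (rewrite <- exp_plus, <- exp_0; f_equal; ring).
  pose proof (exp_pos x) as Hp; pose proof (exp_pos (- x)) as Hm.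
  rewrite Rabs_right by lra.
  destruct (Rle_dec 0 x) as [Hx|Hx].
  - rewrite Rabs_right by lra.
    assert (H3 : exp x - 1 <= x * exp x).
    { apply (Rmult_le_compat_r (exp x)) in H2; lra. }
    pose proof (Rmult_le_compat_l x _ _ Hx H3); nra.
  - rewrite Rabs_left by lra.
    assert (H3 : 1 <= exp (- x)) by lra.
    apply Rle_trans with (x ^ 2 * 1); [|apply Rmult_le_compat_l; [nra|lra]].
    apply Rle_trans with (x * (exp x - 1)); [|nra].
    apply (Rmult_le_compat_r (exp x)) in H2; nra.
Qed.

(** Made for termwise differentiation: quadratic remainder bounds can be summed over the terms of a
    series. *)
Lemma is_derive_of_quadratic_bound (f : R -> R) (x l C r : R) : 0 < r ->
  (forall h, Rabs h <= r -> Rabs (f (x + h) - f x - h * l) <= C * h ^ 2) ->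
  is_derive f x l.
Proof.
  intros Hr H; apply is_derive_Reals; intros eps Heps.
  assert (HC : 0 <= C).
  { specialize (H r); rewrite (Rabs_right r) in H by lra.
    specialize (H (Rle_refl _)).
    pose proof (Rabs_pos (f (x + r) - f x - r * l)).
    apply Rmult_le_reg_r with (r ^ 2); [apply pow_lt; auto|lra]. }
  assert (Hd : 0 < Rmin r (eps / (C + 1))).
  { apply Rmin_pos; auto. apply Rdiv_lt_0_compat; lra. }
  exists (mkposreal _ Hd); intros h Hh Hhd; simpl in Hhd.
  assert (H1 : Rabs h <= r).
  { pose proof (Rmin_l r (eps / (C + 1))); lra. }
  assert (H2 : Rabs h < eps / (C + 1)).
  { pose proof (Rmin_r r (eps / (C + 1))); lra. }
  specialize (H h H1).
  replace ((f (x + h) - f x) / h - l) with ((f (x + h) - f x - h * l) / h)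
    by (field; auto).
  unfold Rdiv; rewrite Rabs_mult, Rabs_inv.
  assert (Hhp : 0 < Rabs h) by (apply Rabs_pos_lt; auto).
  apply Rmult_lt_reg_r with (Rabs h); auto.
  rewrite Rmult_assoc, Rinv_l, Rmult_1_r by lra.
  rewrite <- (pow2_abs h) in H.
  apply Rle_lt_trans with (C * Rabs h ^ 2); auto.
  assert (Rabs h * (C + 1) < eps).
  { apply Rmult_lt_reg_r with (/ (C + 1)).
    - apply Rinv_0_lt_compat; lra.
    - rewrite Rmult_assoc, Rinv_r by lra; unfold Rdiv in H2; lra. }
  nra.
Qed.

(** * General Dirichlet series: termwise derivatives and leading asymptotics *)

Definition dirichlet (c a : nat -> R) (p : nat) (t : R) : R :=
  Series (fun n => c n * a n ^ p * exp (- a n * t)).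

(** Linear growth of the exponents allows comparison with a geometric series; the gap of at least 1
    above [a 0] lets the first term dominate at infinity. *)
Definition admissible (c a : nat -> R) : Prop :=
  (forall n, Rabs (c n) <= 1) /\ 0 < a 0%nat /\ (forall n, a 0%nat + INR n <= a n).

Lemma admissible_pos c a n : admissible c a -> 0 < a n.
Proof.
  intros (_ & H0 & H). specialize (H n). pose proof (pos_INR n). lra.
Qed.

Lemma ex_series_exp_nat (s : R) : 0 < s -> ex_series (fun n => exp (- s * INR n)).
Proof.
  intros Hs. exists (/ (1 - exp (- s))).
  apply is_series_ext with (fun n => exp (- s) ^ n).
  - intros n; symmetry; apply exp_mul_INR.
  - apply is_series_geom. rewrite Rabs_right by (left; apply exp_pos).
    rewrite <- exp_0; apply exp_increasing; lra.
Qed.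

Lemma ex_series_dirichlet_abs c a p t : admissible c a -> 0 < t ->
  ex_series (fun n => a n ^ p * exp (- a n * t)).
Proof.
  intros Ha Ht.
  destruct (pow_mul_exp_bounded p (t / 2)) as [C HC]; [lra|].
  apply (@ex_series_le R_AbsRing R_CompleteNormedModule _
    (fun n => C * exp (- (t / 2) * INR n))).
  - intros n; change norm with Rabs.
    pose proof (admissible_pos c a n Ha) as Hp.
    destruct Ha as (_ & H0 & H); specialize (H n).
    rewrite Rabs_right.
    2:{ apply Rle_ge, Rmult_le_pos; [apply pow_le; lra|left; apply exp_pos]. }
    replace (exp (- a n * t)) with (exp (- (t / 2) * a n) * exp (- (t / 2) * a n))
      by (rewrite <- exp_plus; f_equal; field).
    rewrite <- Rmult_assoc. apply Rmult_le_compat.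
    + apply Rmult_le_pos; [apply pow_le; lra|left; apply exp_pos].
    + left; apply exp_pos.
    + apply HC; lra.
    + apply exp_le; nra.
  - apply (ex_series_scal_l C (fun n => exp (- (t / 2) * INR n))).
    apply ex_series_exp_nat; lra.
Qed.

Lemma dirichlet_term_le c a p t n : admissible c a ->
  Rabs (c n * a n ^ p * exp (- a n * t)) <= a n ^ p * exp (- a n * t).
Proof.
  intros Ha. pose proof (admissible_pos c a n Ha) as Hp.
  destruct Ha as (Hc & _). specialize (Hc n).
  rewrite Rmult_assoc, Rabs_mult.
  assert (E : 0 <= a n ^ p * exp (- a n * t)).
  { apply Rmult_le_pos; [apply pow_le; lra|left; apply exp_pos]. }
  rewrite (Rabs_right (a n ^ p * _)) by lra. nra.
Qed.

Lemma ex_series_dirichlet c a p t : admissible c a -> 0 < t ->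
  ex_series (fun n => c n * a n ^ p * exp (- a n * t)).
Proof.
  intros Ha Ht.
  apply (@ex_series_le R_AbsRing R_CompleteNormedModule _
    (fun n => a n ^ p * exp (- a n * t))).
  - intros n. apply dirichlet_term_le; auto.
  - eapply ex_series_dirichlet_abs; eauto.
Qed.

(** For [|h| <= t / 2], half of the decay [exp (- a n * t)] absorbs the factor [exp |a n * h|] of
    the Taylor remainder, and the other half keeps the sum of the remainders finite. *)
Lemma is_derive_dirichlet c a p t : admissible c a -> 0 < t ->
  is_derive (dirichlet c a p) t (- dirichlet c a (S p) t).
Proof.
  intros Ha Ht.
  apply is_derive_of_quadratic_bound with
    (C := Series (fun n => a n ^ (S (S p)) * exp (- a n * (t / 2)))) (r := t / 2);
    [lra|].
  intros h Hh.
  assert (Hth : 0 < t + h) by (apply Rabs_le_between in Hh; lra).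
  pose proof (ex_series_dirichlet c a p (t + h) Ha Hth) as E1.
  pose proof (ex_series_dirichlet c a p t Ha Ht) as E2.
  pose proof (ex_series_dirichlet c a (S p) t Ha Ht) as E3.
  assert (E4 : ex_series (fun n => a n ^ (S (S p)) * exp (- a n * (t / 2)))).
  { apply (ex_series_dirichlet_abs c); auto; lra. }
  unfold dirichlet.
  rewrite Ropp_mult_distr_r_reverse. unfold Rminus at 1. rewrite Ropp_involutive.
  rewrite <- Series_minus by auto.
  rewrite <- Series_scal_l.
  rewrite <- Series_plus.
  2:{ apply (ex_series_minus (V:=R_NormedModule)); auto. }
  2:{ apply (ex_series_scal_l h _ E3). }
  rewrite Rmult_comm, <- Series_scal_l.
  assert (B : forall n,
    Rabs (c n * a n ^ p * exp (- a n * (t + h)) - c n * a n ^ p * exp (- a n * t)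
      + h * (c n * a n ^ S p * exp (- a n * t)))
    <= h ^ 2 * (a n ^ S (S p) * exp (- a n * (t / 2)))).
  { intros n. pose proof (admissible_pos c a n Ha) as Hp.
    replace (exp (- a n * (t + h))) with (exp (- a n * t) * exp (- a n * h))
      by (rewrite <- exp_plus; f_equal; ring).
    replace (_ + _) with
      (c n * a n ^ p * exp (- a n * t) * (exp (- a n * h) - 1 - (- a n * h)))
      by (simpl; ring).
    rewrite Rabs_mult.
    pose proof (dirichlet_term_le c a p t n Ha) as T1.
    pose proof (exp_taylor1_bound (- a n * h)) as T2.
    apply Rle_trans with ((a n ^ p * exp (- a n * t)) *
      ((- a n * h) ^ 2 * exp (Rabs (- a n * h)))).
    - apply Rmult_le_compat; auto using Rabs_pos.
    - replace (h ^ 2 * _) with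
        ((a n ^ p * (- a n * h) ^ 2) * exp (- a n * (t / 2))) by (simpl; ring).
      replace (a n ^ p * exp (- a n * t) * _) with
        ((a n ^ p * (- a n * h) ^ 2) * (exp (- a n * t) * exp (Rabs (- a n * h))))
        by ring.
      apply Rmult_le_compat_l.
      + apply Rmult_le_pos; [apply pow_le; lra|apply pow2_ge_0].
      + rewrite <- exp_plus; apply exp_le.
        rewrite Rabs_mult, Rabs_Ropp, (Rabs_right (a n)) by lra. nra. }
  assert (E5 : ex_series (fun n => h ^ 2 * (a n ^ S (S p) * exp (- a n * (t / 2)))))
    by apply (ex_series_scal_l (h ^ 2) _ E4).
  eapply Rle_trans; [apply Series_Rabs|apply Series_le; auto].
  - apply (@ex_series_le R_AbsRing R_CompleteNormedModule _ _) with (2 := E5).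
    intros n; change norm with Rabs; rewrite Rabs_Rabsolu; apply B.
  - intros n; split; [apply Rabs_pos|apply B].
Qed.

Lemma is_lim_exp_neg (s : R) : 0 < s -> is_lim (fun t => exp (- s * t)) p_infty 0.
Proof.
  intros Hs. apply is_lim_comp with m_infty.
  - apply is_lim_exp_m.
  - apply is_lim_ext with (fun t => (- s) * t); [auto|].
    replace m_infty with (Rbar_mult (- s) p_infty).
    + apply is_lim_scal_l, is_lim_id.
    + simpl. destruct (Rle_dec 0 (- s)); [exfalso; lra|reflexivity].
  - exists 0; intros; discriminate.
Qed.

(* The first term dominates: the tail is at most a constant times exp (- t). *)
Lemma is_lim_dirichlet c a p : admissible c a ->
  is_lim (fun t => exp (a 0%nat * t) * dirichlet c a p t) p_infty (c 0%nat * a 0%nat ^ p).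
Proof.
  intros Ha.
  set (M := Series (fun n => a (S n) ^ p * exp (- a (S n) * 1))).
  assert (E1 : ex_series (fun n => a (S n) ^ p * exp (- a (S n) * 1))).
  { apply (ex_series_incr_1 (fun n => a n ^ p * exp (- a n * 1))).
    apply (ex_series_dirichlet_abs c); auto; lra. }
  assert (B : forall t, 1 <= t ->
    Rabs (exp (a 0%nat * t) * dirichlet c a p t - c 0%nat * a 0%nat ^ p) <=
    (M * exp (a 0%nat + 1)) * exp (- 1 * t)).
  { intros t Ht. unfold dirichlet.
    assert (E2 := ex_series_dirichlet c a p t Ha ltac:(lra)).
    rewrite Series_incr_1 by auto.
    assert (E3 : ex_series (fun n => c (S n) * a (S n) ^ p * exp (- a (S n) * t)))
      by apply (ex_series_incr_1 (fun n => c n * a n ^ p * exp (- a n * t))), E2.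
    replace (exp (a 0%nat * t) * _ - _) with
      (exp (a 0%nat * t) * Series (fun n => c (S n) * a (S n) ^ p * exp (- a (S n) * t))).
    2:{ rewrite Rmult_plus_distr_l.
        replace (exp (a 0%nat * t) * (c 0%nat * a 0%nat ^ p * exp (- a 0%nat * t)))
          with (c 0%nat * a 0%nat ^ p * (exp (a 0%nat * t) * exp (- a 0%nat * t))) by ring.
        rewrite <- exp_plus.
        replace (a 0%nat * t + - a 0%nat * t) with 0 by ring. rewrite exp_0; ring. }
    rewrite <- Series_scal_l. unfold M.
    replace (Series _ * exp (a 0%nat + 1) * exp (- 1 * t)) with
      (exp (a 0%nat + 1) * exp (- 1 * t) *
       Series (fun n => a (S n) ^ p * exp (- a (S n) * 1))) by ring.
    rewrite <- Series_scal_l.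
    assert (B : forall n,
      Rabs (exp (a 0%nat * t) * (c (S n) * a (S n) ^ p * exp (- a (S n) * t))) <=
      exp (a 0%nat + 1) * exp (- 1 * t) * (a (S n) ^ p * exp (- a (S n) * 1))).
    { intros n. rewrite Rabs_mult, Rabs_right by (left; apply exp_pos).
      apply Rle_trans with (exp (a 0%nat * t) * (a (S n) ^ p * exp (- a (S n) * t))).
      - apply Rmult_le_compat_l; [left; apply exp_pos|apply dirichlet_term_le; auto].
      - pose proof (admissible_pos c a (S n) Ha) as Hp.
        replace (exp (a 0%nat * t) * _) with
          (a (S n) ^ p * (exp (a 0%nat * t) * exp (- a (S n) * t))) by ring.
        replace (exp (a 0%nat + 1) * _ * _) with
          (a (S n) ^ p * (exp (a 0%nat + 1) * exp (- 1 * t) * exp (- a (S n) * 1)))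
          by ring.
        apply Rmult_le_compat_l; [apply pow_le; lra|].
        (* The exponents compare because [(t - 1) * (a (S n) - a 0 - 1) >= 0]. *)
        rewrite <- !exp_plus; apply exp_le.
        destruct Ha as (_ & H0 & H); specialize (H (S n)); rewrite S_INR in H.
        pose proof (pos_INR n). nra. }
    assert (E4 : ex_series (fun n =>
      exp (a 0%nat + 1) * exp (- 1 * t) * (a (S n) ^ p * exp (- a (S n) * 1))))
      by apply (ex_series_scal_l (exp (a 0%nat + 1) * exp (- 1 * t)) _ E1).
    eapply Rle_trans; [apply Series_Rabs|apply Series_le; auto].
    - apply (@ex_series_le R_AbsRing R_CompleteNormedModule _ _) with (2 := E4).
      intros n; change norm with Rabs; rewrite Rabs_Rabsolu; apply B.
    - intros n; split; [apply Rabs_pos|apply B]. }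
  apply is_lim_ext with (fun t => c 0%nat * a 0%nat ^ p +
    (exp (a 0%nat * t) * dirichlet c a p t - c 0%nat * a 0%nat ^ p)); [intros; ring|].
  replace (c 0%nat * a 0%nat ^ p) with (c 0%nat * a 0%nat ^ p + 0) at 1 by ring.
  apply is_lim_plus'; [apply is_lim_const|].
  assert (L : is_lim (fun t => exp (- 1 * t)) p_infty 0).
  { apply (is_lim_ext (fun t => exp (- (1) * t))); [intros t; f_equal; ring|].
    apply is_lim_exp_neg; lra. }
  apply (is_lim_le_le_loc
    (fun t => - ((M * exp (a 0%nat + 1)) * exp (- 1 * t)))
    (fun t => (M * exp (a 0%nat + 1)) * exp (- 1 * t))).
  - exists 1; intros t Ht. apply Rabs_le_between, B; lra.
  - replace (Finite 0) with (Rbar_opp (Rbar_mult (M * exp (a 0%nat + 1)) 0))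
      by (simpl; f_equal; ring).
    apply is_lim_opp, is_lim_scal_l, L.
  - replace (Finite 0) with (Rbar_mult (M * exp (a 0%nat + 1)) 0)
      by (simpl; f_equal; ring).
    apply is_lim_scal_l, L.
Qed.

(** * Double series over the integers *)

Lemma ex_series_le_nonneg (a b : nat -> R) :
  (forall n, 0 <= a n <= b n) -> ex_series b -> ex_series a.
Proof.
  intros H Hb. apply (@ex_series_le R_AbsRing R_CompleteNormedModule a b); auto.
  intros n; change norm with Rabs. rewrite Rabs_right; [apply H|apply Rle_ge, H].
Qed.

Lemma sum_n_nonneg_incr (a : nat -> R) : (forall n, 0 <= a n) ->
  forall n, sum_n a n <= sum_n a (S n).
Proof. intros H n. rewrite sum_Sn. change plus with Rplus. specialize (H (S n)); lra. Qed.

Lemma sum_n_le_Series (a : nat -> R) N : (forall n, 0 <= a n) -> ex_series a ->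
  sum_n a N <= Series a.
Proof.
  intros H E. apply Series_correct in E.
  apply (is_lim_seq_incr_compare (sum_n a) (Series a)); auto.
  apply sum_n_nonneg_incr; auto.
Qed.

Lemma term_le_Series (a : nat -> R) N : (forall n, 0 <= a n) -> ex_series a ->
  a N <= Series a.
Proof.
  intros H E. eapply Rle_trans; [|apply (sum_n_le_Series a N); auto].
  destruct N as [|N]; [rewrite sum_O; lra|].
  rewrite sum_Sn; change plus with Rplus.
  assert (0 <= sum_n a N); [|lra].
  clear - H; induction N as [|N IH]; [rewrite sum_O; apply H|].
  pose proof (sum_n_nonneg_incr a H N); lra.
Qed.

Lemma Series_nonneg_bounded (a : nat -> R) (M : R) : (forall n, 0 <= a n) ->
  (forall N, sum_n a N <= M) -> ex_series a /\ Series a <= M.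
Proof.
  intros H B.
  assert (E : ex_series a).
  { destruct (ex_finite_lim_seq_incr (sum_n a) M) as [l Hl]; auto.
    - apply sum_n_nonneg_incr; auto.
    - exists l; exact Hl. }
  split; auto. apply Series_correct in E.
  apply (is_lim_seq_le (sum_n a) (fun _ => M) (Series a) M); auto.
  apply is_lim_seq_const.
Qed.

Lemma sum_n_Series (a : nat -> nat -> R) (M : nat) : (forall m, ex_series (a m)) ->
  ex_series (fun n => sum_n (fun m => a m n) M) /\
  Series (fun n => sum_n (fun m => a m n) M) = sum_n (fun m => Series (a m)) M.
Proof.
  intros E; induction M as [|M [IH1 IH2]].
  - rewrite sum_O. split.
    + apply ex_series_ext with (a 0%nat); [intros; rewrite sum_O|]; auto.
    + apply Series_ext; intros; rewrite sum_O; auto.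
  - rewrite sum_Sn, <- IH2; change plus with Rplus. split.
    + apply ex_series_ext with (fun n => sum_n (fun m => a m n) M + a (S M) n).
      * intros; rewrite sum_Sn; auto.
      * apply (ex_series_plus (V:=R_NormedModule)); auto.
    + rewrite <- Series_plus by auto. apply Series_ext; intros; rewrite sum_Sn; auto.
Qed.

(** Finite sums over [m] commute with the series over [n] and stay below the iterated sum. One
    inequality is enough, since [tonelli] applies it in both directions. *)
Lemma tonelli_le (a : nat -> nat -> R) : (forall n m, 0 <= a n m) ->
  (forall n, ex_series (a n)) -> ex_series (fun n => Series (a n)) ->
  (forall m, ex_series (fun n => a n m)) /\
  ex_series (fun m => Series (fun n => a n m)) /\
  Series (fun m => Series (fun n => a n m)) <= Series (fun n => Series (a n)).
Proof.
  intros H E1 E2.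
  assert (C : forall m, ex_series (fun n => a n m)).
  { intros m. apply ex_series_le_nonneg with (2 := E2).
    intros n; split; auto. apply term_le_Series; auto. }
  split; auto.
  apply Series_nonneg_bounded.
  - intros m. apply Rle_trans with (a 0%nat m); auto.
    apply (term_le_Series (fun n => a n m) 0); auto.
  - intros M. destruct (sum_n_Series (fun m n => a n m) M) as [_ <-]; auto.
    apply Series_le; auto. intros n; split.
    + clear - H; induction M as [|M IH]; [rewrite sum_O; auto|].
      rewrite sum_Sn; change plus with Rplus; specialize (H n (S M)); lra.
    + apply sum_n_le_Series; auto.
Qed.

Lemma tonelli (a : nat -> nat -> R) : (forall n m, 0 <= a n m) ->
  (forall n, ex_series (a n)) -> ex_series (fun n => Series (a n)) ->
  Series (fun n => Series (a n)) = Series (fun m => Series (fun n => a n m)).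
Proof.
  intros H E1 E2.
  destruct (tonelli_le a H E1 E2) as (C1 & C2 & L).
  destruct (tonelli_le (fun m n => a n m)) as (_ & _ & L'); auto.
  apply Rle_antisym; auto.
Qed.

Lemma Series_even_odd (a : nat -> R) : (forall n, 0 <= a n) -> ex_series a ->
  ex_series (fun n => a (2 * n)%nat) /\ ex_series (fun n => a (2 * n + 1)%nat) /\
  Series a = Series (fun n => a (2 * n)%nat) + Series (fun n => a (2 * n + 1)%nat).
Proof.
  intros H E.
  assert (P : forall N, sum_n (fun n => a (2 * n)%nat + a (2 * n + 1)%nat) N =
    sum_n a (2 * N + 1)).
  { induction N as [|N IH].
    - rewrite sum_O. simpl. rewrite sum_Sn, sum_O. reflexivity.
    - rewrite sum_Sn, IH. replace (2 * S N + 1)%nat with (S (S (2 * N + 1))) by lia.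
      rewrite !sum_Sn. change plus with Rplus.
      replace (2 * S N)%nat with (S (2 * N + 1)) by lia.
      replace (S (2 * N + 1) + 1)%nat with (S (S (2 * N + 1))) by lia.
      symmetry; apply Rplus_assoc. }
  destruct (Series_nonneg_bounded (fun n => a (2 * n)%nat + a (2 * n + 1)%nat)
    (Series a)) as [E' _].
  - intros n; pose proof (H (2 * n)%nat); pose proof (H (2 * n + 1)%nat); lra.
  - intros N; rewrite P; apply sum_n_le_Series; auto.
  - assert (E1 : ex_series (fun n => a (2 * n)%nat)).
    { apply ex_series_le_nonneg with (2 := E'); intros n.
      pose proof (H (2 * n)%nat); pose proof (H (2 * n + 1)%nat); lra. }
    assert (E2 : ex_series (fun n => a (2 * n + 1)%nat)).
    { apply ex_series_le_nonneg with (2 := E'); intros n.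
      pose proof (H (2 * n)%nat); pose proof (H (2 * n + 1)%nat); lra. }
    do 2 (split; auto).
    rewrite <- Series_plus by auto. symmetry.
    apply is_series_unique.
    apply Series_correct in E.
    assert (E3 := is_lim_seq_subseq (sum_n a) (Series a) (fun N => (2 * N + 1)%nat)
      ltac:(apply eventually_subseq; intros; lia) E).
    apply is_lim_seq_ext with (2 := E3). intros N; symmetry; apply P.
Qed.

(** * Sums over the integers: shifts, parity, exchange of two sums *)

Definition summableZ (f : Z -> R) : Prop :=
  ex_series (fun n => f (Z.of_nat n)) /\ ex_series (fun n => f (- Z.of_nat (S n))%Z).

Lemma SeriesZ_fold f : summableZ f ->
  ex_series (fun n => f (Z.of_nat n) + f (- Z.of_nat (S n))%Z) /\
  SeriesZ f = Series (fun n => f (Z.of_nat n) + f (- Z.of_nat (S n))%Z).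
Proof.
  intros [E1 E2]; unfold SeriesZ; split.
  - apply (ex_series_plus (V:=R_NormedModule)); auto.
  - rewrite Series_plus; auto.
Qed.

Lemma SeriesZ_ext f h : (forall n, f n = h n) -> SeriesZ f = SeriesZ h.
Proof. intros H; unfold SeriesZ; f_equal; apply Series_ext; auto. Qed.

Lemma summableZ_ext f h : (forall n, f n = h n) -> summableZ f -> summableZ h.
Proof.
  intros H [E1 E2]; split;
    [apply ex_series_ext with (2 := E1)|apply ex_series_ext with (2 := E2)]; auto.
Qed.

Lemma SeriesZ_scal_l c f : SeriesZ (fun n => c * f n) = c * SeriesZ f.
Proof. unfold SeriesZ. rewrite !Series_scal_l. ring. Qed.

Lemma summableZ_scal_l c f : summableZ f -> summableZ (fun n => c * f n).
Proof.
  intros [E1 E2]; split; [apply (ex_series_scal_l c _ E1)|apply (ex_series_scal_l c _ E2)].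
Qed.

Lemma SeriesZ_shift1 f : summableZ f ->
  summableZ (fun n => f (n + 1)%Z) /\ SeriesZ (fun n => f (n + 1)%Z) = SeriesZ f.
Proof.
  intros [E1 E2].
  set (u := fun n => f (Z.of_nat n)). set (v := fun n => f (- Z.of_nat (S n))%Z).
  assert (A : forall n, f (Z.of_nat n + 1)%Z = u (S n)).
  { intros n; unfold u; f_equal; lia. }
  assert (B : forall n, f (- Z.of_nat (S (S n)) + 1)%Z = v n).
  { intros n; unfold v; f_equal; lia. }
  assert (F1 : ex_series (fun n => f (Z.of_nat n + 1)%Z)).
  { apply ex_series_ext with (fun n => u (S n)); [auto|].
    apply (ex_series_incr_1 u); auto. }
  assert (F2 : ex_series (fun n => f (- Z.of_nat (S n) + 1)%Z)).
  { apply (ex_series_incr_1 (fun n => f (- Z.of_nat (S n) + 1)%Z)).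
    apply ex_series_ext with v; auto. }
  split; [split; auto|].
  unfold SeriesZ. change (Series (fun n => f (Z.of_nat n))) with (Series u).
  rewrite (Series_incr_1 _ F2), (Series_incr_1 u E1).
  rewrite (Series_ext _ _ A), (Series_ext _ _ B). fold v.
  replace (f (- Z.of_nat 1 + 1)%Z) with (u 0%nat) by (unfold u; f_equal).
  ring.
Qed.

Lemma SeriesZ_shift f (k : Z) : summableZ f ->
  summableZ (fun n => f (n + k)%Z) /\ SeriesZ (fun n => f (n + k)%Z) = SeriesZ f.
Proof.
  revert f; assert (P : forall (k : nat) f, summableZ f ->
    summableZ (fun n => f (n + Z.of_nat k)%Z) /\
    SeriesZ (fun n => f (n + Z.of_nat k)%Z) = SeriesZ f).
  { induction k0 as [|k0 IH]; intros f E.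
    - split; [apply summableZ_ext with (2 := E)|apply SeriesZ_ext];
        intros; f_equal; lia.
    - destruct (IH f E) as [E1 S1]. destruct (SeriesZ_shift1 _ E1) as [E2 S2].
      rewrite <- S1, <- S2.
      split; [apply summableZ_ext with (2 := E2)|apply SeriesZ_ext];
        intros; f_equal; lia. }
  (* For backward shifts summability is the only thing to prove: the value follows by shifting the
     shifted family forward again with [P]. *)
  assert (Q : forall (k : nat) f, summableZ f ->
    summableZ (fun n => f (n - Z.of_nat k)%Z)).
  { intros k0 f [E1 E2]. split.
    - apply (ex_series_incr_n (fun n => f (Z.of_nat n - Z.of_nat k0)%Z) k0).
      apply ex_series_ext with (2 := E1). intros; f_equal; lia.
    - apply (ex_series_incr_n (fun n => f (- Z.of_nat (S n))%Z) k0) in E2.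
      apply ex_series_ext with (2 := E2). intros; f_equal; lia. }
  intros f E. destruct (Z_le_gt_dec 0 k) as [Hk|Hk].
  - rewrite <- (Z2Nat.id k) by lia. apply P; auto.
  - pose proof (Q (Z.to_nat (- k)) f E) as E'.
    destruct (P (Z.to_nat (- k)) _ E') as [_ S1].
    rewrite Z2Nat.id in * by lia.
    split.
    + apply summableZ_ext with (2 := E'). intros; f_equal; lia.
    + transitivity (SeriesZ (fun n => f (n - - k)%Z)).
      * apply SeriesZ_ext; intros; f_equal; lia.
      * rewrite <- S1. apply SeriesZ_ext; intros; f_equal; lia.
Qed.

Lemma SeriesZ_even_odd f : (forall n, 0 <= f n) -> summableZ f ->
  SeriesZ f = SeriesZ (fun n => f (2 * n)%Z) + SeriesZ (fun n => f (2 * n + 1)%Z).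
Proof.
  intros H [E1 E2]. unfold SeriesZ.
  destruct (Series_even_odd (fun n => f (Z.of_nat n))) as (_ & _ & ->); auto.
  destruct (Series_even_odd (fun n => f (- Z.of_nat (S n))%Z)) as (_ & _ & ->); auto.
  rewrite (Series_ext (fun n => f (Z.of_nat (2 * n))) (fun n => f (2 * Z.of_nat n)%Z))
    by (intros; f_equal; lia).
  rewrite (Series_ext (fun n => f (Z.of_nat (2 * n + 1)))
    (fun n => f (2 * Z.of_nat n + 1)%Z)) by (intros; f_equal; lia).
  (* On the negative half the parities are exchanged: the even position [2 n] carries the odd
     integer [- (2 n + 1)]. *)
  rewrite (Series_ext (fun n => f (- Z.of_nat (S (2 * n)))%Z)
    (fun n => f (2 * - Z.of_nat (S n) + 1)%Z)) by (intros; f_equal; lia).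
  rewrite (Series_ext (fun n => f (- Z.of_nat (S (2 * n + 1)))%Z)
    (fun n => f (2 * - Z.of_nat (S n))%Z)) by (intros; f_equal; lia).
  ring.
Qed.

Lemma SeriesZ_nonneg (f : Z -> R) : (forall n, 0 <= f n) -> summableZ f -> 0 <= SeriesZ f.
Proof.
  intros Hf [X1 X2]. unfold SeriesZ.
  pose proof (term_le_Series (fun n => f (Z.of_nat n)) 0 (fun n => Hf _) X1).
  pose proof (term_le_Series (fun n => f (- Z.of_nat (S n))%Z) 0 (fun n => Hf _) X2).
  pose proof (Hf (Z.of_nat 0)); pose proof (Hf (- Z.of_nat 1)%Z). simpl in *; lra.
Qed.

(** The four quadrants of the integer plane are folded into one double sequence over [nat]. *)
Lemma tonelliZ (f : Z -> Z -> R) : (forall m n, 0 <= f m n) ->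
  (forall m, summableZ (f m)) -> summableZ (fun m => SeriesZ (f m)) ->
  summableZ (fun n => SeriesZ (fun m => f m n)) /\
  SeriesZ (fun m => SeriesZ (f m)) = SeriesZ (fun n => SeriesZ (fun m => f m n)).
Proof.
  intros H E1 E2.
  set (nn := fun n => (- Z.of_nat (S n))%Z).
  set (a := fun m n : nat => (f (Z.of_nat m) (Z.of_nat n) + f (Z.of_nat m) (nn n)) +
                     (f (nn m) (Z.of_nat n) + f (nn m) (nn n))).
  assert (Ha : forall m n, 0 <= a m n).
  { intros m n; unfold a.
    pose proof (H (Z.of_nat m) (Z.of_nat n)); pose proof (H (nn m) (Z.of_nat n)).
    pose proof (H (Z.of_nat m) (nn n)); pose proof (H (nn m) (nn n)); lra. }
  assert (R1 : forall m, ex_series (a m) /\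
    Series (a m) = SeriesZ (f (Z.of_nat m)) + SeriesZ (f (nn m))).
  { intros m. destruct (SeriesZ_fold _ (E1 (Z.of_nat m))) as [X1 ->].
    destruct (SeriesZ_fold _ (E1 (nn m))) as [X2 ->]. split.
    - apply (ex_series_plus (V:=R_NormedModule) _ _ X1 X2).
    - rewrite <- Series_plus by auto. reflexivity. }
  destruct (SeriesZ_fold _ E2) as [R2 R3].
  assert (R4 : ex_series (fun m => Series (a m))).
  { apply ex_series_ext with (2 := R2). intros m; symmetry; apply R1. }
  destruct (tonelli_le a Ha (fun m => proj1 (R1 m)) R4) as (C1 & C2 & _).
  pose proof (tonelli a Ha (fun m => proj1 (R1 m)) R4) as T.
  assert (S0 : forall n, summableZ (fun m => f m (Z.of_nat n)) /\
                         summableZ (fun m => f m (nn n))).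
  { intros n; repeat split; apply ex_series_le_nonneg with (2 := C1 n);
      intros m; fold (nn m); (split; [auto|]); unfold a;
      pose proof (H (Z.of_nat m) (Z.of_nat n)); pose proof (H (nn m) (Z.of_nat n));
      pose proof (H (Z.of_nat m) (nn n)); pose proof (H (nn m) (nn n)); lra. }
  assert (R5 : forall n, Series (fun m => a m n) =
    SeriesZ (fun m => f m (Z.of_nat n)) + SeriesZ (fun m => f m (nn n))).
  { intros n. destruct (S0 n) as [X1 X2].
    destruct (SeriesZ_fold _ X1) as [Y1 ->]. destruct (SeriesZ_fold _ X2) as [Y2 ->].
    rewrite <- Series_plus by auto. apply Series_ext; intros m; unfold a, nn; ring. }
  assert (E3 : summableZ (fun n => SeriesZ (fun m => f m n))).
  { split; apply ex_series_le_nonneg with (2 := C2); intros n; rewrite R5;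
      destruct (S0 n) as [X1 X2];
      pose proof (SeriesZ_nonneg _ (fun m => H m (Z.of_nat n)) X1);
      pose proof (SeriesZ_nonneg _ (fun m => H m (nn n)) X2); fold (nn n); lra. }
  split; auto.
  rewrite R3. destruct (SeriesZ_fold _ E3) as [_ ->].
  transitivity (Series (fun m => Series (a m))).
  - apply Series_ext; intros m; symmetry; apply R1.
  - rewrite T; apply Series_ext; intros n; apply R5.
Qed.

(** * Duplication formulas *)

Definition ones (n : nat) : R := 1.
(** The constant term of [theta3] is left out, so that the first term of the series is the leading
    decaying one. *)
Definition exponent3 (n : nat) : R := (INR n + 1) ^ 2.
Definition exponent2 (n : nat) : R := (INR n + 1 / 2) ^ 2.

Lemma admissible_exponent3 : admissible ones exponent3.
Proof.
  unfold ones, exponent3; repeat split; intros; simpl INR; try (rewrite Rabs_R1); try lra.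
  pose proof (pos_INR n); nra.
Qed.

Lemma admissible_exponent2 : admissible ones exponent2.
Proof.
  unfold ones, exponent2; repeat split; intros; simpl INR; try (rewrite Rabs_R1); try lra.
  assert (0 <= INR n * (INR n)) by (pose proof (pos_INR n); nra). 
  destruct n as [|n]; [simpl; lra|]. rewrite S_INR in *. pose proof (pos_INR n); nra.
Qed.

Lemma summableZ_theta3 y : 0 < y ->
  summableZ (fun n => exp (- PI * (IZR n) ^ 2 * y)) /\
  theta3 y = 1 + 2 * dirichlet ones exponent3 0 (PI * y).
Proof.
  intros Hy. pose proof PI_RGT_0 as Hpi.
  assert (E := ex_series_dirichlet ones exponent3 0 (PI * y) admissible_exponent3 ltac:(nra)).
  assert (E1 : forall n : nat, ones n * exponent3 n ^ 0 * exp (- exponent3 n * (PI * y)) =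
    exp (- PI * (IZR (Z.of_nat (S n))) ^ 2 * y)).
  { intros n. unfold ones, exponent3. rewrite <- INR_IZR_INZ, S_INR, pow_O, !Rmult_1_l.
    f_equal; ring. }
  assert (E2 : forall n : nat, ones n * exponent3 n ^ 0 * exp (- exponent3 n * (PI * y)) =
    exp (- PI * (IZR (- Z.of_nat (S n))) ^ 2 * y)).
  { intros n. rewrite E1, opp_IZR. f_equal; ring. }
  assert (F1 : ex_series (fun n => exp (- PI * (IZR (Z.of_nat n)) ^ 2 * y))).
  { apply (ex_series_incr_1 (fun n => exp (- PI * (IZR (Z.of_nat n)) ^ 2 * y))).
    apply ex_series_ext with (2 := E); auto. }
  split; [split; auto; apply ex_series_ext with (2 := E); auto|].
  unfold theta3, SeriesZ, dirichlet.
  rewrite (Series_incr_1 (fun n => exp (- PI * (IZR (Z.of_nat n)) ^ 2 * y))) by auto.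
  rewrite <- (Series_ext _ _ E1), <- (Series_ext _ _ E2).
  replace (exp (- PI * IZR (Z.of_nat 0) ^ 2 * y)) with 1; [ring|].
  symmetry; rewrite <- exp_0; f_equal; simpl; ring.
Qed.

Lemma summableZ_theta2 y : 0 < y ->
  summableZ (fun n => exp (- PI * (IZR n - 1 / 2) ^ 2 * y)) /\
  theta2 y = 2 * dirichlet ones exponent2 0 (PI * y).
Proof.
  intros Hy. pose proof PI_RGT_0 as Hpi.
  assert (E := ex_series_dirichlet ones exponent2 0 (PI * y) admissible_exponent2 ltac:(nra)).
  set (u := fun n : nat => ones n * exponent2 n ^ 0 * exp (- exponent2 n * (PI * y))) in E.
  assert (E1 : forall n : nat, u n =
    exp (- PI * (IZR (Z.of_nat (S n)) - 1 / 2) ^ 2 * y)).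
  { intros n. unfold u, ones, exponent2. rewrite <- INR_IZR_INZ, S_INR, pow_O, !Rmult_1_l.
    f_equal; field. }
  (* The integers 0 and 1 both have exponent 1/4, so [u 0] occurs at index 0 and the negative half
     starts at [u 1]. *)
  assert (E2 : forall n : nat, u (S n) =
    exp (- PI * (IZR (- Z.of_nat (S n)) - 1 / 2) ^ 2 * y)).
  { intros n. rewrite E1, opp_IZR, <- !INR_IZR_INZ, !S_INR. f_equal; field. }
  assert (E' : ex_series (fun n => u (S n))) by (apply (ex_series_incr_1 u); auto).
  assert (F1 : ex_series (fun n => exp (- PI * (IZR (Z.of_nat n) - 1 / 2) ^ 2 * y))).
  { apply (ex_series_incr_1 (fun n => exp (- PI * (IZR (Z.of_nat n) - 1 / 2) ^ 2 * y))).
    apply ex_series_ext with (2 := E); auto. }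
  split; [split; auto; apply ex_series_ext with (2 := E'); auto|].
  unfold theta2, SeriesZ, dirichlet. fold u.
  rewrite (Series_incr_1 (fun n => exp (- PI * (IZR (Z.of_nat n) - 1 / 2) ^ 2 * y))) by auto.
  rewrite <- (Series_ext _ _ E1), <- (Series_ext _ _ E2).
  rewrite (Series_incr_1 u) by auto.
  replace (exp (- PI * (IZR (Z.of_nat 0) - 1 / 2) ^ 2 * y)) with (u 0%nat); [ring|].
  unfold u, ones, exponent2; rewrite pow_O, !Rmult_1_l; f_equal; simpl; field.
Qed.

Lemma SeriesZ_half_shift y : 0 < y ->
  summableZ (fun n => exp (- PI * (IZR n + 1 / 2) ^ 2 * y)) /\
  SeriesZ (fun n => exp (- PI * (IZR n + 1 / 2) ^ 2 * y)) = theta2 y.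
Proof.
  intros Hy. destruct (summableZ_theta2 y Hy) as [E _].
  destruct (SeriesZ_shift _ 1 E) as [E1 S1]; cbv beta in *.
  assert (P : forall n, exp (- PI * (IZR (n + 1) - 1 / 2) ^ 2 * y) =
    exp (- PI * (IZR n + 1 / 2) ^ 2 * y)).
  { intros n; rewrite plus_IZR; f_equal; field. }
  split; [apply summableZ_ext with (2 := E1); auto|].
  unfold theta2; rewrite <- S1; apply SeriesZ_ext; auto.
Qed.

(** Even integers are twice integers, odd integers twice half-integers. *)
Lemma theta3_split y : 0 < y -> theta3 y = theta3 (4 * y) + theta2 (4 * y).
Proof.
  intros Hy. destruct (summableZ_theta3 y Hy) as [E _].
  unfold theta3 at 1. rewrite SeriesZ_even_odd; auto.
  2:{ intros; left; apply exp_pos. }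
  destruct (SeriesZ_half_shift (4 * y)) as [_ <-]; [lra|].
  unfold theta3. f_equal; apply SeriesZ_ext; intros n;
    rewrite ?plus_IZR, mult_IZR; f_equal; field.
Qed.

(* Substituting n = s - m and splitting s by parity diagonalises the form m^2 + n^2. *)
Lemma theta3_sq y : 0 < y -> theta3 y ^ 2 = theta3 (2 * y) ^ 2 + theta2 (2 * y) ^ 2.
Proof.
  intros Hy. assert (Hy2 : 0 < 2 * y) by lra.
  set (e := fun m n => exp (- PI * (IZR m) ^ 2 * y) * exp (- PI * (IZR n) ^ 2 * y)).
  assert (Hrow : forall m, summableZ (e m) /\
    SeriesZ (e m) = exp (- PI * (IZR m) ^ 2 * y) * theta3 y).
  { intros m. destruct (summableZ_theta3 y Hy) as [E _]. split.
    - apply summableZ_scal_l; auto.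
    - unfold e; rewrite SeriesZ_scal_l; auto. }
  assert (Hrow' : forall m, summableZ (fun s => e m (s + - m)%Z) /\
    SeriesZ (fun s => e m (s + - m)%Z) = exp (- PI * (IZR m) ^ 2 * y) * theta3 y).
  { intros m. destruct (Hrow m) as [E <-]. apply (SeriesZ_shift (e m)); auto. }
  assert (Hs : summableZ (fun m => SeriesZ (fun s => e m (s + - m)%Z)) /\
    SeriesZ (fun m => SeriesZ (fun s => e m (s + - m)%Z)) = theta3 y ^ 2).
  { destruct (summableZ_theta3 y Hy) as [E _].
    assert (P : forall m, theta3 y * exp (- PI * (IZR m) ^ 2 * y) =
      SeriesZ (fun s => e m (s + - m)%Z)).
    { intros m; destruct (Hrow' m) as [_ ->]; ring. }
    split.
    - apply summableZ_ext with (1 := P), summableZ_scal_l; auto.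
    - rewrite <- (SeriesZ_ext _ _ P), SeriesZ_scal_l. fold (theta3 y). simpl; ring. }
  destruct Hs as [Hs1 <-].
  destruct (tonelliZ (fun m s => e m (s + - m)%Z)) as [T1 ->]; auto.
  { intros m n; unfold e; rewrite <- exp_plus; left; apply exp_pos. }
  { intros m; apply Hrow'. }
  (* [m^2 + (2 j - m)^2 = 2 j^2 + 2 (m - j)^2]; for odd [s] the same holds with [j + 1/2] in place
     of [j]. *)
  assert (Heven : forall j, summableZ (fun m => e m (2 * j + - m)%Z) /\
    SeriesZ (fun m => e m (2 * j + - m)%Z) =
    exp (- PI * (IZR j) ^ 2 * (2 * y)) * theta3 (2 * y)).
  { intros j.
    destruct (summableZ_theta3 (2 * y) Hy2) as [E _].
    destruct (SeriesZ_shift _ (- j) E) as [E1 S1]; cbv beta in *.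
    assert (P : forall m, exp (- PI * (IZR j) ^ 2 * (2 * y)) *
      exp (- PI * IZR (m + - j) ^ 2 * (2 * y)) = e m (2 * j + - m)%Z).
    { intros m; unfold e; rewrite <- !exp_plus; f_equal.
      rewrite !plus_IZR, mult_IZR, !opp_IZR; ring. }
    split; [apply summableZ_ext with (1 := P), summableZ_scal_l; auto|].
    rewrite <- (SeriesZ_ext _ _ P), SeriesZ_scal_l, S1; reflexivity. }
  assert (Hodd : forall j, summableZ (fun m => e m (2 * j + 1 + - m)%Z) /\
    SeriesZ (fun m => e m (2 * j + 1 + - m)%Z) =
    exp (- PI * (IZR j + 1 / 2) ^ 2 * (2 * y)) * theta2 (2 * y)).
  { intros j.
    destruct (summableZ_theta2 (2 * y) Hy2) as [E _].
    destruct (SeriesZ_shift _ (- j) E) as [E1 S1]; cbv beta in *.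
    assert (P : forall m, exp (- PI * (IZR j + 1 / 2) ^ 2 * (2 * y)) *
      exp (- PI * (IZR (m + - j) - 1 / 2) ^ 2 * (2 * y)) = e m (2 * j + 1 + - m)%Z).
    { intros m; unfold e; rewrite <- !exp_plus; f_equal.
      rewrite !plus_IZR, mult_IZR, !opp_IZR; field. }
    split; [apply summableZ_ext with (1 := P), summableZ_scal_l; auto|].
    rewrite <- (SeriesZ_ext _ _ P), SeriesZ_scal_l, S1; reflexivity. }
  rewrite SeriesZ_even_odd; auto.
  - f_equal.
    + rewrite (SeriesZ_ext _ _ (fun j => proj2 (Heven j))).
      rewrite (SeriesZ_ext _ (fun j => theta3 (2 * y) * exp (- PI * (IZR j) ^ 2 * (2 * y))))
        by (intros; ring).
      rewrite SeriesZ_scal_l. fold (theta3 (2 * y)); simpl; ring.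
    + rewrite (SeriesZ_ext _ _ (fun j => proj2 (Hodd j))).
      rewrite (SeriesZ_ext _ (fun j => theta2 (2 * y) *
        exp (- PI * (IZR j + 1 / 2) ^ 2 * (2 * y)))) by (intros; ring).
      rewrite SeriesZ_scal_l. destruct (SeriesZ_half_shift (2 * y) Hy2) as [_ ->].
      simpl; ring.
  - intros s. apply SeriesZ_nonneg.
    + intros m; unfold e; rewrite <- exp_plus; left; apply exp_pos.
    + destruct (Z.Even_or_Odd s) as [[j ->]|[j ->]]; [apply Heven|apply Hodd].
Qed.

(* The usual alternating series, split according to the parity of the index. *)
Definition theta4 (y : R) : R := theta3 (4 * y) - theta2 (4 * y).

(** By the parallelogram identity [theta3 y ^ 2 + theta4 y ^ 2] is twice
    [theta3 (4 y) ^ 2 + theta2 (4 y) ^ 2], that is [2 * theta3 (2 y) ^ 2]. *)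
Lemma theta4_sq y : 0 < y -> theta4 y ^ 2 = theta3 (2 * y) ^ 2 - theta2 (2 * y) ^ 2.
Proof.
  intros Hy. pose proof (theta3_sq y Hy) as E1.
  pose proof (theta3_sq (2 * y) ltac:(lra)) as E2.
  replace (2 * (2 * y)) with (4 * y) in E2 by ring.
  pose proof (theta3_split y Hy) as E3. unfold theta4. nra.
Qed.

Lemma theta3_theta4 y : 0 < y -> theta3 y * theta4 y = theta4 (2 * y) ^ 2.
Proof.
  intros Hy. rewrite theta4_sq by lra. replace (2 * (2 * y)) with (4 * y) by ring.
  rewrite theta3_split by auto. unfold theta4. ring.
Qed.

Lemma theta2_sq_double y : 0 < y -> 2 * theta2 (2 * y) ^ 2 = theta3 y ^ 2 - theta4 y ^ 2.
Proof. intros Hy. rewrite (theta3_sq y), (theta4_sq y) by auto. ring. Qed.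

Lemma theta3_sq_double y : 0 < y -> 2 * theta3 (2 * y) ^ 2 = theta3 y ^ 2 + theta4 y ^ 2.
Proof. intros Hy. rewrite (theta3_sq y), (theta4_sq y) by auto. ring. Qed.

Lemma theta2_sq y : 0 < y -> theta2 y ^ 2 = 2 * theta2 (2 * y) * theta3 (2 * y).
Proof.
  intros Hy. pose proof (theta2_sq_double (y / 2) ltac:(lra)) as E1.
  replace (2 * (y / 2)) with y in E1 by field.
  pose proof (theta3_split (y / 2) ltac:(lra)) as E2. unfold theta4 in E1.
  replace (4 * (y / 2)) with (2 * y) in * by field. rewrite E2 in E1. nra.
Qed.

Lemma jacobi_quartic y : 0 < y -> theta3 y ^ 4 = theta4 y ^ 4 + theta2 y ^ 4.
Proof.
  intros Hy.
  replace (theta3 y ^ 4) with ((theta3 y ^ 2) ^ 2) by ring.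
  replace (theta4 y ^ 4) with ((theta4 y ^ 2) ^ 2) by ring.
  replace (theta2 y ^ 4) with ((theta2 y ^ 2) ^ 2) by ring.
  rewrite (theta3_sq y), (theta4_sq y), (theta2_sq y) by auto. ring.
Qed.

(** * Derivatives and asymptotics of the theta functions *)

Lemma is_lim_mult_fin f g x (lf lg : R) : is_lim f x lf -> is_lim g x lg ->
  is_lim (fun y => f y * g y) x (lf * lg).
Proof. intros Hf Hg. apply (is_lim_mult f g x lf lg Hf Hg); exact I. Qed.

Lemma is_lim_inv_fin f x (lf : R) : is_lim f x lf -> lf <> 0 ->
  is_lim (fun y => / f y) x (/ lf).
Proof. intros Hf H. apply (is_lim_inv f x lf Hf). congruence. Qed.

Lemma is_lim_div_fin f g x (lf lg : R) : is_lim f x lf -> is_lim g x lg -> lg <> 0 ->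
  is_lim (fun y => f y / g y) x (lf / lg).
Proof. intros. apply is_lim_mult_fin; auto. apply is_lim_inv_fin; auto. Qed.

Lemma is_lim_pow_fin f x (lf : R) (n : nat) : is_lim f x lf ->
  is_lim (fun y => f y ^ n) x (lf ^ n).
Proof.
  intros Hf; induction n as [|n IH]; simpl; [apply is_lim_const|].
  apply is_lim_mult_fin; auto.
Qed.

Lemma is_lim_scale (a : R) : 0 < a -> is_lim (fun y => a * y) p_infty p_infty.
Proof.
  intros Ha. evar_last; [apply is_lim_scal_l, is_lim_id|].
  simpl. destruct (Rle_dec 0 a) as [H|]; [|lra].
  destruct (Rle_lt_or_eq_dec 0 a H); [reflexivity|lra].
Qed.

Lemma is_lim_comp_scale f (a : R) (l : Rbar) : 0 < a -> is_lim f p_infty l ->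
  is_lim (fun y => f (a * y)) p_infty l.
Proof.
  intros Ha Hf. apply is_lim_comp with p_infty; auto using is_lim_scale.
  exists 0; intros; discriminate.
Qed.

Lemma doubling_iter (f : R -> R) (y : R) (n : nat) : 0 < y ->
  (forall y, 0 < y -> f (2 * y) = f y) -> f (2 ^ n * y) = f y.
Proof.
  intros Hy H; induction n as [|n IH]; simpl; [f_equal; ring|].
  rewrite <- IH, Rmult_assoc. apply H. apply Rmult_lt_0_compat; auto.
  apply pow_lt; lra.
Qed.

Lemma is_lim_seq_pow2_mul (y : R) : 0 < y -> is_lim_seq (fun n => 2 ^ n * y) p_infty.
Proof.
  intros Hy. evar_last; [apply is_lim_seq_scal_r, is_lim_seq_geom_p; lra|].
  simpl. destruct (Rle_dec 0 y) as [H|]; [|lra].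
  destruct (Rle_lt_or_eq_dec 0 y H); [reflexivity|lra].
Qed.

Lemma is_lim_along_pow2 f (l : Rbar) (y : R) : 0 < y -> is_lim f p_infty l ->
  is_lim_seq (fun n => f (2 ^ n * y)) l.
Proof.
  intros Hy Hf. apply (is_lim_comp_seq f _ p_infty l); auto using is_lim_seq_pow2_mul.
  exists 0%nat; intros; discriminate.
Qed.

(** Along [2 ^ n * y] the function is constant and also tends to [l]. The differential equations of
    the theta functions rest on this. *)
Lemma doubling_invariant_eq_lim (f : R -> R) (l y : R) : 0 < y ->
  (forall y, 0 < y -> f (2 * y) = f y) -> is_lim f p_infty l -> f y = l.
Proof.
  intros Hy H L. apply (is_lim_along_pow2 f l y Hy) in L.
  apply is_lim_seq_ext with (v := fun _ => f y) in L.
  2:{ intros n; apply doubling_iter; auto. }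
  apply is_lim_seq_unique in L. rewrite Lim_seq_const in L. congruence.
Qed.

Lemma locally_pos y : 0 < y -> locally y (fun x => 0 < x).
Proof. intros Hy. apply (open_gt 0). auto. Qed.

Lemma is_derive_ext_pos (f h : R -> R) (y l : R) : 0 < y -> (forall x, 0 < x -> f x = h x) ->
  is_derive f y l -> is_derive h y l.
Proof.
  intros Hy H. apply is_derive_ext_loc. generalize (locally_pos y Hy).
  apply filter_imp; auto.
Qed.

Lemma derive_eq_of_eq_pos (f h : R -> R) (y l l' : R) : 0 < y -> (forall x, 0 < x -> f x = h x) ->
  is_derive f y l -> is_derive h y l' -> l = l'.
Proof.
  intros Hy H Hf Hh. apply (is_derive_ext_pos f h y l Hy H) in Hf.
  apply is_derive_unique in Hf; apply is_derive_unique in Hh; congruence.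
Qed.

Definition dtheta3 (y : R) : R := - 2 * PI * dirichlet ones exponent3 1 (PI * y).
Definition ddtheta3 (y : R) : R := 2 * PI ^ 2 * dirichlet ones exponent3 2 (PI * y).
Definition dtheta2 (y : R) : R := - 2 * PI * dirichlet ones exponent2 1 (PI * y).
Definition dtheta4 (y : R) : R := 4 * dtheta3 (4 * y) - 4 * dtheta2 (4 * y).

Lemma is_derive_dirichlet_pi c a p y : admissible c a -> 0 < y ->
  is_derive (fun y => dirichlet c a p (PI * y)) y (- PI * dirichlet c a (S p) (PI * y)).
Proof.
  intros Ha Hy. pose proof PI_RGT_0.
  evar_last.
  - apply (is_derive_comp (dirichlet c a p) (fun y => PI * y)).
    + apply is_derive_dirichlet; auto. nra.
    + apply is_derive_scal, (is_derive_id y).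
  - unfold scal, one; simpl; unfold mult; simpl; ring.
Qed.

Lemma is_derive_theta3 y : 0 < y -> is_derive theta3 y (dtheta3 y).
Proof.
  intros Hy.
  apply (is_derive_ext_pos (fun y => 1 + 2 * dirichlet ones exponent3 0 (PI * y))); auto.
  - intros x Hx; symmetry; apply summableZ_theta3; auto.
  - pose proof (is_derive_dirichlet_pi ones exponent3 0 y admissible_exponent3 Hy) as D.
    unfold dtheta3. evar_last.
    + apply (is_derive_plus (fun _ => 1)); [apply is_derive_const|].
      apply is_derive_scal, D.
    + unfold plus, zero; simpl; ring.
Qed.

Lemma is_derive_theta2 y : 0 < y -> is_derive theta2 y (dtheta2 y).
Proof.
  intros Hy.
  apply (is_derive_ext_pos (fun y => 2 * dirichlet ones exponent2 0 (PI * y))); auto.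
  - intros x Hx; symmetry; apply summableZ_theta2; auto.
  - pose proof (is_derive_dirichlet_pi ones exponent2 0 y admissible_exponent2 Hy) as D.
    unfold dtheta2. evar_last; [apply is_derive_scal, D|ring].
Qed.

Lemma is_derive_dtheta3 y : 0 < y -> is_derive dtheta3 y (ddtheta3 y).
Proof.
  intros Hy. pose proof (is_derive_dirichlet_pi ones exponent3 1 y admissible_exponent3 Hy) as D.
  unfold dtheta3, ddtheta3. evar_last; [apply is_derive_scal, D|ring].
Qed.

Lemma is_derive_scale (f : R -> R) (a y l : R) : is_derive f (a * y) l ->
  is_derive (fun y => f (a * y)) y (a * l).
Proof.
  intros D. evar_last.
  - apply (is_derive_comp f (fun y => a * y)); [exact D|].
    apply is_derive_scal, (is_derive_id y).
  - unfold scal, one; simpl; unfold mult; simpl; ring.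
Qed.

Lemma is_derive_theta4 y : 0 < y -> is_derive theta4 y (dtheta4 y).
Proof.
  intros Hy. unfold theta4, dtheta4.
  apply (is_derive_minus (fun y => theta3 (4 * y)) (fun y => theta2 (4 * y)));
    apply is_derive_scale; [apply is_derive_theta3|apply is_derive_theta2]; lra.
Qed.

Lemma dirichlet_pos a p t : admissible ones a -> 0 < t -> 0 < dirichlet ones a p t.
Proof.
  intros Ha Ht.
  assert (P : forall n, 0 < ones n * a n ^ p * exp (- a n * t)).
  { intros n. pose proof (admissible_pos _ _ n Ha). unfold ones.
    apply Rmult_lt_0_compat; [|apply exp_pos].
    apply Rmult_lt_0_compat; [lra|apply pow_lt; auto]. }
  eapply Rlt_le_trans; [apply (P 0%nat)|].
  apply (term_le_Series (fun n => ones n * a n ^ p * exp (- a n * t)) 0).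
  - intros n; left; apply P.
  - apply ex_series_dirichlet; auto.
Qed.

Lemma theta3_pos y : 0 < y -> 0 < theta3 y.
Proof.
  intros Hy. pose proof PI_RGT_0. destruct (summableZ_theta3 y Hy) as [_ ->].
  pose proof (dirichlet_pos exponent3 0 (PI * y) admissible_exponent3 ltac:(nra)). lra.
Qed.

Lemma theta2_pos y : 0 < y -> 0 < theta2 y.
Proof.
  intros Hy. pose proof PI_RGT_0. destruct (summableZ_theta2 y Hy) as [_ ->].
  pose proof (dirichlet_pos exponent2 0 (PI * y) admissible_exponent2 ltac:(nra)). lra.
Qed.

Lemma dtheta3_neg y : 0 < y -> dtheta3 y < 0.
Proof.
  intros Hy. pose proof PI_RGT_0. unfold dtheta3.
  pose proof (dirichlet_pos exponent3 1 (PI * y) admissible_exponent3 ltac:(nra)). nra.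
Qed.

Lemma is_lim_dirichlet_pi a p : admissible ones a ->
  is_lim (fun y => exp (a 0%nat * (PI * y)) * dirichlet ones a p (PI * y)) p_infty
    (a 0%nat ^ p).
Proof.
  intros Ha. pose proof (is_lim_dirichlet ones a p Ha) as L.
  apply (is_lim_comp_scale _ PI) in L; [|apply PI_RGT_0].
  unfold ones in L at 2. rewrite Rmult_1_l in L. exact L.
Qed.

Lemma is_lim_exp_neg_pi : is_lim (fun y => exp (- PI * y)) p_infty 0.
Proof. apply is_lim_exp_neg, PI_RGT_0. Qed.

Lemma is_lim_series3 p : is_lim (fun y => exp (PI * y) * dirichlet ones exponent3 p (PI * y)) p_infty 1.
Proof.
  pose proof (is_lim_dirichlet_pi exponent3 p admissible_exponent3) as L.
  replace (exponent3 0%nat) with 1 in L by (unfold exponent3; simpl; ring). rewrite pow1 in L.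
  apply is_lim_ext with (2 := L). intros y; do 2 f_equal; ring.
Qed.

Lemma is_lim_dtheta3 : is_lim (fun y => exp (PI * y) * dtheta3 y) p_infty (- 2 * PI).
Proof.
  pose proof (is_lim_scal_l _ (- 2 * PI) _ _ (is_lim_series3 1)) as L.
  simpl in L; rewrite Rmult_1_r in L.
  apply is_lim_ext with (2 := L). intros y; unfold dtheta3; ring.
Qed.

Lemma is_lim_ddtheta3 : is_lim (fun y => exp (PI * y) * ddtheta3 y) p_infty (2 * PI ^ 2).
Proof.
  pose proof (is_lim_scal_l _ (2 * PI ^ 2) _ _ (is_lim_series3 2)) as L.
  change (Rbar_mult (2 * PI ^ 2) 1) with (Finite (2 * PI ^ 2 * 1)) in L.
  rewrite Rmult_1_r in L.
  apply is_lim_ext with (2 := L). intros y; unfold ddtheta3; ring.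
Qed.

Lemma is_lim_of_exp_mul f (l : R) : is_lim (fun y => exp (PI * y) * f y) p_infty l ->
  is_lim f p_infty 0.
Proof.
  intros L. pose proof (is_lim_mult_fin _ _ _ _ _ is_lim_exp_neg_pi L) as M.
  rewrite Rmult_0_l in M. apply is_lim_ext with (2 := M). intros y.
  rewrite <- Rmult_assoc, <- exp_plus. replace (- PI * y + PI * y) with 0 by ring.
  rewrite exp_0; ring.
Qed.

Lemma is_lim_ext_pos f h l : (forall y, 0 < y -> f y = h y) ->
  is_lim f p_infty l -> is_lim h p_infty l.
Proof. intros H. apply is_lim_ext_loc. exists 0; auto. Qed.

Lemma is_lim_theta3 : is_lim theta3 p_infty 1.
Proof.
  pose proof (is_lim_of_exp_mul _ _ (is_lim_series3 0)) as L.
  apply (is_lim_ext_pos (fun y => 1 + 2 * dirichlet ones exponent3 0 (PI * y))).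
  { intros y Hy; symmetry; apply summableZ_theta3; auto. }
  replace (Finite 1) with (Finite (1 + 2 * 0)) by (f_equal; ring).
  apply is_lim_plus'; [apply is_lim_const|].
  apply is_lim_mult_fin; [apply is_lim_const|exact L].
Qed.

Lemma is_lim_series2 p : is_lim (fun y => exp (PI * y / 4) * dirichlet ones exponent2 p (PI * y)) p_infty
  ((1 / 4) ^ p).
Proof.
  pose proof (is_lim_dirichlet_pi exponent2 p admissible_exponent2) as L.
  replace (exponent2 0%nat) with (1 / 4) in L by (unfold exponent2; simpl; field).
  apply is_lim_ext with (2 := L). intros y; do 2 f_equal; field.
Qed.

Lemma is_lim_theta2 : is_lim (fun y => exp (PI * y / 4) * theta2 y) p_infty 2.
Proof.
  pose proof (is_lim_scal_l _ 2 _ _ (is_lim_series2 0)) as L.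
  simpl in L; rewrite Rmult_1_r in L.
  apply is_lim_ext_pos with (2 := L). intros y Hy.
  destruct (summableZ_theta2 y Hy) as [_ ->]; ring.
Qed.

Lemma is_lim_dtheta2 : is_lim (fun y => exp (PI * y / 4) * dtheta2 y) p_infty (- PI / 2).
Proof.
  pose proof (is_lim_scal_l _ (- 2 * PI) _ _ (is_lim_series2 1)) as L.
  simpl in L. replace (- 2 * PI * (1 / 4 * 1)) with (- PI / 2) in L by field.
  apply is_lim_ext with (2 := L). intros y; unfold dtheta2; ring.
Qed.

Lemma is_lim_theta2_4 : is_lim (fun y => exp (PI * y) * theta2 (4 * y)) p_infty 2.
Proof.
  pose proof (is_lim_comp_scale _ 4 _ ltac:(lra) is_lim_theta2) as L.
  apply is_lim_ext with (2 := L). intros y; do 2 f_equal; field.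
Qed.

Lemma is_lim_theta4 : is_lim theta4 p_infty 1.
Proof.
  unfold theta4. replace (Finite 1) with (Finite (1 - 0)) by (f_equal; ring).
  apply is_lim_minus'.
  - apply (is_lim_comp_scale theta3 4); [lra|apply is_lim_theta3].
  - apply (is_lim_of_exp_mul _ 2), is_lim_theta2_4.
Qed.

Lemma is_lim_dtheta4 : is_lim (fun y => exp (PI * y) * dtheta4 y) p_infty (2 * PI).
Proof.
  pose proof (is_lim_comp_scale _ 4 _ ltac:(lra) is_lim_dtheta2) as L2.
  pose proof (is_lim_comp_scale _ 4 _ ltac:(lra) is_lim_dtheta3) as L3.
  assert (L4 : is_lim (fun y => exp (- (3 * PI) * y)) p_infty 0).
  { apply is_lim_exp_neg. pose proof PI_RGT_0; lra. }
  replace (Finite (2 * PI)) with (Finite (4 * (0 * (- 2 * PI)) - 4 * (- PI / 2)))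
    by (f_equal; field).
  apply is_lim_ext with (fun y => 4 * (exp (- (3 * PI) * y) *
      (exp (PI * (4 * y)) * dtheta3 (4 * y))) - 4 * (exp (PI * (4 * y) / 4) * dtheta2 (4 * y))).
  - intros y. rewrite <- (Rmult_assoc (exp _) (exp _)), <- exp_plus.
    replace (- (3 * PI) * y + PI * (4 * y)) with (PI * y) by ring.
    replace (PI * (4 * y) / 4) with (PI * y) by field. unfold dtheta4; ring.
  - apply is_lim_minus'; apply is_lim_mult_fin; try apply is_lim_const; auto.
    apply is_lim_mult_fin; auto.
Qed.

(** Positivity holds far out by the limit and is pulled back along halvings, because
    [theta3 y * theta4 y] is the square of [theta4 (2 y)]. *)
Lemma theta4_pos y : 0 < y -> 0 < theta4 y.
Proof.
  intros Hy.
  assert (E : exists n, 0 < theta4 (2 ^ n * y)).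
  { pose proof (is_lim_along_pow2 theta4 1 y Hy is_lim_theta4) as L.
    apply is_lim_seq_spec in L. destruct (L (mkposreal (1 / 2) ltac:(lra))) as [N HN].
    exists N. specialize (HN N (le_n N)). simpl in HN. apply Rabs_lt_between' in HN. lra. }
  destruct E as [n Hn]. induction n as [|n IH]; [simpl in Hn; rewrite Rmult_1_l in Hn; auto|].
  apply IH. assert (Hp : 0 < 2 ^ n * y) by (apply Rmult_lt_0_compat; auto; apply pow_lt; lra).
  pose proof (theta3_theta4 _ Hp) as E. pose proof (theta3_pos _ Hp).
  simpl in Hn. rewrite Rmult_assoc in Hn. nra.
Qed.

(** * Differential equations *)

Lemma dtheta4_double y : 0 < y ->
  4 * theta4 (2 * y) * dtheta4 (2 * y) = dtheta3 y * theta4 y + theta3 y * dtheta4 y.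
Proof.
  intros Hy. pose proof (is_derive_theta4 (2 * y) ltac:(lra)) as D2.
  apply is_derive_scale in D2.
  pose proof (is_derive_theta4 y Hy) as D4. pose proof (is_derive_theta3 y Hy) as D3.
  symmetry.
  apply (derive_eq_of_eq_pos (fun y => theta3 y * theta4 y) (fun y => theta4 (2 * y) ^ 2) y);
    auto using theta3_theta4.
  - evar_last; [apply (is_derive_mult theta3 theta4); eauto; intros; apply Rmult_comm|].
    unfold plus, mult; simpl; ring.
  - evar_last; [apply is_derive_pow, D2|]. simpl; ring.
Qed.

Lemma dtheta3_double y : 0 < y ->
  4 * theta3 (2 * y) * dtheta3 (2 * y) = theta3 y * dtheta3 y + theta4 y * dtheta4 y.
Proof.
  intros Hy. pose proof (is_derive_theta3 (2 * y) ltac:(lra)) as D2.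
  apply is_derive_scale in D2.
  pose proof (is_derive_theta4 y Hy) as D4. pose proof (is_derive_theta3 y Hy) as D3.
  cut (8 * theta3 (2 * y) * dtheta3 (2 * y) =
    2 * theta3 y * dtheta3 y + 2 * theta4 y * dtheta4 y); [lra|].
  apply (derive_eq_of_eq_pos (fun y => 2 * theta3 (2 * y) ^ 2)
    (fun y => theta3 y ^ 2 + theta4 y ^ 2) y); auto using theta3_sq_double.
  - evar_last; [apply is_derive_scal, is_derive_pow, D2|]. simpl; ring.
  - evar_last; [apply (is_derive_plus (fun y => theta3 y ^ 2) (fun y => theta4 y ^ 2));
      apply is_derive_pow; eauto|].
    unfold plus; simpl; ring.
Qed.

Lemma theta2_4_eq y : 0 < y -> theta2 y ^ 4 = theta3 y ^ 4 - theta4 y ^ 4.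
Proof. intros Hy; rewrite jacobi_quartic by auto; ring. Qed.

(* Both sides scale in the same way under [y -> 2 y], so their quotient is determined
   by its limit at infinity. *)
Lemma theta_log_derive y : 0 < y ->
  dtheta4 y / theta4 y - dtheta3 y / theta3 y = PI / 4 * theta2 y ^ 4.
Proof.
  intros Hy.
  set (f := fun y => (dtheta4 y / theta4 y - dtheta3 y / theta3 y) / theta2 y ^ 4).
  assert (E : f y = PI / 4).
  { apply doubling_invariant_eq_lim; auto; unfold f; clear f.
    - clear y Hy; intros y Hy. assert (H2 : 0 < 2 * y) by lra.
      pose proof (theta3_pos y Hy). pose proof (theta4_pos y Hy).
      pose proof (theta2_pos y Hy) as P2. pose proof (theta2_pos _ H2) as P2'.
      pose proof (theta3_pos _ H2). pose proof (theta4_pos _ H2).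
      assert (Q : 0 < theta3 y ^ 2 - theta4 y ^ 2).
      { rewrite <- theta2_sq_double by auto. pose proof (pow_lt _ 2 P2'); lra. }
      replace (theta2 (2 * y) ^ 4) with (((theta3 y ^ 2 - theta4 y ^ 2) / 2) ^ 2).
      2:{ rewrite <- theta2_sq_double by auto. field. }
      rewrite (theta2_4_eq y) by auto.
      replace (dtheta4 (2 * y) / theta4 (2 * y)) with
        ((4 * theta4 (2 * y) * dtheta4 (2 * y)) / (4 * theta4 (2 * y) ^ 2)) by (field; lra).
      replace (dtheta3 (2 * y) / theta3 (2 * y)) with
        ((4 * theta3 (2 * y) * dtheta3 (2 * y)) / (2 * (2 * theta3 (2 * y) ^ 2)))
        by (field; lra).
      rewrite dtheta4_double, dtheta3_double, <- theta3_theta4, theta3_sq_double by auto.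
      assert (theta3 y ^ 2 + theta4 y ^ 2 > 0) by nra.
      field. repeat split; try lra.
      replace (theta3 y ^ 4 - theta4 y ^ 4) with
        ((theta3 y ^ 2 - theta4 y ^ 2) * (theta3 y ^ 2 + theta4 y ^ 2)) by ring. nra.
    (* Numerator and denominator both decay like [exp (- PI y)]; after cancelling this factor the
       limit is [(2 PI + 2 PI) / 16]. *)
    - apply (is_lim_ext_pos (fun y => ((exp (PI * y) * dtheta4 y) / theta4 y -
        (exp (PI * y) * dtheta3 y) / theta3 y) / (exp (PI * y / 4) * theta2 y) ^ 4)).
      + intros x Hx. rewrite Rpow_mult_distr.
        replace (exp (PI * x / 4) ^ 4) with (exp (PI * x)).
        2:{ rewrite <- exp_mul_INR; f_equal; simpl; field. }
        pose proof (exp_pos (PI * x)). pose proof (theta3_pos x Hx).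
        pose proof (theta4_pos x Hx). pose proof (theta2_pos x Hx).
        field; repeat split; try lra.
      + replace (Finite (PI / 4)) with
          (Finite ((2 * PI / 1 - (- 2 * PI) / 1) / 2 ^ 4)) by (f_equal; field).
        apply is_lim_div_fin; [|apply is_lim_pow_fin, is_lim_theta2|lra].
        apply is_lim_minus'; apply is_lim_div_fin; try lra.
        * apply is_lim_dtheta4.
        * apply is_lim_theta4.
        * apply is_lim_dtheta3.
        * apply is_lim_theta3. }
  rewrite <- E. unfold f. field.
  pose proof (theta3_pos y Hy). pose proof (theta4_pos y Hy).
  pose proof (theta2_pos y Hy). repeat split; lra.
Qed.

Lemma dtheta4_eq y : 0 < y ->
  dtheta4 y = theta4 y * (dtheta3 y / theta3 y + PI / 4 * theta2 y ^ 4).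
Proof.
  intros Hy. rewrite <- theta_log_derive by auto. pose proof (theta3_pos y Hy).
  pose proof (theta4_pos y Hy). field; lra.
Qed.

(** The derivative of [dtheta3_double], taken after [dtheta4] has been eliminated by [dtheta4_eq],
    so that no second derivative of [theta4] appears. *)
Lemma ddtheta3_double y : 0 < y ->
  8 * (dtheta3 (2 * y) ^ 2 + theta3 (2 * y) * ddtheta3 (2 * y)) =
  dtheta3 y ^ 2 + theta3 y * ddtheta3 y +
  (2 * theta4 y * dtheta4 y * (dtheta3 y / theta3 y + PI / 4 * theta2 y ^ 4) +
   theta4 y ^ 2 * (ddtheta3 y / theta3 y - (dtheta3 y / theta3 y) ^ 2 +
     PI * (theta3 y ^ 3 * dtheta3 y - theta4 y ^ 3 * dtheta4 y))).
Proof.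
  intros Hy.
  pose proof (is_derive_theta4 y Hy) as D4. pose proof (is_derive_theta3 y Hy) as D3.
  pose proof (is_derive_dtheta3 y Hy) as DD3.
  pose proof (is_derive_theta3 (2 * y) ltac:(lra)) as D2. apply is_derive_scale in D2.
  pose proof (is_derive_dtheta3 (2 * y) ltac:(lra)) as DD2. apply is_derive_scale in DD2.
  pose proof (theta3_pos y Hy) as P3.
  apply (derive_eq_of_eq_pos (fun y => 4 * (theta3 (2 * y) * dtheta3 (2 * y)))
    (fun y => theta3 y * dtheta3 y + theta4 y ^ 2 *
      (dtheta3 y / theta3 y + PI / 4 * (theta3 y ^ 4 - theta4 y ^ 4))) y); auto.
  - intros x Hx. rewrite <- theta2_4_eq by auto.
    replace (4 * _) with (4 * theta3 (2 * x) * dtheta3 (2 * x)) by ring.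
    rewrite dtheta3_double by auto. rewrite (dtheta4_eq x) at 1 by auto. ring.
  - evar_last.
    + apply is_derive_scal.
      apply (is_derive_mult (fun y => theta3 (2 * y)) (fun y => dtheta3 (2 * y)));
        eauto; intros; apply Rmult_comm.
    + unfold plus, mult; simpl; ring.
  - rewrite theta2_4_eq by auto. auto_derive.
    + repeat split; try lra; eexists; eauto.
    + rewrite (is_derive_unique (fun x : R => theta3 x) _ _ D3),
        (is_derive_unique (fun x : R => theta4 x) _ _ D4),
        (is_derive_unique (fun x : R => dtheta3 x) _ _ DD3).
      field; lra.
Qed.

Lemma is_lim_sq_exp_neg : is_lim (fun y => y ^ 2 * exp (- PI * y)) p_infty 0.
Proof.
  pose proof PI_RGT_0 as Hpi.
  destruct (pow_mul_exp_bounded 2 (PI / 2)) as [C HC]; [lra|].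
  apply (is_lim_le_le_loc (fun _ => 0) (fun y => C * exp (- (PI / 2) * y))).
  - exists 0; intros y Hy. split.
    + apply Rmult_le_pos; [apply pow2_ge_0|left; apply exp_pos].
    + replace (exp (- PI * y)) with (exp (- (PI / 2) * y) * exp (- (PI / 2) * y)).
      * rewrite <- Rmult_assoc. apply Rmult_le_compat_r; [left; apply exp_pos|].
        apply HC; lra.
      * rewrite <- exp_plus; f_equal; field.
  - apply is_lim_const.
  - replace (Finite 0) with (Finite (C * 0)) by (f_equal; ring).
    apply is_lim_mult_fin; [apply is_lim_const|apply is_lim_exp_neg; lra].
Qed.

(* The difference of the two sides is divided by 4 under [y -> 2 y] and decays exponentially. *)
Lemma ddtheta3_eq y : 0 < y ->
  2 * (ddtheta3 y / theta3 y) - 6 * (dtheta3 y / theta3 y) ^ 2 =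
  PI ^ 2 / 4 * theta4 y ^ 4 * theta2 y ^ 4.
Proof.
  intros Hy.
  set (E := fun y => 2 * (ddtheta3 y / theta3 y) - 6 * (dtheta3 y / theta3 y) ^ 2 -
    PI ^ 2 / 4 * theta4 y ^ 4 * theta2 y ^ 4).
  (* The weight [y ^ 2] turns the scaling by 1/4 into invariance, and the exponential decay of [E]
     outweighs it. *)
  assert (Z : y ^ 2 * E y = 0).
  { apply (doubling_invariant_eq_lim (fun y => y ^ 2 * E y)); auto.
    - clear y Hy; intros y Hy. assert (H2 : 0 < 2 * y) by lra.
      pose proof (theta3_pos y Hy). pose proof (theta3_pos _ H2).
      cut (4 * E (2 * y) = E y); [intros <-; ring|]. unfold E.
      replace (theta2 (2 * y) ^ 4) with (((theta3 y ^ 2 - theta4 y ^ 2) / 2) ^ 2).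
      2:{ rewrite <- theta2_sq_double by auto. field. }
      replace (theta4 (2 * y) ^ 4) with ((theta3 y * theta4 y) ^ 2).
      2:{ rewrite theta3_theta4 by auto. ring. }
      assert (P2 : theta3 y ^ 2 + theta4 y ^ 2 > 0) by nra.
      replace (2 * (ddtheta3 (2 * y) / theta3 (2 * y)) - 6 * (dtheta3 (2 * y) / theta3 (2 * y)) ^ 2)
        with (8 * (dtheta3 (2 * y) ^ 2 + theta3 (2 * y) * ddtheta3 (2 * y)) /
          (2 * (2 * theta3 (2 * y) ^ 2)) -
          2 * (4 * theta3 (2 * y) * dtheta3 (2 * y)) ^ 2 / (2 * theta3 (2 * y) ^ 2) ^ 2)
        by (field; lra).
      rewrite ddtheta3_double, dtheta3_double, theta3_sq_double by auto.
      rewrite !(dtheta4_eq y), !(theta2_4_eq y) by auto.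
      field. split; lra.
    - apply is_lim_ext_pos with (fun y => (y ^ 2 * exp (- PI * y)) * (exp (PI * y) * E y)).
      { intros x Hx.
        replace (x ^ 2 * exp (- PI * x) * (exp (PI * x) * E x)) with
          (x ^ 2 * E x * (exp (- PI * x) * exp (PI * x))) by ring.
        rewrite <- exp_plus. replace (- PI * x + PI * x) with 0 by ring.
        rewrite exp_0; ring. }
      (* Any finite value would serve here, because it is multiplied by the limit 0. *)
      set (l := 2 * (2 * PI ^ 2 / 1) - 6 * (- 2 * PI / 1 * (0 / 1)) - PI ^ 2 / 4 * 1 ^ 4 * 2 ^ 4).
      replace (Finite 0) with (Finite (0 * l)) by (f_equal; ring).
      apply is_lim_mult_fin; [apply is_lim_sq_exp_neg|].
      apply is_lim_ext_pos with (fun y => 2 * ((exp (PI * y) * ddtheta3 y) / theta3 y) -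
        6 * ((exp (PI * y) * dtheta3 y) / theta3 y * (dtheta3 y / theta3 y)) -
        PI ^ 2 / 4 * theta4 y ^ 4 * (exp (PI * y / 4) * theta2 y) ^ 4).
      { intros x Hx. rewrite Rpow_mult_distr.
        replace (exp (PI * x / 4) ^ 4) with (exp (PI * x)).
        2:{ rewrite <- exp_mul_INR; f_equal; simpl; field. }
        pose proof (theta3_pos x Hx). unfold E. field; lra. }
      assert (L3 := is_lim_theta3). assert (L4 := is_lim_theta4).
      assert (Ld := is_lim_of_exp_mul _ _ is_lim_dtheta3).
      apply is_lim_minus'; [apply is_lim_minus'|].
      + apply is_lim_mult_fin; [apply is_lim_const|].
        apply is_lim_div_fin; auto using is_lim_ddtheta3; lra.
      + apply is_lim_mult_fin; [apply is_lim_const|].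
        apply is_lim_mult_fin; apply is_lim_div_fin; auto using is_lim_dtheta3; lra.
      + apply is_lim_mult_fin; [|apply is_lim_pow_fin, is_lim_theta2].
        apply is_lim_mult_fin; [apply is_lim_const|apply is_lim_pow_fin; auto]. }
  cbv beta in Z. apply Rmult_integral in Z. destruct Z as [Z|Z].
  - pose proof (pow_lt y 2 Hy); lra.
  - unfold E in Z; lra.
Qed.

(** * The Gaussian integral *)

Definition gauss (t : R) : R := exp (- PI * t ^ 2).
Definition gauss_int (x : R) : R := RInt gauss 0 x.
(** From the classical proof by differentiation under the integral sign: the integral of this kernel
    over [0, 1], divided by [PI], has the derivative opposite to that of [gauss_int ^ 2]. *)
Definition gauss_kernel (x t : R) : R := exp (- PI * (x ^ 2 * (1 + t ^ 2))) / (1 + t ^ 2).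

Lemma ex_RInt_cont (f : R -> R) (a b : R) : (forall t, continuous f t) -> ex_RInt f a b.
Proof. intros H. apply (ex_RInt_continuous (V := R_CompleteNormedModule)); auto. Qed.

Lemma continuous_gauss (t : R) : continuous gauss t.
Proof. apply (ex_derive_continuous gauss). unfold gauss; auto_derive; auto. Qed.

Lemma is_derive_gauss_int (x : R) : is_derive gauss_int x (gauss x).
Proof.
  apply (is_derive_RInt gauss gauss_int 0 x).
  - apply filter_forall; intros y.
    apply (RInt_correct (V := R_CompleteNormedModule) gauss 0 y), ex_RInt_cont.
    intros; apply continuous_gauss.
  - apply continuous_gauss.
Qed.

Lemma gauss_int_0 : gauss_int 0 = 0.
Proof. unfold gauss_int. apply (RInt_point (V := R_CompleteNormedModule)). Qed.

Lemma one_plus_sq_pos (t : R) : 0 < 1 + t ^ 2.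
Proof. pose proof (pow2_ge_0 t); lra. Qed.

Lemma is_derive_gauss_kernel (x t : R) :
  is_derive (fun x => gauss_kernel x t) x (- 2 * PI * x * gauss x * gauss (x * t)).
Proof.
  pose proof (one_plus_sq_pos t).
  assert (E : gauss x * gauss (x * t) = exp (- PI * (x ^ 2 * (1 + t ^ 2)))).
  { unfold gauss. rewrite <- exp_plus. f_equal; ring. }
  rewrite Rmult_assoc, E. unfold gauss_kernel. auto_derive; [lra|].
  change (x * (x * 1)) with (x ^ 2); change (t * (t * 1)) with (t ^ 2).
  field. lra.
Qed.

Lemma continuous_gauss_kernel (x t : R) : continuous (gauss_kernel x) t.
Proof.
  pose proof (one_plus_sq_pos t).
  apply (ex_derive_continuous (gauss_kernel x)). unfold gauss_kernel; auto_derive; lra.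
Qed.

Lemma ex_RInt_gauss_kernel x : ex_RInt (gauss_kernel x) 0 1.
Proof. apply ex_RInt_cont; intros; apply continuous_gauss_kernel. Qed.

Lemma is_derive_gauss_kernel_int (x : R) :
  is_derive (fun x => RInt (gauss_kernel x) 0 1) x (- 2 * PI * gauss x * gauss_int x).
Proof.
  evar_last.
  - apply (is_derive_RInt_param gauss_kernel 0 1 x).
    + apply filter_forall; intros y t _. eexists; apply is_derive_gauss_kernel.
    + intros t _.
      apply (continuity_2d_pt_ext (fun u v => - 2 * PI * u * gauss u * gauss (u * v))).
      { intros u v; symmetry; apply is_derive_unique, is_derive_gauss_kernel. }
      assert (Hg : forall z, continuity_pt gauss z).
      { intros z; apply continuity_pt_filterlim, continuous_gauss. }
      repeat apply continuity_2d_pt_mult;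
        try apply continuity_2d_pt_const; try apply continuity_2d_pt_id1.
      * apply (continuity_1d_2d_pt_comp gauss (fun u v => u)); auto.
        apply continuity_2d_pt_id1.
      * apply (continuity_1d_2d_pt_comp gauss (fun u v => u * v)); auto.
        apply continuity_2d_pt_mult; [apply continuity_2d_pt_id1|apply continuity_2d_pt_id2].
    + apply filter_forall; intros y. apply ex_RInt_gauss_kernel.
  (* The substitution [u = x t] produces [gauss_int x]; the summand 0 gives the shape of the rule
     for linear substitutions. *)
  - rewrite (RInt_ext _ (fun t => - 2 * PI * gauss x * (x * gauss (x * t + 0)))).
    2:{ intros t _.
        rewrite (is_derive_unique (fun u : R => gauss_kernel u t) _ _
          (is_derive_gauss_kernel x t)).
        rewrite Rplus_0_r. match goal with |- @eq _ ?a ?b => change (@eq R a b) end. ring. }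
    assert (E : ex_RInt (fun t => x * gauss (x * t + 0)) 0 1).
    { apply ex_RInt_cont; intros t.
      apply (ex_derive_continuous (fun t => x * gauss (x * t + 0))).
      unfold gauss. auto_derive; auto. }
    transitivity (- 2 * PI * gauss x * RInt (fun t => x * gauss (x * t + 0)) 0 1).
    { apply (RInt_scal (V := R_CompleteNormedModule)); auto. }
    f_equal. unfold gauss_int.
    transitivity (RInt gauss (x * 0 + 0) (x * 1 + 0)).
    { apply (RInt_comp_lin (V := R_CompleteNormedModule) gauss x 0 0 1).
      apply ex_RInt_cont, continuous_gauss. }
    f_equal; ring.
Qed.

Lemma RInt_gauss_kernel_0 : RInt (gauss_kernel 0) 0 1 = PI / 4.
Proof.
  rewrite <- atan_1. apply is_RInt_unique.
  apply (is_RInt_ext (fun t => / (1 + t ^ 2))).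
  { intros t _. unfold gauss_kernel.
    replace (- PI * (0 ^ 2 * (1 + t ^ 2))) with 0 by ring. rewrite exp_0. unfold Rdiv.
    symmetry; apply Rmult_1_l. }
  evar_last.
  - apply (is_RInt_derive atan (fun t => / (1 + t ^ 2))).
    + intros t _. evar_last; [apply is_derive_atan|unfold Rsqr; f_equal; ring].
    + intros t _. pose proof (one_plus_sq_pos t).
      apply (ex_derive_continuous (fun t => / (1 + t ^ 2))). auto_derive; lra.
  - rewrite atan_0. unfold minus, plus, opp; simpl; ring.
Qed.

Lemma gauss_int_identity x : gauss_int x ^ 2 + RInt (gauss_kernel x) 0 1 / PI = 1 / 4.
Proof.
  pose proof PI_RGT_0 as Hpi.
  set (f := fun x => gauss_int x ^ 2 + RInt (gauss_kernel x) 0 1 / PI).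
  assert (D : forall y, is_derive f y 0).
  { intros y. unfold f. evar_last.
    - apply (is_derive_plus (fun x => gauss_int x ^ 2) (fun x => RInt (gauss_kernel x) 0 1 / PI)).
      + apply is_derive_pow, is_derive_gauss_int.
      + unfold Rdiv. apply (is_derive_ext (fun x => / PI * RInt (gauss_kernel x) 0 1)).
        { intros; apply Rmult_comm. }
        apply is_derive_scal, is_derive_gauss_kernel_int.
    - unfold plus; simpl. field. lra. }
  assert (E : f x = f 0).
  { destruct (MVT_gen f 0 x (fun _ => 0)) as [c [_ Hc]]; [auto| |lra].
    intros z _. apply continuity_pt_filterlim, (ex_derive_continuous f). eexists; apply D. }
  fold (f x). rewrite E. unfold f. rewrite gauss_int_0, RInt_gauss_kernel_0. field. lra.
Qed.

Lemma gauss_int_nonneg x : 0 <= x -> 0 <= gauss_int x.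
Proof.
  intros Hx. apply RInt_ge_0; auto.
  - apply ex_RInt_cont; intros; apply continuous_gauss.
  - intros; left; apply exp_pos.
Qed.

Lemma is_lim_gauss_int : is_lim gauss_int p_infty (1 / 2).
Proof.
  pose proof PI_RGT_0 as Hpi.
  assert (K : is_lim (fun x => RInt (gauss_kernel x) 0 1) p_infty 0).
  { apply (is_lim_le_le_loc (fun _ => 0) (fun x => exp (- PI * x))).
    - exists 1; intros x Hx. split.
      + apply RInt_ge_0; [lra|apply ex_RInt_gauss_kernel|].
        intros t _; apply Rmult_le_pos; [left; apply exp_pos|].
        left; apply Rinv_0_lt_compat, one_plus_sq_pos.
      + apply Rle_trans with (RInt (fun _ => exp (- PI * x)) 0 1).
        * apply RInt_le; [lra|apply ex_RInt_gauss_kernel|apply ex_RInt_const|].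
          intros t _. pose proof (one_plus_sq_pos t) as Ht. unfold gauss_kernel.
          pose proof (pow2_ge_0 t).
          rewrite <- (Rmult_1_r (exp (- PI * x))). apply Rmult_le_compat.
          -- left; apply exp_pos.
          -- left; apply Rinv_0_lt_compat; auto.
          -- apply exp_le. assert (x <= x ^ 2 * (1 + t ^ 2)) by nra. nra.
          -- rewrite <- Rinv_1. apply Rinv_le_contravar; lra.
        * rewrite RInt_const. unfold scal; simpl; unfold mult; simpl. lra.
    - apply is_lim_const.
    - apply is_lim_exp_neg_pi. }
  apply (is_lim_ext_pos (fun x => sqrt (1 / 4 - RInt (gauss_kernel x) 0 1 * / PI))).
  - intros x Hx. rewrite <- (gauss_int_identity x). unfold Rdiv.
    replace (_ + _ - _) with (gauss_int x ^ 2) by ring.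
    apply sqrt_pow2, gauss_int_nonneg; lra.
  - replace (1 / 2) with (sqrt (1 / 4 - 0 * / PI)).
    2:{ rewrite Rmult_0_l, Rminus_0_r. replace (1 / 4) with ((1 / 2) ^ 2) by field.
        apply sqrt_pow2; lra. }
    apply (is_lim_comp_continuous _ sqrt).
    + apply is_lim_minus'; [apply is_lim_const|].
      apply is_lim_mult_fin; [exact K|apply is_lim_const].
    + apply continuity_pt_filterlim. apply continuity_pt_sqrt. lra.
Qed.

Lemma gauss_decr x y : 0 <= x <= y -> gauss y <= gauss x.
Proof. intros H. pose proof PI_RGT_0. apply exp_le. assert (x ^ 2 <= y ^ 2) by nra. nra. Qed.

Lemma gauss_int_step x h : 0 <= x -> 0 < h ->
  h * gauss (x + h) <= gauss_int (x + h) - gauss_int x <= h * gauss x.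
Proof.
  intros Hx Hh.
  destruct (MVT_gen gauss_int x (x + h) gauss) as [c [Hc ->]].
  - intros; apply is_derive_gauss_int.
  - intros z _. apply continuity_pt_filterlim, (ex_derive_continuous gauss_int).
    eexists; apply is_derive_gauss_int.
  - rewrite Rmin_left, Rmax_right in Hc by lra.
    pose proof (gauss_decr c (x + h) ltac:(lra)). pose proof (gauss_decr x c ltac:(lra)). nra.
Qed.

(** For the decreasing [gauss] the left and right Riemann sums of mesh [h] enclose the half-line
    integral 1/2 and differ by [h * gauss 0 = h]. *)
Lemma gauss_riemann_sum h : 0 < h ->
  1 - h <= h * theta3 (h ^ 2) <= 1 + h.
Proof.
  intros Hh. assert (Hy : 0 < h ^ 2) by (apply pow_lt; auto).
  pose proof PI_RGT_0 as Hpi.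
  destruct (summableZ_theta3 _ Hy) as [_ ->].
  set (u := fun n => gauss ((INR n + 1) * h)).
  assert (Hu : forall n, ones n * exponent3 n ^ 0 * exp (- exponent3 n * (PI * h ^ 2)) = u n).
  { intros n. unfold ones, exponent3, u, gauss. rewrite pow_O, !Rmult_1_l. f_equal; ring. }
  assert (E : ex_series u).
  { apply ex_series_ext with (1 := Hu).
    apply ex_series_dirichlet; [apply admissible_exponent3|nra]. }
  assert (B : forall N, h * sum_n u N <= gauss_int ((INR N + 1) * h) /\
    gauss_int ((INR N + 1) * h) <= h + h * sum_n u N - h * u N).
  { induction N as [|N [IH1 IH2]].
    - rewrite !sum_O. pose proof (gauss_int_step 0 h ltac:(lra) Hh) as G.
      rewrite gauss_int_0 in G. unfold u. simpl INR.
      replace ((0 + 1) * h) with (0 + h) by ring.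
      replace (gauss 0) with 1 in G; [lra|].
      symmetry; unfold gauss. rewrite <- exp_0; f_equal; ring.
    - rewrite !sum_Sn. change plus with Rplus. rewrite S_INR.
      pose proof (pos_INR N) as HN.
      pose proof (gauss_int_step ((INR N + 1) * h) h ltac:(nra) Hh) as G.
      replace ((INR N + 1 + 1) * h) with ((INR N + 1) * h + h) by ring.
      assert (Eu : u (S N) = gauss ((INR N + 1) * h + h)).
      { unfold u. rewrite S_INR. f_equal; ring. }
      fold (u N) in G. rewrite Eu. lra. }
  assert (Hi : is_lim_seq (fun N => gauss_int ((INR N + 1) * h)) (1 / 2)).
  { apply (is_lim_comp_seq gauss_int _ p_infty); [apply is_lim_gauss_int| |].
    - exists 0%nat; intros; discriminate.
    - apply (is_lim_seq_le_p_loc (fun N => INR N * h)).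
      + exists 0%nat; intros; nra.
      + evar_last; [apply is_lim_seq_scal_r, is_lim_seq_INR|].
        simpl. destruct (Rle_dec 0 h) as [H|]; [|lra].
        destruct (Rle_lt_or_eq_dec 0 h H); [reflexivity|lra]. }
  assert (Hs : is_lim_seq (sum_n u) (Series u)) by (apply Series_correct in E; exact E).
  assert (I1 : h * Series u <= 1 / 2).
  { apply (is_lim_seq_le (fun N => h * sum_n u N) _ (h * Series u) (1 / 2) (fun N => proj1 (B N)));
      auto. apply (is_lim_seq_scal_l (sum_n u) h (Series u) Hs). }
  assert (I2 : 1 / 2 <= h + h * Series u).
  { apply (is_lim_seq_le (fun N => gauss_int ((INR N + 1) * h)) (fun N => h + h * sum_n u N)
      (1 / 2) (h + h * Series u)); auto.
    - intros N. assert (0 < u N) by apply exp_pos. destruct (B N). nra.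
    - apply is_lim_seq_plus'; [apply is_lim_seq_const|].
      apply (is_lim_seq_scal_l (sum_n u) h (Series u) Hs). }
  unfold dirichlet. rewrite (Series_ext _ _ Hu). lra.
Qed.

(** The Riemann sum with mesh [1 / sqrt y]. This asymptotic form of the inversion formula takes the
    place of Poisson summation. *)
Lemma is_lim_theta3_inv : is_lim (fun y => theta3 (1 / y) ^ 2 / y) p_infty 1.
Proof.
  assert (L : is_lim (fun y => theta3 (1 / y) / sqrt y) p_infty 1).
  { assert (L0 : is_lim (fun y => / sqrt y) p_infty 0).
    { replace (Finite 0) with (Rbar_inv p_infty) by reflexivity.
      apply is_lim_inv; [|discriminate]. apply is_lim_sqrt_p, is_lim_id. }
    apply (is_lim_le_le_loc (fun y => 1 - / sqrt y) (fun y => 1 + / sqrt y)).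
    - exists 0; intros y Hy. pose proof (sqrt_lt_R0 y Hy) as Hs.
      pose proof (gauss_riemann_sum (/ sqrt y) (Rinv_0_lt_compat _ Hs)) as B.
      replace ((/ sqrt y) ^ 2) with (1 / y) in B.
      + replace (theta3 (1 / y) / sqrt y) with (/ sqrt y * theta3 (1 / y))
          by apply Rmult_comm. exact B.
      + rewrite pow_inv. simpl. rewrite Rmult_1_r, sqrt_sqrt by lra. field; lra.
    - replace (Finite 1) with (Finite (1 - 0)) by (f_equal; ring).
      apply is_lim_minus'; auto. apply is_lim_const.
    - replace (Finite 1) with (Finite (1 + 0)) by (f_equal; ring).
      apply is_lim_plus'; auto. apply is_lim_const. }
  replace (Finite 1) with (Finite (1 ^ 2)) by (f_equal; ring).
  apply is_lim_ext_pos with (fun y => (theta3 (1 / y) / sqrt y) ^ 2).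
  - intros y Hy. pose proof (sqrt_lt_R0 y Hy).
    unfold Rdiv at 1. rewrite Rpow_mult_distr, pow_inv. unfold Rdiv. do 2 f_equal.
    simpl. rewrite Rmult_1_r. apply sqrt_sqrt; lra.
  - apply is_lim_pow_fin; auto.
Qed.

(** * Inversion formulas *)

Definition Fth (y : R) : R := theta3 y ^ 2.
Definition gth (y : R) : R := (theta4 y / theta3 y) ^ 2.
Definition kth (y : R) : R := (theta2 y / theta3 y) ^ 2.
Definition speed (y : R) : R := PI / 2 * Fth y ^ 2.

Lemma Fth_pos y : 0 < y -> 0 < Fth y.
Proof. intros Hy; apply pow_lt, theta3_pos; auto. Qed.

Lemma gth_pos y : 0 < y -> 0 < gth y.
Proof.
  intros Hy; apply pow_lt, Rdiv_lt_0_compat; auto using theta3_pos, theta4_pos.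
Qed.

Lemma kth_pos y : 0 < y -> 0 < kth y.
Proof.
  intros Hy; apply pow_lt, Rdiv_lt_0_compat; auto using theta3_pos, theta2_pos.
Qed.

Lemma speed_pos y : 0 < y -> 0 < speed y.
Proof.
  intros Hy. pose proof (pow_lt _ 2 (Fth_pos y Hy)). pose proof PI_RGT_0.
  unfold speed. nra.
Qed.

Lemma gk_sq y : 0 < y -> gth y ^ 2 + kth y ^ 2 = 1.
Proof.
  intros Hy. pose proof (jacobi_quartic y Hy) as J. pose proof (theta3_pos y Hy) as P.
  unfold gth, kth.
  replace (((theta4 y / theta3 y) ^ 2) ^ 2 + ((theta2 y / theta3 y) ^ 2) ^ 2) with
    ((theta4 y ^ 4 + theta2 y ^ 4) / theta3 y ^ 4) by (field; lra).
  rewrite <- J. field. lra.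
Qed.

Lemma Fth_double y : 0 < y -> Fth (2 * y) = Fth y * (1 + gth y) / 2.
Proof.
  intros Hy. pose proof (theta3_sq_double y Hy) as E. pose proof (theta3_pos y Hy).
  unfold Fth, gth.
  replace (theta3 (2 * y) ^ 2) with ((theta3 y ^ 2 + theta4 y ^ 2) / 2) by lra.
  field. lra.
Qed.

Lemma kth_double y : 0 < y -> kth (2 * y) = (1 - gth y) / (1 + gth y).
Proof.
  intros Hy. pose proof (theta3_sq_double y Hy) as E3.
  pose proof (theta2_sq_double y Hy) as E2.
  pose proof (theta3_pos y Hy). pose proof (theta3_pos (2 * y) ltac:(lra)).
  pose proof (pow_lt _ 2 (theta4_pos y Hy)).
  unfold kth, gth.
  replace ((theta2 (2 * y) / theta3 (2 * y)) ^ 2) with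
    ((2 * theta2 (2 * y) ^ 2) / (2 * theta3 (2 * y) ^ 2)) by (field; lra).
  rewrite E2, E3. field. repeat split; nra.
Qed.

Lemma gth_double y : 0 < y -> gth (2 * y) ^ 2 = 4 * gth y / (1 + gth y) ^ 2.
Proof.
  intros Hy. pose proof (gk_sq (2 * y) ltac:(lra)) as E. rewrite kth_double in E by auto.
  pose proof (gth_pos y Hy).
  replace (gth (2 * y) ^ 2) with (1 - ((1 - gth y) / (1 + gth y)) ^ 2) by lra.
  field. lra.
Qed.

Lemma is_derive_Fth y : 0 < y -> is_derive Fth y (2 * theta3 y * dtheta3 y).
Proof.
  intros Hy. unfold Fth.
  evar_last; [apply is_derive_pow, is_derive_theta3; auto|simpl; ring].
Qed.

Lemma is_derive_gth y : 0 < y -> is_derive gth y (speed y * gth y * kth y ^ 2).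
Proof.
  intros Hy. pose proof (theta3_pos y Hy). pose proof (theta4_pos y Hy).
  unfold gth. evar_last.
  - apply is_derive_pow, is_derive_div; [apply is_derive_theta4|apply is_derive_theta3|]; auto.
    lra.
  - rewrite dtheta4_eq by auto. unfold speed, Fth, gth, kth. simpl. field. lra.
Qed.

Lemma kth_eq_sqrt y : 0 < y -> kth y = sqrt (1 - gth y ^ 2).
Proof.
  intros Hy. pose proof (gk_sq y Hy). pose proof (kth_pos y Hy).
  replace (1 - gth y ^ 2) with (kth y ^ 2) by lra. symmetry; apply sqrt_pow2; lra.
Qed.

Lemma is_derive_kth y : 0 < y -> is_derive kth y (- speed y * kth y * gth y ^ 2).
Proof.
  intros Hy. pose proof (gk_sq y Hy) as E. pose proof (kth_pos y Hy) as Pk.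
  apply (is_derive_ext_pos (fun y => sqrt (1 - gth y ^ 2))); auto.
  { intros; symmetry; apply kth_eq_sqrt; auto. }
  evar_last.
  - apply (is_derive_sqrt (fun y => 1 - gth y ^ 2)).
    + apply (is_derive_minus (fun _ => 1)); [apply is_derive_const|].
      apply is_derive_pow, is_derive_gth; auto.
    + pose proof (pow_lt _ 2 Pk); lra.
  - rewrite <- kth_eq_sqrt by auto.
    unfold minus, plus, opp, zero; simpl. field. lra.
Qed.

Definition tau (y : R) : R := ln (gth y) - ln (kth y).

Lemma is_derive_tau y : 0 < y -> is_derive tau y (speed y).
Proof.
  intros Hy. pose proof (gk_sq y Hy) as E.
  pose proof (kth_pos y Hy) as Pk. pose proof (gth_pos y Hy) as Pg.
  unfold tau. evar_last.
  - apply (is_derive_minus (fun y => ln (gth y)) (fun y => ln (kth y)));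
      (apply is_derive_comp; [apply is_derive_ln; auto|]).
    + apply is_derive_gth; auto.
    + apply is_derive_kth; auto.
  - unfold scal, minus, plus, opp; simpl; unfold mult; simpl.
    transitivity (speed y * (gth y ^ 2 + kth y ^ 2)); [field; lra|rewrite E; ring].
Qed.

Lemma is_derive_inv_arg (f : R -> R) y l : 0 < y -> is_derive f (1 / y) l ->
  is_derive (fun y => f (1 / y)) y (- l / y ^ 2).
Proof.
  intros Hy D. evar_last.
  - apply (is_derive_comp f (fun y => 1 / y)); [exact D|].
    apply (is_derive_div (fun _ => 1) (fun y => y)); [apply is_derive_const|apply is_derive_id|lra].
  - unfold scal, one, zero; simpl; unfold mult; simpl. field. lra.
Qed.

Lemma is_lim_Fth : is_lim Fth p_infty 1.
Proof.
  replace (Finite 1) with (Finite (1 ^ 2)) by (f_equal; ring).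
  apply is_lim_pow_fin, is_lim_theta3.
Qed.

Lemma is_lim_gth : is_lim gth p_infty 1.
Proof.
  replace (Finite 1) with (Finite ((1 / 1) ^ 2)) by (f_equal; field).
  apply is_lim_pow_fin, is_lim_div_fin; [apply is_lim_theta4|apply is_lim_theta3|lra].
Qed.

(** The duplication formulas combine to [kth (2 z) = Fth z / Fth (2 z) - 1]. At [z = 1 / (2 y)] the
    ratio tends to 2, by the growth of [Fth] near 0, so [kth] tends to 1. *)
Lemma is_lim_gth_inv : is_lim (fun y => gth (1 / y) ^ 2) p_infty 0.
Proof.
  assert (L := is_lim_theta3_inv : is_lim (fun y => Fth (1 / y) / y) p_infty 1).
  assert (L2 := is_lim_comp_scale _ 2 _ ltac:(lra) L).
  cbv beta in L2.
  replace (Finite 0) with (Finite (1 - (2 * (1 / 1) - 1) ^ 2)) by (f_equal; field).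
  apply is_lim_ext_pos with (fun y => 1 -
    (2 * ((Fth (1 / (2 * y)) / (2 * y)) / (Fth (1 / y) / y)) - 1) ^ 2).
  - intros y Hy. assert (Hi : 0 < 1 / (2 * y)) by (apply Rdiv_lt_0_compat; lra).
    assert (Hi' : 0 < 1 / y) by (apply Rdiv_lt_0_compat; lra).
    replace (1 / y) with (2 * (1 / (2 * y))) by (field; lra).
    set (z := 1 / (2 * y)) in *.
    pose proof (gk_sq (2 * z) ltac:(lra)) as E.
    replace (2 * _ - 1) with (kth (2 * z)); [lra|].
    rewrite kth_double, Fth_double by auto.
    pose proof (gth_pos z Hi). pose proof (Fth_pos z Hi). unfold z. field.
    fold z. repeat split; nra.
  - apply is_lim_minus'; [apply is_lim_const|]. apply is_lim_pow_fin.
    apply is_lim_minus'; [|apply is_lim_const].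
    apply is_lim_mult_fin; [apply is_lim_const|]. apply is_lim_div_fin; auto.
Qed.

Lemma gth_surj t : 0 < t < 1 -> exists y, 0 < y /\ gth y = t.
Proof.
  intros Ht.
  assert (Hb : exists b, 1 < b /\ t < gth b).
  { pose proof is_lim_gth as L. apply is_lim_spec in L.
    destruct (L (mkposreal (1 - t) ltac:(lra))) as [M HM].
    exists (Rmax M 1 + 1). pose proof (Rmax_l M 1). pose proof (Rmax_r M 1).
    split; [lra|]. specialize (HM (Rmax M 1 + 1) ltac:(lra)). simpl in HM.
    apply Rabs_lt_between' in HM. lra. }
  assert (Ha : exists a, 0 < a < 1 /\ gth a < t).
  { pose proof is_lim_gth_inv as L. apply is_lim_spec in L.
    destruct (L (mkposreal (t ^ 2) ltac:(nra))) as [M HM].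
    set (x := Rmax M 1 + 1). pose proof (Rmax_l M 1). pose proof (Rmax_r M 1).
    assert (Hx : 1 < x) by (unfold x; lra).
    assert (Hi : 0 < 1 / x) by (apply Rdiv_lt_0_compat; lra).
    exists (1 / x). repeat split; auto.
    - apply Rmult_lt_reg_r with x; [lra|]. field_simplify; lra.
    - specialize (HM x ltac:(unfold x; lra)). simpl in HM.
      apply Rabs_lt_between' in HM. pose proof (gth_pos _ Hi). simpl in *. nra. }
  destruct Hb as (b & Hb1 & Hb2). destruct Ha as (a & Ha1 & Ha2).
  destruct (IVT_interv (fun y => gth y - t) a b) as (z & Hz1 & Hz2); try lra.
  - intros x Hx. apply continuity_pt_filterlim.
    apply (ex_derive_continuous (fun y => gth y - t)).
    eexists. apply (is_derive_minus gth (fun _ => t)); [|apply is_derive_const].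
    apply is_derive_gth; lra.
  - exists z; split; lra.
Qed.

(** [gth] at [z] and [kth] at [1 / y] obey the same recursion under doubling: [kth_double] at [x],
    solved backwards for [kth x], is the formula [gth_double]. *)
Lemma gth_orbit y z n : 0 < y -> 0 < z -> gth z = kth (1 / y) ->
  gth (2 ^ n * z) = kth (1 / (2 ^ n * y)).
Proof.
  intros Hy Hz E. induction n as [|n IH]; [simpl; rewrite !Rmult_1_l; auto|].
  assert (H2 : 0 < 2 ^ n) by (apply pow_lt; lra).
  assert (Hy' : 0 < 2 ^ n * y) by nra. assert (Hz' : 0 < 2 ^ n * z) by nra.
  simpl; rewrite !Rmult_assoc.
  set (y' := 2 ^ n * y) in *. set (z' := 2 ^ n * z) in *.
  assert (Hx : 0 < 1 / (2 * y')) by (apply Rdiv_lt_0_compat; lra).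
  replace (1 / y') with (2 * (1 / (2 * y'))) in IH by (field; lra).
  set (x := 1 / (2 * y')) in *.
  pose proof (gth_pos (2 * z') ltac:(lra)) as P1. pose proof (kth_pos x Hx) as P2.
  apply Rsqr_inj; try lra. rewrite !Rsqr_pow2.
  rewrite gth_double, IH, kth_double by auto.
  pose proof (gth_pos x Hx). pose proof (gk_sq x Hx).
  replace (kth x ^ 2) with (1 - gth x ^ 2) by lra. field. lra.
Qed.

Lemma kth_eq_of_gth y z : 0 < y -> 0 < z -> gth z = kth y -> kth z = gth y.
Proof.
  intros Hy Hz E. pose proof (gk_sq y Hy). pose proof (gk_sq z Hz) as H1. rewrite E in H1.
  pose proof (gth_pos y Hy). pose proof (kth_pos z Hz).
  apply Rsqr_inj; try lra. rewrite !Rsqr_pow2. lra.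
Qed.

(* Along the common doubling orbit, [tau] grows at the asymptotic rate [PI / 2] in both
   variables, which forces [z = y]. *)
Lemma gth_orbit_unique y z : 0 < y -> 0 < z -> gth z = kth (1 / y) -> z = y.
Proof.
  intros Hy Hz E. pose proof PI_RGT_0 as Hpi.
  assert (B : forall e, 0 < e -> Rabs (z - y) <= e * (y + z)).
  { intros e He.
    assert (L1 : is_lim (fun y => Fth y ^ 2) p_infty 1).
    { replace (Finite 1) with (Finite (1 ^ 2)) by (f_equal; ring).
      apply is_lim_pow_fin, is_lim_Fth. }
    assert (L2 : is_lim (fun y => (Fth (1 / y) / y) ^ 2) p_infty 1).
    { replace (Finite 1) with (Finite (1 ^ 2)) by (f_equal; ring).
      apply is_lim_pow_fin, is_lim_theta3_inv. }
    apply is_lim_spec in L1; apply is_lim_spec in L2.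
    destruct (L1 (mkposreal e He)) as [M1 HM1]. destruct (L2 (mkposreal e He)) as [M2 HM2].
    change (pos (mkposreal e He)) with e in HM1, HM2.
    set (M := Rmax M1 M2). pose proof (Rmax_l M1 M2) as Q1. pose proof (Rmax_r M1 M2) as Q2.
    fold M in Q1, Q2.
    assert (N : forall x, 0 < x -> exists N, forall n, (N <= n)%nat -> M < 2 ^ n * x).
    { intros x Hx. pose proof (is_lim_seq_pow2_mul x Hx) as Lx. apply is_lim_seq_spec in Lx.
      destruct (Lx M) as [N HN]. exists N; auto. }
    destruct (N y Hy) as [Ny HNy]. destruct (N z Hz) as [Nz HNz].
    set (n := max Ny Nz). specialize (HNy n ltac:(unfold n; lia)).
    specialize (HNz n ltac:(unfold n; lia)).
    assert (H2 : 0 < 2 ^ n) by (apply pow_lt; lra).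
    assert (T : forall m, tau (2 ^ m * z) = - tau (1 / (2 ^ m * y))).
    { intros m. assert (H2m : 0 < 2 ^ m) by (apply pow_lt; lra).
      pose proof (gth_orbit y z m Hy Hz E) as Em.
      assert (Hi : 0 < 1 / (2 ^ m * y)) by (apply Rdiv_lt_0_compat; nra).
      pose proof (kth_eq_of_gth _ (2 ^ m * z) Hi ltac:(nra) Em) as Em'.
      unfold tau. rewrite Em, Em'. ring. }
    destruct (MVT_gen tau (2 ^ n * z) (2 ^ S n * z) speed) as (c & Hc & Ec).
    { intros x. rewrite Rmin_left by (simpl; nra). intros Hx. apply is_derive_tau. nra. }
    { intros x. rewrite Rmin_left by (simpl; nra). intros Hx.
      apply continuity_pt_filterlim, (ex_derive_continuous tau).
      eexists; apply is_derive_tau. nra. }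
    rewrite Rmin_left, Rmax_right in Hc by (simpl; nra).
    assert (D : forall x, 0 < x -> is_derive (fun x => - tau (1 / x)) x (speed (1 / x) / x ^ 2)).
    { intros x Hx. evar_last.
      - apply (is_derive_opp (fun x => tau (1 / x))). apply is_derive_inv_arg; auto.
        apply is_derive_tau. apply Rdiv_lt_0_compat; lra.
      - unfold opp; simpl. field. lra. }
    destruct (MVT_gen (fun x => - tau (1 / x)) (2 ^ n * y) (2 ^ S n * y)
      (fun x => speed (1 / x) / x ^ 2)) as (d & Hd & Ed).
    { intros x. rewrite Rmin_left by (simpl; nra). intros Hx. apply D. nra. }
    { intros x. rewrite Rmin_left by (simpl; nra). intros Hx.
      apply continuity_pt_filterlim, (ex_derive_continuous (fun x => - tau (1 / x))).
      eexists; apply D. nra. }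
    rewrite Rmin_left, Rmax_right in Hd by (simpl; nra).
    rewrite <- !T, Ec in Ed.
    specialize (HM1 c ltac:(lra)). specialize (HM2 d ltac:(lra)).
    (* Both sides are the same increment of [tau] over one doubling, up to [PI / 2 * 2 ^ n]; the two
       factors in front of [z] and [y] are within [e] of 1. *)
    assert (G : Fth c ^ 2 * z = (Fth (1 / d) / d) ^ 2 * y).
    { apply Rmult_eq_reg_l with (PI / 2 * 2 ^ n); [|nra].
      transitivity (speed c * (2 ^ S n * z - 2 ^ n * z)); [unfold speed; simpl; ring|].
      rewrite Ed. unfold speed; simpl. field. nra. }
    apply Rabs_lt_between' in HM1. apply Rabs_lt_between' in HM2.
    set (p := Fth c ^ 2) in *. set (q := (Fth (1 / d) / d) ^ 2) in *.
    assert (G' : z - y = z * (1 - p) + y * (q - 1)).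
    { transitivity (z - y - p * z + q * y); [rewrite G|]; ring. }
    assert (z * (1 - p) <= z * e) by (apply Rmult_le_compat_l; lra).
    assert (y * (q - 1) <= y * e) by (apply Rmult_le_compat_l; lra).
    assert (z * (p - 1) <= z * e) by (apply Rmult_le_compat_l; lra).
    assert (y * (1 - q) <= y * e) by (apply Rmult_le_compat_l; lra).
    apply Rabs_le. lra. }
  assert (Z : Rabs (z - y) <= 0).
  { apply le_epsilon. intros e He. rewrite Rplus_0_l.
    specialize (B (e / (y + z)) ltac:(apply Rdiv_lt_0_compat; lra)).
    replace (e / (y + z) * (y + z)) with e in B by (field; lra). exact B. }
  pose proof (Rabs_pos (z - y)). assert (R0 : Rabs (z - y) = 0) by lra.
  destruct (Req_dec (z - y) 0) as [|H0]; [lra|]. apply Rabs_no_R0 in H0; lra.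
Qed.

(** The value [kth (1 / y)] is attained by [gth] at some [z], and the comparison of orbits
    identifies [z] with [y]. *)
Lemma kth_inv y : 0 < y -> kth (1 / y) = gth y.
Proof.
  intros Hy. assert (Hi : 0 < 1 / y) by (apply Rdiv_lt_0_compat; lra).
  pose proof (gk_sq _ Hi). pose proof (kth_pos _ Hi). pose proof (gth_pos _ Hi).
  destruct (gth_surj (kth (1 / y))) as (z & Hz & E); [nra|].
  rewrite <- E. f_equal. apply gth_orbit_unique; auto.
Qed.

Lemma gth_inv y : 0 < y -> gth (1 / y) = kth y.
Proof.
  intros Hy. assert (Hi : 0 < 1 / y) by (apply Rdiv_lt_0_compat; lra).
  rewrite <- (kth_inv (1 / y)) by auto. f_equal. field; lra.
Qed.

(** Differentiating [kth (1 / y) = gth y] and cancelling common factors leaves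
    [Fth (1 / y) ^ 2 / y ^ 2 = Fth y ^ 2]. *)
Lemma Fth_inv y : 0 < y -> Fth (1 / y) = y * Fth y.
Proof.
  intros Hy. assert (Hi : 0 < 1 / y) by (apply Rdiv_lt_0_compat; lra).
  pose proof (gth_pos y Hy) as Pg. pose proof (kth_pos y Hy) as Pk.
  pose proof (Fth_pos y Hy) as PF. pose proof (Fth_pos _ Hi) as PF'. pose proof PI_RGT_0.
  assert (D := is_derive_inv_arg kth y _ Hy (is_derive_kth _ Hi)).
  pose proof (derive_eq_of_eq_pos (fun y => kth (1 / y)) gth y _ _ Hy kth_inv D
    (is_derive_gth y Hy)) as E.
  rewrite kth_inv, gth_inv in E by auto. unfold speed in E.
  assert (E' : Fth (1 / y) ^ 2 = (y * Fth y) ^ 2).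
  { apply Rmult_eq_reg_l with (PI / 2 * gth y * kth y ^ 2 / y ^ 2).
    - transitivity (- (- (PI / 2 * Fth (1 / y) ^ 2) * gth y * kth y ^ 2) / y ^ 2);
        [field; lra|]. rewrite E. field; lra.
    - apply Rgt_not_eq, Rdiv_lt_0_compat; [|nra].
      apply Rmult_lt_0_compat; [nra|apply pow_lt; auto]. }
  apply Rsqr_inj; try nra. rewrite !Rsqr_pow2; auto.
Qed.

(** * The autonomous system *)

Lemma is_derive_continuity_pt (f : R -> R) (x l : R) : is_derive f x l -> continuity_pt f x.
Proof.
  intros D. apply continuity_pt_filterlim, (ex_derive_continuous f). eexists; eauto.
Qed.

Lemma mean_value (f df : R -> R) (a b : R) : a < b ->
  (forall x, a <= x <= b -> is_derive f x (df x)) ->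
  exists c, a < c < b /\ f b - f a = df c * (b - a).
Proof.
  intros Hab D. destruct (MVT_cor2 f df a b Hab) as (c & E & Hc).
  - intros x Hx; apply is_derive_Reals; auto.
  - exists c; auto.
Qed.

(** The derivative has to be controlled only where the barrier is violated: after the last point
    with [0 <= f], the function would be negative and yet nondecreasing. *)
Lemma barrier (f df : R -> R) (a b : R) : a <= b ->
  (forall x, a <= x <= b -> is_derive f x (df x)) -> 0 <= f a ->
  (forall x, a <= x <= b -> f x < 0 -> 0 <= df x) -> 0 <= f b.
Proof.
  intros Hab D Ha H. apply Rnot_lt_le; intros Hb.
  destruct (completeness (fun x => a <= x <= b /\ 0 <= f x)) as [s [Hs1 Hs2]].
  { exists b; intros x [Hx _]; apply Hx. }
  { exists a; split; lra. }
  assert (Has : a <= s) by (apply Hs1; split; lra).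
  assert (Hsb : s <= b) by (apply Hs2; intros x [Hx _]; apply Hx).
  assert (Hgt : forall x, s < x <= b -> f x < 0).
  { intros x Hx. apply Rnot_le_lt; intros Hx0.
    assert (x <= s) by (apply Hs1; split; lra). lra. }
  assert (Hfs : 0 <= f s).
  { apply Rnot_lt_le; intros Hfs.
    pose proof (is_derive_continuity_pt f s _ (D s (conj Has Hsb))) as C.
    destruct (proj1 (continuity_pt_locally f s) C (mkposreal (- f s) ltac:(lra)))
      as [eps Heps].
    assert (s <= s - Rmin eps 1 / 2); [apply Hs2|].
    - intros x [Hx Hx0]. apply Rnot_lt_le; intros Hlt.
      assert (Hxs : x <= s) by (apply Hs1; split; auto).
      assert (Hball : ball s eps x).
      { unfold ball; simpl; unfold AbsRing_ball, abs, minus, plus, opp; simpl.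
        apply Rabs_lt_between. pose proof (Rmin_l eps 1). pose proof (cond_pos eps).
        pose proof (Rmin_pos eps 1 ltac:(auto) ltac:(lra)). lra. }
      specialize (Heps x Hball). simpl in Heps. apply Rabs_lt_between' in Heps. lra.
    - pose proof (Rmin_pos eps 1 (cond_pos eps) ltac:(lra)). lra. }
  assert (Hlt : s < b).
  { destruct Hsb as [|E]; auto. rewrite E in Hfs; lra. }
  destruct (mean_value f df s b Hlt) as (c & Hc & E).
  { intros x Hx; apply D; lra. }
  assert (0 <= df c) by (apply H; [lra|apply Hgt; lra]). nra.
Qed.

(** The sign condition leaves out [a], where the intended functions and possibly their derivatives
    vanish. A zero at [b] with positive slope would force negative values just before [b]. *)
Lemma barrier_strict (f df : R -> R) (a b : R) : a < b ->
  (forall x, a <= x <= b -> is_derive f x (df x)) -> 0 <= f a ->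
  (forall x, a < x <= b -> f x <= 0 -> 0 < df x) -> 0 < f b.
Proof.
  intros Hab D Ha H.
  assert (W : forall x, a <= x <= b -> 0 <= f x).
  { intros x Hx. apply (barrier f df a x); [lra|intros; apply D; lra|auto|].
    intros z Hz Hfz. destruct (Req_dec z a) as [->|Hza]; [lra|].
    left; apply H; lra. }
  destruct (W b ltac:(lra)) as [|E]; auto. exfalso.
  pose proof (H b ltac:(lra) ltac:(lra)) as Hd.
  pose proof (D b ltac:(lra)) as Db. apply is_derive_Reals in Db.
  destruct (Db (df b / 2) ltac:(lra)) as [del Hdel].
  set (h := Rmin del (b - a) / 2).
  pose proof (Rmin_l del (b - a)). pose proof (Rmin_r del (b - a)).
  pose proof (Rmin_pos del (b - a) (cond_pos del) ltac:(lra)).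
  assert (Hh : 0 < h) by (unfold h; lra).
  specialize (Hdel (- h) ltac:(lra)).
  rewrite Rabs_Ropp, Rabs_right in Hdel by lra. specialize (Hdel ltac:(unfold h; lra)).
  rewrite <- E in Hdel. pose proof (W (b + - h) ltac:(unfold h in *; lra)) as Wh.
  apply Rabs_lt_between' in Hdel.
  assert ((f (b + - h) - 0) / - h <= 0); [|lra].
  replace ((f (b + - h) - 0) / - h) with (- (f (b + - h) / h)) by (field; lra).
  assert (0 <= f (b + - h) / h) by (apply Rdiv_le_0_compat; lra). lra.
Qed.

Lemma nonincreasing_ge_lim (f df : R -> R) (a l : R) :
  (forall x, a <= x -> is_derive f x (df x)) -> (forall x, a <= x -> df x <= 0) ->
  is_lim f p_infty l -> l <= f a.
Proof.
  intros D H L.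
  apply (is_lim_le_loc f (fun _ => f a) p_infty l (f a)); auto using is_lim_const.
  exists a; intros x Hx.
  destruct (mean_value f df a x Hx) as (c & Hc & E); [intros; apply D; lra|].
  specialize (H c ltac:(lra)). nra.
Qed.

(* In the time [tau], in which [d/dtau = (1 / speed) d/dy]: [Tt = tanh tau], [vv] is the
   derivative of [ln y] over 2, and [nn], [mm] are the logarithmic derivatives of [Fth] and
   of [sqrt y * Fth]. *)
Definition Tt (y : R) : R := gth y ^ 2 - kth y ^ 2.
Definition nn (y : R) : R := 4 * dtheta3 y / (PI * theta3 y ^ 5).
Definition vv (y : R) : R := 1 / (PI * y * Fth y ^ 2).
Definition mm (y : R) : R := nn y + vv y.
Definition mu (y : R) : R := (1 - Tt y ^ 2) / 4 - vv y ^ 2 - mm y ^ 2.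

Lemma Tt_bounds y : 0 < y -> -1 < Tt y < 1.
Proof.
  intros Hy. pose proof (gk_sq y Hy).
  pose proof (pow_lt _ 2 (gth_pos y Hy)). pose proof (pow_lt _ 2 (kth_pos y Hy)).
  unfold Tt; lra.
Qed.

Lemma sech_sq_eq y : 0 < y -> 1 - Tt y ^ 2 = 4 * gth y ^ 2 * kth y ^ 2.
Proof.
  intros Hy. pose proof (gk_sq y Hy) as E. unfold Tt.
  replace 1 with ((gth y ^ 2 + kth y ^ 2) ^ 2) by (rewrite E; ring). ring.
Qed.

Lemma is_derive_Tt y : 0 < y -> is_derive Tt y (speed y * (1 - Tt y ^ 2)).
Proof.
  intros Hy. unfold Tt at 1. evar_last.
  - apply (is_derive_minus (fun y => gth y ^ 2) (fun y => kth y ^ 2));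
      apply is_derive_pow; [apply is_derive_gth|apply is_derive_kth]; auto.
  - rewrite sech_sq_eq by auto. unfold minus, plus, opp; simpl. ring.
Qed.

(** The Riccati form of [ddtheta3_eq], with [1 - Tt ^ 2] in the role of [1 / cosh^2 tau]. *)
Lemma is_derive_nn y : 0 < y -> is_derive nn y (speed y * ((1 - Tt y ^ 2) / 4 - nn y ^ 2)).
Proof.
  intros Hy. pose proof PI_RGT_0 as Hpi. pose proof (theta3_pos y Hy) as P3.
  pose proof (is_derive_theta3 y Hy) as D3. pose proof (is_derive_dtheta3 y Hy) as DD3.
  assert (P5 : 0 < PI * theta3 y ^ 5) by (apply Rmult_lt_0_compat; auto; apply pow_lt; auto).
  unfold nn at 1. evar_last.
  - apply (is_derive_div (fun y => 4 * dtheta3 y) (fun y => PI * theta3 y ^ 5)).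
    + apply is_derive_scal, DD3.
    + apply is_derive_scal, is_derive_pow, D3.
    + lra.
  - rewrite sech_sq_eq by auto. unfold speed, Fth, gth, kth, nn.
    assert (E : ddtheta3 y = theta3 y * (3 * (dtheta3 y / theta3 y) ^ 2 +
      PI ^ 2 / 8 * theta4 y ^ 4 * theta2 y ^ 4)).
    { pose proof (ddtheta3_eq y Hy) as E.
      replace (ddtheta3 y) with (theta3 y * (ddtheta3 y / theta3 y)) at 1 by (field; lra).
      f_equal. lra. }
    rewrite E. simpl. field. lra.
Qed.

Lemma vv_pos y : 0 < y -> 0 < vv y.
Proof.
  intros Hy. pose proof PI_RGT_0. pose proof (pow_lt _ 2 (Fth_pos y Hy)).
  apply Rdiv_lt_0_compat; [lra|].
  apply Rmult_lt_0_compat; [apply Rmult_lt_0_compat|]; lra.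
Qed.

Lemma nn_neg y : 0 < y -> nn y < 0.
Proof.
  intros Hy. pose proof PI_RGT_0. pose proof (dtheta3_neg y Hy).
  assert (0 < PI * theta3 y ^ 5).
  { apply Rmult_lt_0_compat; auto. apply pow_lt, theta3_pos; auto. }
  assert (0 < - nn y); [|lra]. unfold nn.
  replace (- (4 * dtheta3 y / (PI * theta3 y ^ 5))) with
    (4 * - dtheta3 y / (PI * theta3 y ^ 5))
    by (pose proof (theta3_pos y Hy); field; lra).
  apply Rdiv_lt_0_compat; lra.
Qed.

Lemma is_derive_vv y : 0 < y -> is_derive vv y (speed y * (- 2 * mm y * vv y)).
Proof.
  intros Hy. pose proof PI_RGT_0 as Hpi. pose proof (theta3_pos y Hy) as P3.
  pose proof (Fth_pos y Hy) as PF.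
  assert (0 < PI * y * Fth y ^ 2).
  { apply Rmult_lt_0_compat; [apply Rmult_lt_0_compat; lra|apply pow_lt; auto]. }
  unfold vv at 1. evar_last.
  - apply (is_derive_div (fun _ => 1) (fun y => PI * y * Fth y ^ 2)); [apply is_derive_const| |lra].
    apply (is_derive_mult (fun y => PI * y) (fun y => Fth y ^ 2)).
    + apply is_derive_scal, is_derive_id.
    + apply is_derive_pow, is_derive_Fth; auto.
    + intros; apply Rmult_comm.
  - unfold plus, mult, zero, one; simpl. unfold speed, mm, nn, vv, Fth. simpl. field. lra.
Qed.

(** With [nn = mm - vv] the mixed terms cancel: [- nn ^ 2 - 2 * mm * vv = - mm ^ 2 - vv ^ 2]. *)
Lemma is_derive_mm y : 0 < y -> is_derive mm y (speed y * mu y).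
Proof.
  intros Hy. unfold mm at 1. evar_last.
  - apply (is_derive_plus nn vv); [apply is_derive_nn|apply is_derive_vv]; auto.
  - unfold plus, mu, mm; simpl. field.
Qed.

Lemma Tt_1 : Tt 1 = 0.
Proof.
  pose proof (kth_inv 1 ltac:(lra)) as E. replace (1 / 1) with 1 in E by field.
  unfold Tt; rewrite E; ring.
Qed.

(** Differentiating [Fth (1 / y) = y * Fth y] at 1 gives [dtheta3 1 = - theta3 1 / 4]. *)
Lemma mm_1 : mm 1 = 0.
Proof.
  assert (D := is_derive_Fth 1 ltac:(lra)).
  assert (D' : is_derive Fth (1 / 1) (2 * theta3 1 * dtheta3 1)).
  { replace (1 / 1) with 1 by field; auto. }
  apply is_derive_inv_arg in D'; [|lra].
  assert (D2 : is_derive (fun y => y * Fth y) 1 (1 * Fth 1 + 1 * (2 * theta3 1 * dtheta3 1))).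
  { apply (is_derive_mult (fun y => y) Fth); [apply (is_derive_id (K := R_AbsRing))|exact D|].
    intros; apply Rmult_comm. }
  assert (E := derive_eq_of_eq_pos (fun y => Fth (1 / y)) (fun y => y * Fth y) 1 _ _
    ltac:(lra) Fth_inv D' D2).
  pose proof PI_RGT_0. pose proof (theta3_pos 1 ltac:(lra)).
  assert (E' : dtheta3 1 = - theta3 1 / 4).
  { unfold Fth in E. apply Rmult_eq_reg_l with (4 * theta3 1); lra. }
  unfold mm, nn, vv, Fth. rewrite E'. field. lra.
Qed.

Lemma is_lim_kth : is_lim kth p_infty 0.
Proof.
  assert (L : is_lim theta2 p_infty 0).
  { apply is_lim_ext with (fun y => exp (- (PI / 4) * y) * (exp (PI * y / 4) * theta2 y)).
    - intros y. rewrite <- Rmult_assoc, <- exp_plus.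
      replace (- (PI / 4) * y + PI * y / 4) with 0 by field. rewrite exp_0; ring.
    - replace (Finite 0) with (Finite (0 * 2)) by (f_equal; ring).
      apply is_lim_mult_fin; [|apply is_lim_theta2].
      apply is_lim_exp_neg. pose proof PI_RGT_0; lra. }
  replace (Finite 0) with (Finite ((0 / 1) ^ 2)) by (f_equal; field).
  apply is_lim_pow_fin, is_lim_div_fin; auto using is_lim_theta3.
Qed.

Lemma is_lim_Tt : is_lim Tt p_infty 1.
Proof.
  replace (Finite 1) with (Finite (1 ^ 2 - 0 ^ 2)) by (f_equal; ring).
  apply is_lim_minus'; apply is_lim_pow_fin; [apply is_lim_gth|apply is_lim_kth].
Qed.

Lemma is_lim_nn : is_lim nn p_infty 0.
Proof.
  pose proof PI_RGT_0.
  replace (Finite 0) with (Finite (4 * 0 / (PI * 1 ^ 5))) by (f_equal; field; lra).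
  apply is_lim_div_fin; [| |lra].
  - apply is_lim_mult_fin; [apply is_lim_const|].
    apply (is_lim_of_exp_mul _ _ is_lim_dtheta3).
  - apply is_lim_mult_fin; [apply is_lim_const|apply is_lim_pow_fin, is_lim_theta3].
Qed.

Lemma Tt_increasing x y : 0 < x < y -> Tt x < Tt y.
Proof.
  intros H. destruct (mean_value Tt (fun y => speed y * (1 - Tt y ^ 2)) x y) as (c & Hc & E).
  - lra.
  - intros z Hz; apply is_derive_Tt; lra.
  - pose proof (speed_pos c ltac:(lra)). pose proof (Tt_bounds c ltac:(lra)).
    assert (0 < 1 - Tt c ^ 2) by nra.
    assert (0 < speed c * (1 - Tt c ^ 2) * (y - x)); [|lra].
    apply Rmult_lt_0_compat; [apply Rmult_lt_0_compat|]; lra.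
Qed.

Lemma Tt_pos y : 1 < y -> 0 < Tt y.
Proof. intros Hy. rewrite <- Tt_1. apply Tt_increasing; lra. Qed.

Lemma Tt_nonneg y : 1 <= y -> 0 <= Tt y.
Proof. intros [H|<-]; [left; apply Tt_pos; auto|rewrite Tt_1; lra]. Qed.

(** First approximation: the Riccati equation without [- nn ^ 2], integrated from infinity, where
    [nn] and [1 - Tt] both vanish. *)
Lemma nn_lower y : 0 < y -> - (1 - Tt y) / 4 <= nn y.
Proof.
  intros Hy. cut (0 <= nn y + (1 - Tt y) / 4); [lra|].
  apply (nonincreasing_ge_lim (fun y => nn y + (1 - Tt y) / 4)
    (fun y => - speed y * nn y ^ 2)).
  - intros x Hx.
    assert (D1 := is_derive_nn x ltac:(lra)). assert (D2 := is_derive_Tt x ltac:(lra)).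
    auto_derive; [repeat split; eexists; eauto|].
    rewrite (is_derive_unique (fun x : R => nn x) _ _ D1),
      (is_derive_unique (fun x : R => Tt x) _ _ D2). field.
  - intros x Hx. pose proof (speed_pos x ltac:(lra)). pose proof (pow2_ge_0 (nn x)). nra.
  - replace (Finite 0) with (Finite (0 + (1 - 1) / 4)) by (f_equal; field).
    apply is_lim_plus'; [apply is_lim_nn|]. apply is_lim_div_fin; [|apply is_lim_const|lra].
    apply is_lim_minus'; [apply is_lim_const|apply is_lim_Tt].
Qed.

(** Second approximation: [nn ^ 2] is replaced by the square of the first one. Its primitive in [Tt]
    would contain a logarithm; a polynomial one results from [(1 + T) * (2 - T) >= 2] on [0, 1]. *)
Lemma nn_upper y : 1 <= y ->
  nn y <= - (1 - Tt y) / 4 + (1 - Tt y) ^ 2 * (5 - 2 * Tt y) / 192.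
Proof.
  intros Hy.
  cut (0 <= (1 - Tt y) ^ 2 * (5 - 2 * Tt y) / 192 - (nn y + (1 - Tt y) / 4)); [lra|].
  apply (nonincreasing_ge_lim
    (fun y => (1 - Tt y) ^ 2 * (5 - 2 * Tt y) / 192 - (nn y + (1 - Tt y) / 4))
    (fun y => speed y * (nn y ^ 2 - (1 - Tt y) ^ 2 * (1 + Tt y) * (2 - Tt y) / 32))).
  - intros x Hx.
    assert (D1 := is_derive_nn x ltac:(lra)). assert (D2 := is_derive_Tt x ltac:(lra)).
    auto_derive; [repeat split; eexists; eauto|].
    rewrite (is_derive_unique (fun x : R => nn x) _ _ D1),
      (is_derive_unique (fun x : R => Tt x) _ _ D2). field.
  - intros x Hx. pose proof (speed_pos x ltac:(lra)).
    pose proof (nn_lower x ltac:(lra)). pose proof (nn_neg x ltac:(lra)).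
    pose proof (Tt_nonneg x ltac:(lra)). pose proof (Tt_bounds x ltac:(lra)).
    assert (nn x ^ 2 <= ((1 - Tt x) / 4) ^ 2) by nra.
    assert (0 <= (1 - Tt x) ^ 2 * (Tt x * (1 - Tt x))).
    { apply Rmult_le_pos; [apply pow2_ge_0|nra]. }
    assert (nn x ^ 2 - (1 - Tt x) ^ 2 * (1 + Tt x) * (2 - Tt x) / 32 <= 0) by nra.
    nra.
  - replace (Finite 0) with (Finite ((1 - 1) ^ 2 * (5 - 2 * 1) / 192 - (0 + (1 - 1) / 4)))
      by (f_equal; field).
    assert (L1 : is_lim (fun y => 1 - Tt y) p_infty (1 - 1)).
    { apply is_lim_minus'; [apply is_lim_const|apply is_lim_Tt]. }
    apply is_lim_minus'.
    + apply is_lim_div_fin; [|apply is_lim_const|lra].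
      apply is_lim_mult_fin; [apply is_lim_pow_fin; auto|].
      apply is_lim_minus'; [apply is_lim_const|].
      apply is_lim_mult_fin; [apply is_lim_const|apply is_lim_Tt].
    + apply is_lim_plus'; [apply is_lim_nn|].
      apply is_lim_div_fin; [auto|apply is_lim_const|lra].
Qed.

(** * Barriers *)

(** Where [mm <= 0], the bound [nn_lower] keeps both [vv] and [- mm] below [(1 - Tt) / 4], which
    makes [mu] positive. *)
Lemma mm_pos y : 1 < y -> 0 < mm y.
Proof.
  intros Hy. apply (barrier_strict mm (fun y => speed y * mu y) 1 y); auto.
  - intros x Hx. apply is_derive_mm; lra.
  - rewrite mm_1; lra.
  - intros x Hx Hm. apply Rmult_lt_0_compat; [apply speed_pos; lra|].
    pose proof (vv_pos x ltac:(lra)). pose proof (nn_lower x ltac:(lra)).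
    pose proof (Tt_nonneg x ltac:(lra)). pose proof (Tt_bounds x ltac:(lra)).
    unfold mu. unfold mm in *. set (t := Tt x) in *.
    assert (vv x ^ 2 <= ((1 - t) / 4) ^ 2) by nra.
    assert ((nn x + vv x) ^ 2 <= ((1 - t) / 4) ^ 2) by nra. nra.
Qed.

Lemma mm_nonneg y : 1 <= y -> 0 <= mm y.
Proof. intros [H|<-]; [left; apply mm_pos; auto|rewrite mm_1; lra]. Qed.

Ltac sum_of_nonneg :=
  repeat match goal with
  | |- 0 <= _ + _ => apply Rplus_le_le_0_compat
  | |- 0 <= _ * _ => apply Rmult_le_pos
  | |- 0 <= _ ^ _ => apply pow_le
  end; lra.

(* The coefficients below are those of the Bernstein expansions of the left-hand sides
   on the given intervals. *)
Lemma lower_barrier_poly t : 0 <= t <= 9 / 10 ->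
  0 <= (1 - t ^ 2) / 4 - (t * (3 / 16 - 3 / 50 * t ^ 2) + (1 - t) / 4) ^ 2
    - (t * (3 / 16 - 3 / 50 * t ^ 2)) ^ 2 - (1 - t ^ 2) * (3 / 16 - 9 / 50 * t ^ 2).
Proof.
  intros Ht.
  (* A factor [t] splits off because the slope 3/16 is exactly [1/4 - (1/4)^2], so there is equality
     at 0. *)
  replace (_ - _) with (t * (
    3125 / 59049 * (9/10 - t) ^ 5 +
    181475 / 472392 * (t * (9/10 - t) ^ 4) +
    123835 / 118098 * (t ^ 2 * (9/10 - t) ^ 3) +
    275471 / 236196 * (t ^ 3 * (9/10 - t) ^ 2) +
    54191 / 118098 * (t ^ 4 * (9/10 - t)) +
    803611 / 295245000 * t ^ 5)) by field.
  sum_of_nonneg.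
Qed.

Lemma upper_barrier_poly t : 0 <= t <= 1 ->
  0 <= (1 - t ^ 2) * (1 / 5 - 9 / 100 * t ^ 2) - (1 - t ^ 2) / 4
    + (t * (1 / 5 - 3 / 100 * t ^ 2) + (1 - t) / 4 - (1 - t) ^ 2 * (5 - 2 * t) / 192) ^ 2
    + (t * (1 / 5 - 3 / 100 * t ^ 2)) ^ 2.
Proof.
  (* The margin at [t = 0] is narrow: 1/5 just exceeds [1/4 - (43/192)^2]. *)
  intros Ht. destruct (Rle_dec t (1 / 2)) as [H|H].
  - replace (_ + _) with (
      29 / 2880 * (1/2 - t) ^ 6 +
      23 / 96 * (t * (1/2 - t) ^ 5) +
      2283 / 3200 * (t ^ 2 * (1/2 - t) ^ 4) +
      16697 / 28800 * (t ^ 3 * (1/2 - t) ^ 3) +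
      8551 / 384000 * (t ^ 4 * (1/2 - t) ^ 2) +
      403 / 16000 * (t ^ 5 * (1/2 - t)) +
      36013 / 360000 * t ^ 6) by field.
    sum_of_nonneg.
  - replace (_ + _) with (
      36013 / 360000 * (1 - t) ^ 6 +
      282059 / 240000 * ((t - 1/2) * (1 - t) ^ 5) +
      2216663 / 384000 * ((t - 1/2) ^ 2 * (1 - t) ^ 4) +
      4379 / 300 * ((t - 1/2) ^ 3 * (1 - t) ^ 3) +
      19763 / 1000 * ((t - 1/2) ^ 4 * (1 - t) ^ 2) +
      8476 / 625 * ((t - 1/2) ^ 5 * (1 - t)) +
      2312 / 625 * (t - 1/2) ^ 6) by field.
    sum_of_nonneg.
Qed.

(** In [Gam_pos] this is the right end, [mm = 159/1000], of a quadratic minorant of [Gam]. *)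
Lemma tail_poly t : 9 / 10 <= t <= 1 ->
  0 < t * ((1 - t ^ 2) / 4 - (159 / 1000 + (1 - t) / 4) ^ 2 - 2 * (159 / 1000) ^ 2)
    + (t ^ 2 / 2 - (1 - t ^ 2)) * (159 / 1000).
Proof.
  intros Ht.
  apply Rlt_le_trans with (9 / 10000); [lra|].
  apply Rminus_le_0.
  replace (_ - _) with (
    588 / 10000 * (1 - t) ^ 3 +
    71946 / 10000 * ((t - 9 / 10) * (1 - t) ^ 2) +
    102053 / 10000 * ((t - 9 / 10) ^ 2 * (1 - t)) +
    2757 / 1000 * (t - 9 / 10) ^ 3) by field.
  sum_of_nonneg.
Qed.

(** Below the barrier [vv = mm - nn] is at most the barrier plus [(1 - Tt) / 4], so [mu] is at least
    its slope. Some bound on [Tt] is forced: the barrier is positive at [Tt = 1], whereas [mm] tends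
    to 0. *)
Lemma mm_lower y : 1 <= y -> Tt y <= 9 / 10 ->
  Tt y * (3 / 16 - 3 / 50 * Tt y ^ 2) <= mm y.
Proof.
  intros Hy HT. apply Rminus_le_0.
  apply (barrier (fun y => mm y - Tt y * (3 / 16 - 3 / 50 * Tt y ^ 2))
    (fun y => speed y * (mu y - (1 - Tt y ^ 2) * (3 / 16 - 9 / 50 * Tt y ^ 2))) 1 y); auto.
  - intros x Hx.
    assert (D1 := is_derive_mm x ltac:(lra)). assert (D2 := is_derive_Tt x ltac:(lra)).
    auto_derive; [repeat split; eexists; eauto|].
    rewrite (is_derive_unique (fun x : R => mm x) _ _ D1),
      (is_derive_unique (fun x : R => Tt x) _ _ D2). field.
  - rewrite mm_1, Tt_1; lra.
  - intros x Hx Hm. apply Rmult_le_pos; [left; apply speed_pos; lra|].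
    pose proof (vv_pos x ltac:(lra)). pose proof (nn_lower x ltac:(lra)).
    pose proof (Tt_nonneg x ltac:(lra)). pose proof (mm_nonneg x ltac:(lra)).
    assert (Hx9 : Tt x <= 9 / 10).
    { apply Rle_trans with (Tt y); auto. destruct (Req_dec x y) as [->|Hxy]; [lra|].
      left; apply Tt_increasing; lra. }
    pose proof (lower_barrier_poly (Tt x) ltac:(lra)) as P.
    assert (Hv : vv x = mm x - nn x) by (unfold mm; ring).
    unfold mu. set (t := Tt x) in *. set (l := t * (3 / 16 - 3 / 50 * t ^ 2)) in *.
    assert (mm x ^ 2 <= l ^ 2) by nra.
    assert (vv x ^ 2 <= (l + (1 - t) / 4) ^ 2) by nra. lra.
Qed.

(** Above the barrier [mm] and [vv = mm - nn] are both large. The estimate of [vv] takes [nn_upper]: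
    from [nn <= 0] alone the slope at 1 would only be bounded by 1/4. *)
Lemma mm_upper y : 1 <= y -> mm y <= Tt y * (1 / 5 - 3 / 100 * Tt y ^ 2).
Proof.
  intros Hy. apply Rminus_le_0.
  apply (barrier (fun y => Tt y * (1 / 5 - 3 / 100 * Tt y ^ 2) - mm y)
    (fun y => speed y * ((1 - Tt y ^ 2) * (1 / 5 - 9 / 100 * Tt y ^ 2) - mu y)) 1 y); auto.
  - intros x Hx.
    assert (D1 := is_derive_mm x ltac:(lra)). assert (D2 := is_derive_Tt x ltac:(lra)).
    auto_derive; [repeat split; eexists; eauto|].
    rewrite (is_derive_unique (fun x : R => mm x) _ _ D1),
      (is_derive_unique (fun x : R => Tt x) _ _ D2). field.
  - rewrite mm_1, Tt_1; lra.
  - intros x Hx Hm. apply Rmult_le_pos; [left; apply speed_pos; lra|].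
    pose proof (nn_upper x ltac:(lra)) as Hn. pose proof (nn_neg x ltac:(lra)).
    pose proof (Tt_nonneg x ltac:(lra)). pose proof (Tt_bounds x ltac:(lra)).
    pose proof (upper_barrier_poly (Tt x) ltac:(lra)) as P.
    assert (Hv : vv x = mm x - nn x) by (unfold mm; ring).
    unfold mu. set (t := Tt x) in *. set (l := t * (1 / 5 - 3 / 100 * t ^ 2)) in *.
    assert (Hl : 0 <= l) by (apply Rmult_le_pos; nra).
    set (d := (1 - t) / 4 - (1 - t) ^ 2 * (5 - 2 * t) / 192).
    assert (Hd : 0 <= d).
    { replace d with ((1 - t) * (48 - (1 - t) * (5 - 2 * t)) / 192) by (unfold d; field).
      apply Rdiv_le_0_compat; [apply Rmult_le_pos; nra|lra]. }
    replace (l + (1 - t) / 4 - (1 - t) ^ 2 * (5 - 2 * t) / 192) with (l + d) in P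
      by (unfold d; ring).
    assert (l ^ 2 <= mm x ^ 2) by nra.
    assert ((l + d) ^ 2 <= vv x ^ 2).
    { apply pow_incr. unfold d in *. lra. }
    lra.
Qed.

(** The constant slightly exceeds the cubic barrier at 9/10, so a violation can occur only for
    [Tt >= 9/10]; there [2 * (159/1000)^2 > (1 - (9/10)^2) / 4] makes [mu] negative. *)
Lemma mm_upper_tail y : 1 <= y -> mm y <= 159 / 1000.
Proof.
  intros Hy. apply Rminus_le_0.
  apply (barrier (fun y => 159 / 1000 - mm y) (fun y => - (speed y * mu y)) 1 y); auto.
  - intros x Hx. assert (D1 := is_derive_mm x ltac:(lra)).
    auto_derive; [repeat split; eexists; eauto|].
    rewrite (is_derive_unique (fun x : R => mm x) _ _ D1). ring.
  - rewrite mm_1; lra.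
  - intros x Hx Hm. pose proof (speed_pos x ltac:(lra)).
    pose proof (mm_upper x ltac:(lra)). pose proof (nn_neg x ltac:(lra)).
    pose proof (Tt_nonneg x ltac:(lra)). pose proof (Tt_bounds x ltac:(lra)).
    assert (H9 : 9 / 10 <= Tt x).
    { apply Rnot_lt_le; intros H9. set (t := Tt x) in *.
      (* This product is the cubic barrier at 9/10 minus the barrier at [t]. *)
      assert (0 <= (9 / 10 - t) * (1 / 5 - 3 / 100 * (81 / 100 + 9 / 10 * t + t ^ 2)))
        by (apply Rmult_le_pos; nra). lra. }
    assert (Hv : vv x = mm x - nn x) by (unfold mm; ring).
    assert (mu x <= 0); [|nra].
    unfold mu. assert ((159 / 1000) ^ 2 <= mm x ^ 2) by nra.
    assert ((159 / 1000) ^ 2 <= vv x ^ 2) by nra. nra.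
Qed.

(* [Gam] has the sign of the derivative of [W' / X'] for [W = sqrt (gth * kth) * X]. *)
Definition Gam (y : R) : R :=
  Tt y * mu y - Tt y * mm y ^ 2 + (Tt y ^ 2 / 2 - (1 - Tt y ^ 2)) * mm y.

Definition gam_source (t m : R) : R :=
  - t ^ 2 * (1 - t ^ 2) / 4 + t / 8 * (19 * (1 - t ^ 2) - 1) * m
  + 9 / 4 * (1 - 3 * (1 - t ^ 2)) * m ^ 2 - 6 * t * m ^ 3.

(* [vv] enters both sides only through [vv ^ 2], linearly, so it can be eliminated from
   the derivative in favour of [Gam] itself. *)
Lemma is_derive_Gam y : 0 < y ->
  is_derive Gam y (speed y * ((Tt y / 2 - 8 * mm y) * Gam y + 2 * gam_source (Tt y) (mm y))).
Proof.
  intros Hy.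
  assert (D1 := is_derive_mm y Hy). assert (D2 := is_derive_Tt y Hy).
  assert (D3 := is_derive_vv y Hy).
  unfold Gam at 1. unfold mu. auto_derive; [repeat split; eexists; eauto|].
  rewrite (is_derive_unique (fun x : R => mm x) _ _ D1),
    (is_derive_unique (fun x : R => Tt x) _ _ D2),
    (is_derive_unique (fun x : R => vv x) _ _ D3).
  unfold Gam, gam_source, mu. field.
Qed.

(** With [m = t x] the source is [t ^ 2] times a cubic [h] in [x], which lies above its chord over
    the window; its values at the two ends suffice. *)
Lemma gam_source_pos t m : 0 < t <= 9 / 10 ->
  t * (3 / 16 - 3 / 50 * t ^ 2) <= m <= t / 5 -> 0 < gam_source t m.
Proof.
  intros Ht Hm. set (x := m / t).
  assert (Em : m = t * x) by (unfold x; field; lra).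
  set (w := t ^ 2). assert (Hw : 0 < w <= 81 / 100) by (unfold w; nra).
  assert (Hx : 3 / 16 - 3 / 50 * w <= x <= 1 / 5).
  { unfold w; split; apply Rmult_le_reg_l with t; lra. }
  set (h := fun x => - (1 - w) / 4 + (19 * (1 - w) - 1) * x / 8
    + 9 / 4 * (1 - 3 * (1 - w)) * x ^ 2 - 6 * w * x ^ 3).
  replace (gam_source t m) with (t ^ 2 * h x).
  2:{ rewrite Em. unfold gam_source, h, w. field. }
  apply Rmult_lt_0_compat; [nra|].
  set (p := 3 / 16 - 3 / 50 * w) in *.
  assert (Hp : 0 < h p) by (unfold h, p; nra).
  assert (Hq : 0 < h (1 / 5)) by (unfold h; nra).
  assert (Pb : 138 / 1000 <= p <= 3 / 16) by (unfold p; lra).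
  assert (C : 0 <= 6 * w * (x + p + 1 / 5) - 9 / 4 * (1 - 3 * (1 - w))) by nra.
  (* Linear interpolation with remainder: the last factor is minus the second divided difference of
     [h] at [x], [p] and 1/5. *)
  assert (E : (1 / 5 - p) * h x = (1 / 5 - x) * h p + (x - p) * h (1 / 5)
    + (1 / 5 - p) * ((x - p) * (1 / 5 - x) *
      (6 * w * (x + p + 1 / 5) - 9 / 4 * (1 - 3 * (1 - w))))) by (unfold h; field).
  assert (0 <= (x - p) * (1 / 5 - x) *
      (6 * w * (x + p + 1 / 5) - 9 / 4 * (1 - 3 * (1 - w)))).
  { apply Rmult_le_pos; auto. apply Rmult_le_pos; lra. }
  apply Rmult_lt_reg_l with (1 / 5 - p); [lra|]. rewrite E, Rmult_0_r.
  assert (0 < (1 / 5 - x) * h p + (x - p) * h (1 / 5)).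
  { destruct (Rle_lt_or_eq_dec p x) as [Hpx|Hpx]; [lra| |].
    - apply Rplus_le_lt_0_compat; [apply Rmult_le_pos; lra|apply Rmult_lt_0_compat; lra].
    - rewrite <- Hpx. apply Rplus_lt_le_0_compat;
        [apply Rmult_lt_0_compat; lra|apply Rmult_le_pos; lra]. }
  nra.
Qed.

Lemma Gam_pos y : 1 < y -> 0 < Gam y.
Proof.
  intros Hy. destruct (Rle_dec (Tt y) (9 / 10)) as [HT|HT].
  - apply (barrier_strict Gam (fun y => speed y *
      ((Tt y / 2 - 8 * mm y) * Gam y + 2 * gam_source (Tt y) (mm y))) 1 y); auto.
    + intros x Hx; apply is_derive_Gam; lra.
    + unfold Gam. rewrite Tt_1, mm_1. lra.
    + intros x Hx HG. apply Rmult_lt_0_compat; [apply speed_pos; lra|].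
      pose proof (Tt_pos x ltac:(lra)).
      assert (Hx9 : Tt x <= 9 / 10).
      { apply Rle_trans with (Tt y); auto. destruct (Req_dec x y) as [->|Hxy]; [lra|].
        left; apply Tt_increasing; lra. }
      pose proof (mm_lower x ltac:(lra) Hx9) as ML. pose proof (mm_upper x ltac:(lra)) as MU.
      set (t := Tt x) in *. set (m := mm x) in *.
      assert (0 < gam_source t m) by (apply gam_source_pos; nra).
      (* The coefficient of [Gam] is nonpositive, so where [Gam <= 0] the linear term cannot offset
         the source. *)
      assert (t / 2 - 8 * m <= 0) by nra. nra.
  - pose proof (Tt_bounds y ltac:(lra)). pose proof (mm_nonneg y ltac:(lra)).
    pose proof (mm_upper_tail y ltac:(lra)). pose proof (nn_lower y ltac:(lra)).
    pose proof (vv_pos y ltac:(lra)).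
    pose proof (tail_poly (Tt y) ltac:(lra)) as P.
    assert (Hv : vv y = mm y - nn y) by (unfold mm; ring).
    unfold Gam, mu. set (t := Tt y) in *. set (m := mm y) in *. set (M := 159 / 1000) in *.
    assert (Hv2 : vv y ^ 2 <= (m + (1 - t) / 4) ^ 2) by nra.
    (* [q] is [Gam] with [vv] replaced by its upper bound. Its coefficient of [m ^ 2] is [- 3 t], so
       by concavity the ends 0 and [M] suffice. *)
    set (q := fun m => t * ((1 - t ^ 2) / 4 - (m + (1 - t) / 4) ^ 2 - 2 * m ^ 2)
      + (t ^ 2 / 2 - (1 - t ^ 2)) * m).
    apply Rlt_le_trans with (q m).
    + assert (Q0 : 0 < q 0) by (unfold q; nra).
      assert (QM : 0 < q M) by exact P.
      assert (E : M * q m = (M - m) * q 0 + m * q M + M * (3 * t * (m * (M - m))))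
        by (unfold q; ring).
      assert (0 <= 3 * t * (m * (M - m))) by (apply Rmult_le_pos; [lra|apply Rmult_le_pos; lra]).
      assert (0 < (M - m) * q 0 + m * q M).
      { destruct (Req_dec m 0) as [->|Hm0]; [unfold M; lra|].
        apply Rplus_le_lt_0_compat; [apply Rmult_le_pos; lra|apply Rmult_lt_0_compat; lra]. }
      apply Rmult_lt_reg_l with M; [unfold M; lra|]. rewrite E.
      assert (0 < M) by (unfold M; lra). nra.
    + unfold q. nra.
Qed.

(** * The quotients *)

Lemma inv_arg_pos y : 0 < y -> 0 < 1 / y.
Proof. intros Hy; apply Rdiv_lt_0_compat; lra. Qed.

Lemma one_lt_inv_arg y : 0 < y < 1 -> 1 < 1 / y.
Proof.
  intros Hy. apply Rmult_lt_reg_r with y; [lra|].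
  replace (1 / y * y) with 1 by (field; lra). lra.
Qed.

Lemma theta3_inv y : 0 < y -> theta3 (1 / y) = sqrt y * theta3 y.
Proof.
  intros Hy. pose proof (Fth_inv y Hy) as E. unfold Fth in E.
  pose proof (theta3_pos y Hy). pose proof (theta3_pos _ (inv_arg_pos y Hy)).
  pose proof (sqrt_lt_R0 y Hy).
  apply Rsqr_inj; try nra. rewrite !Rsqr_pow2, Rpow_mult_distr, pow2_sqrt by lra. auto.
Qed.

Lemma theta4_inv y : 0 < y -> theta4 (1 / y) = sqrt y * theta2 y.
Proof.
  intros Hy. pose proof (gth_inv y Hy) as E. unfold gth, kth in E.
  pose proof (theta3_pos y Hy). pose proof (theta2_pos y Hy).
  pose proof (theta3_pos _ (inv_arg_pos y Hy)). pose proof (theta4_pos _ (inv_arg_pos y Hy)).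
  rewrite <- !Rsqr_pow2 in E. apply Rsqr_inj in E;
    try (left; apply Rdiv_lt_0_compat; auto).
  rewrite theta3_inv in E by auto. pose proof (sqrt_lt_R0 y Hy).
  transitivity (theta4 (1 / y) / (sqrt y * theta3 y) * (sqrt y * theta3 y)); [field; lra|].
  rewrite E. field. lra.
Qed.

Lemma theta2_inv y : 0 < y -> theta2 (1 / y) = sqrt y * theta4 y.
Proof.
  intros Hy. pose proof (theta4_inv (1 / y) (inv_arg_pos y Hy)) as E.
  replace (1 / (1 / y)) with y in E by (field; lra). rewrite E.
  rewrite <- Rmult_assoc, <- sqrt_mult by (pose proof (inv_arg_pos y Hy); lra).
  replace (y * (1 / y)) with 1 by (field; lra). rewrite sqrt_1; ring.
Qed.

Definition Xf (y : R) : R := sqrt y * Fth y.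
Definition wf (y : R) : R := sqrt (gth y * kth y).
Definition sf (y : R) : R := (gth y + kth y - 1) / 2.
(** Minus the [tau] derivative of [sf], divided by [Tt]; the denominator comes from [gth ^ 2 - kth ^
    2 = (gth - kth) * (gth + kth)]. *)
Definition ef (y : R) : R := gth y * kth y / (2 * (gth y + kth y)).

Lemma calX_eq y : 0 < y -> calX y = 1 * Xf y.
Proof. intros Hy. unfold calX, Xf, Fth. rewrite theta3_inv by auto. ring. Qed.

Lemma calY_eq y : 0 < y -> calY y = (1 + wf y) * Xf y.
Proof.
  intros Hy. assert (Hi := inv_arg_pos y Hy). unfold calY.
  replace (4 / y) with (4 * (1 / y)) by (field; lra).
  (* Polarisation: [2 (a a' + b b') = (a + b) (a' + b') + (a - b) (a' - b')]. *)
  transitivity (theta3 y * theta3 (1 / y) + theta4 y * theta4 (1 / y)).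
  { rewrite (theta3_split y), (theta3_split (1 / y)) by auto. unfold theta4. ring. }
  pose proof (theta3_pos y Hy). pose proof (theta2_pos y Hy). pose proof (theta4_pos y Hy).
  assert (E : wf y = theta4 y * theta2 y / theta3 y ^ 2).
  { unfold wf, gth, kth. rewrite <- (sqrt_pow2 (theta4 y * theta2 y / theta3 y ^ 2)).
    - f_equal. field. lra.
    - left; apply Rdiv_lt_0_compat; nra. }
  rewrite theta3_inv, theta4_inv, E by auto. unfold Xf, Fth. field. lra.
Qed.

Lemma sqrt2_sqrt_half y : 0 < y -> sqrt 2 * sqrt (y / 2) = sqrt y.
Proof. intros Hy. rewrite <- sqrt_mult by lra. f_equal; field. Qed.

Lemma theta2_sq_double_gth y : 0 < y -> theta2 (2 * y) ^ 2 = Fth y * (1 - gth y) / 2.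
Proof.
  intros Hy. pose proof (theta2_sq_double y Hy) as E. pose proof (theta3_pos y Hy).
  transitivity ((2 * theta2 (2 * y) ^ 2) / 2); [field|]. rewrite E.
  unfold Fth, gth. field. lra.
Qed.

Lemma theta2_theta3_double_kth y : 0 < y -> theta2 (2 * y) * theta3 (2 * y) = Fth y * kth y / 2.
Proof.
  intros Hy. pose proof (theta2_sq y Hy) as E. pose proof (theta3_pos y Hy).
  transitivity ((2 * theta2 (2 * y) * theta3 (2 * y)) / 2); [field|]. rewrite <- E.
  unfold Fth, kth. field. lra.
Qed.

(** Inversion turns [theta3 (2 / y)] into [theta3 (y / 2)], which splits into theta functions at
    [2 y]. *)
Lemma calA_eq y : 0 < y -> calA y = (1 + sf y) * Xf y.
Proof.
  intros Hy. unfold calA. replace (2 / y) with (1 / (y / 2)) by (field; lra).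
  rewrite theta3_inv by lra.
  replace (sqrt 2 * theta3 (2 * y) * (sqrt (y / 2) * theta3 (y / 2))) with
    ((sqrt 2 * sqrt (y / 2)) * (theta3 (2 * y) * theta3 (y / 2))) by ring.
  rewrite sqrt2_sqrt_half, (theta3_split (y / 2)) by lra.
  replace (4 * (y / 2)) with (2 * y) by field.
  replace (theta3 (2 * y) * _) with
    (theta3 (2 * y) ^ 2 + theta2 (2 * y) * theta3 (2 * y)) by ring.
  fold (Fth (2 * y)). rewrite Fth_double, theta2_theta3_double_kth by auto.
  unfold Xf, sf. field.
Qed.

Lemma calB_eq y : 0 < y -> calB y = sf y * Xf y.
Proof.
  intros Hy. unfold calB. replace (2 / y) with (1 / (y / 2)) by (field; lra).
  rewrite theta2_inv by lra.
  replace (sqrt 2 * theta2 (2 * y) * (sqrt (y / 2) * theta4 (y / 2))) with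
    ((sqrt 2 * sqrt (y / 2)) * (theta2 (2 * y) * theta4 (y / 2))) by ring.
  rewrite sqrt2_sqrt_half by lra. unfold theta4.
  replace (4 * (y / 2)) with (2 * y) by field.
  replace (theta2 (2 * y) * (theta3 _ - _)) with
    (theta2 (2 * y) * theta3 (2 * y) - theta2 (2 * y) ^ 2) by ring.
  rewrite theta2_sq_double_gth, theta2_theta3_double_kth by auto.
  unfold Xf, sf. field.
Qed.

Lemma Xf_pos y : 0 < y -> 0 < Xf y.
Proof. intros Hy. apply Rmult_lt_0_compat; [apply sqrt_lt_R0|apply Fth_pos]; auto. Qed.

Lemma is_derive_Xf y : 0 < y -> is_derive Xf y (speed y * (mm y * Xf y)).
Proof.
  intros Hy. pose proof (theta3_pos y Hy). pose proof (sqrt_lt_R0 y Hy) as Hs.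
  pose proof PI_RGT_0. assert (D := is_derive_Fth y Hy).
  unfold Xf at 1. auto_derive; [repeat split; auto; eexists; eauto|].
  rewrite (is_derive_unique (fun x : R => Fth x) _ _ D).
  unfold Xf, speed, mm, nn, vv, Fth.
  assert (Er : y = sqrt y ^ 2) by (symmetry; apply pow2_sqrt; lra).
  set (t := theta3 y) in *. set (d := dtheta3 y) in *. set (r := sqrt y) in *.
  rewrite Er. field. lra.
Qed.

Lemma gk_sum_pos y : 0 < y -> 0 < gth y + kth y.
Proof. intros Hy; pose proof (gth_pos y Hy); pose proof (kth_pos y Hy); lra. Qed.

Lemma is_derive_wf y : 0 < y -> is_derive wf y (speed y * (- (wf y / 2) * Tt y)).
Proof.
  intros Hy. assert (Dg := is_derive_gth y Hy). assert (Dk := is_derive_kth y Hy).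
  pose proof (gth_pos y Hy). pose proof (kth_pos y Hy).
  assert (P : 0 < gth y * kth y) by nra. pose proof (sqrt_lt_R0 _ P) as Hs.
  unfold wf at 1. auto_derive; [repeat split; auto; eexists; eauto|].
  rewrite (is_derive_unique (fun x : R => gth x) _ _ Dg),
    (is_derive_unique (fun x : R => kth x) _ _ Dk).
  unfold wf, Tt.
  apply Rmult_eq_reg_l with (2 * sqrt (gth y * kth y)); [|lra].
  transitivity (speed y * (gth y * kth y) * (kth y ^ 2 - gth y ^ 2)); [field; lra|].
  rewrite <- (sqrt_sqrt (gth y * kth y)) at 1 by lra. field.
Qed.

Lemma is_derive_sf y : 0 < y -> is_derive sf y (speed y * (- ef y * Tt y)).
Proof.
  intros Hy. assert (Dg := is_derive_gth y Hy). assert (Dk := is_derive_kth y Hy).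
  pose proof (gk_sum_pos y Hy).
  unfold sf. auto_derive; [repeat split; eexists; eauto|].
  rewrite (is_derive_unique (fun x : R => gth x) _ _ Dg),
    (is_derive_unique (fun x : R => kth x) _ _ Dk).
  unfold ef, Tt. field. lra.
Qed.

Lemma is_derive_ef y : 0 < y -> is_derive ef y
  (speed y * (ef y * Tt y * (gth y * kth y / (gth y + kth y) ^ 2 - 1))).
Proof.
  intros Hy. assert (Dg := is_derive_gth y Hy). assert (Dk := is_derive_kth y Hy).
  pose proof (gk_sum_pos y Hy).
  unfold ef at 1. auto_derive; [repeat split; try lra; eexists; eauto|].
  rewrite (is_derive_unique (fun x : R => gth x) _ _ Dg),
    (is_derive_unique (fun x : R => kth x) _ _ Dk).
  unfold ef, Tt. field. lra.
Qed.

(** * Symmetry under inversion *)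

Lemma derive_of_inv_symmetric (f : R -> R) y l : 0 < y ->
  (forall x, 0 < x -> f (1 / x) = f x) -> is_derive f (1 / y) l ->
  is_derive f y (- l / y ^ 2).
Proof.
  intros Hy Hf D. apply (is_derive_ext_pos (fun x => f (1 / x))); auto.
  apply is_derive_inv_arg; auto.
Qed.

Lemma mul_inv_symmetric f g (c : R) x : 0 < x ->
  f (c * (1 / x)) * g (c / (1 / x)) = f (c / x) * g (c * x).
Proof. intros Hx. f_equal; f_equal; field; lra. Qed.

Lemma calX_inv x : 0 < x -> calX (1 / x) = calX x.
Proof.
  intros Hx. unfold calX. replace (1 / (1 / x)) with x by (field; lra). ring.
Qed.

Lemma calY_inv x : 0 < x -> calY (1 / x) = calY x.
Proof. intros Hx. unfold calY. rewrite !mul_inv_symmetric by auto. ring. Qed.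

Lemma calA_inv x : 0 < x -> calA (1 / x) = calA x.
Proof.
  intros Hx. unfold calA. rewrite !Rmult_assoc, !mul_inv_symmetric by auto. ring.
Qed.

Lemma calB_inv x : 0 < x -> calB (1 / x) = calB x.
Proof.
  intros Hx. unfold calB. rewrite !Rmult_assoc, !mul_inv_symmetric by auto. ring.
Qed.

Lemma derive_quotient_inv F G : 
  (forall x, 0 < x -> F (1 / x) = F x) -> (forall x, 0 < x -> G (1 / x) = G x) ->
  (forall x, 0 < x -> ex_derive F x) -> (forall x, 0 < x -> ex_derive G x) ->
  forall y, 0 < y -> derive_quotient F G (1 / y) = derive_quotient F G y.
Proof.
  intros HF HG DF DG y Hy. unfold derive_quotient.
  assert (Hi := inv_arg_pos y Hy).
  destruct (Req_EM_T y 1) as [->|H1].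
  { destruct (Req_EM_T (1 / 1) 1) as [|H]; [auto|exfalso; apply H; field]. }
  destruct (Req_EM_T (1 / y) 1) as [E|H1'].
  { exfalso; apply H1. replace y with (1 / (1 / y)) by (field; lra). rewrite E; field. }
  pose proof (derive_of_inv_symmetric F y _ Hy HF (Derive_correct _ _ (DF _ Hi))) as EF.
  pose proof (derive_of_inv_symmetric G y _ Hy HG (Derive_correct _ _ (DG _ Hi))) as EG.
  rewrite (is_derive_unique _ _ _ EF), (is_derive_unique _ _ _ EG).
  set (a := Derive F (1 / y)). set (b := Derive G (1 / y)).
  (* Nonvanishing of the derivative of [G] is not assumed; where it vanishes, both quotients are 0
     by the convention [/ 0 = 0]. *)
  destruct (Req_dec b 0) as [Hb|Hb].
  - rewrite Hb. replace (- 0 / y ^ 2) with 0 by (field; lra).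
    unfold Rdiv. rewrite Rinv_0. ring.
  - field. repeat split; lra.
Qed.

(** Inversion reverses the sign of the derivative, which settles [y < 1] and makes the derivative at
    1 its own negative. *)
Lemma inv_symmetric_valley (Q : R -> R) :
  (forall y, 0 < y -> Q (1 / y) = Q y) -> ex_derive Q 1 ->
  (forall y, 1 < y -> exists d, is_derive Q y d /\ 0 < d) ->
  (forall y, 0 < y -> ex_derive Q y) /\
  (forall y, 0 < y -> (is_derive Q y 0 <-> y = 1)) /\
  (forall y, 0 < y < 1 -> Derive Q y < 0) /\
  (forall y, 1 < y -> Derive Q y > 0).
Proof.
  intros HQ H1 Hgt.
  assert (Hlt : forall y, 0 < y < 1 -> exists d, is_derive Q y d /\ d < 0).
  { intros y Hy. destruct (Hgt (1 / y)) as (d & Hd & Pd).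
    - apply one_lt_inv_arg; auto.
    - exists (- d / y ^ 2). split; [apply derive_of_inv_symmetric; auto; lra|].
      assert (0 < d / y ^ 2) by (apply Rdiv_lt_0_compat; [auto|apply pow_lt; lra]).
      unfold Rdiv in *. rewrite Ropp_mult_distr_l_reverse. lra. }
  assert (D1 : is_derive Q 1 0).
  { destruct H1 as [d Hd].
    assert (Hd' : is_derive Q 1 (- d / 1 ^ 2)).
    { apply derive_of_inv_symmetric; auto; [lra|]. replace (1 / 1) with 1 by field. auto. }
    pose proof (is_derive_unique _ _ _ Hd). pose proof (is_derive_unique _ _ _ Hd').
    replace 0 with d by lra. auto. }
  split; [|split; [|split]].
  - intros y Hy. destruct (Rtotal_order y 1) as [H|[->|H]].
    + destruct (Hlt y ltac:(lra)) as (d & Hd & _). eexists; eauto.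
    + auto.
    + destruct (Hgt y H) as (d & Hd & _). eexists; eauto.
  - intros y Hy0; split; [|intros ->; auto].
    intros D0. apply is_derive_unique in D0.
    destruct (Rtotal_order y 1) as [Hy|[Hy|Hy]]; auto; exfalso.
    + destruct (Hlt y ltac:(lra)) as (d & Hd & Pd). apply is_derive_unique in Hd. lra.
    + destruct (Hgt y Hy) as (d & Hd & Pd). apply is_derive_unique in Hd. lra.
  - intros y Hy. destruct (Hlt y Hy) as (d & Hd & Pd). apply is_derive_unique in Hd. lra.
  - intros y Hy. destruct (Hgt y Hy) as (d & Hd & Pd). apply is_derive_unique in Hd. lra.
Qed.

(** * Removing the common zero at 1 *)

Definition divided_difference (f : R -> R) (l x y : R) : R :=
  if Req_EM_T y x then l else f y / (y - x).

(** The mean value theorem for the second-order Taylor remainder [G] of [f]: its derivative is the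
    first-order remainder of [df], which is small against [h]. *)
Lemma is_derive_divided_difference (f df : R -> R) (x ddf : R) : f x = 0 ->
  locally x (fun y => is_derive f y (df y)) -> is_derive df x ddf ->
  is_derive (divided_difference f (df x) x) x (ddf / 2).
Proof.
  intros Hf [r Hr] DD. apply is_derive_Reals. intros eps Heps.
  apply is_derive_Reals in DD. destruct (DD (eps / 2) ltac:(lra)) as [del Hdel].
  assert (Hd : 0 < Rmin del r / 2).
  { pose proof (Rmin_pos del r (cond_pos del) (cond_pos r)). lra. }
  exists (mkposreal _ Hd). intros h Hh Hhd. simpl in Hhd.
  pose proof (Rmin_l del r). pose proof (Rmin_r del r).
  set (G := fun t => f (x + t) - df x * t - ddf / 2 * t ^ 2).
  assert (DG : forall t, Rabs t <= Rabs h ->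
    is_derive G t (df (x + t) - df x - ddf * t)).
  { intros t Ht. unfold G.
    assert (Dt : is_derive f (x + t) (df (x + t))).
    { apply Hr. unfold ball; simpl; unfold AbsRing_ball, abs, minus, plus, opp; simpl.
      replace (x + t + - x) with t by ring. lra. }
    auto_derive; [eexists; eauto|].
    rewrite (is_derive_unique (fun x : R => f x) _ _ Dt). field. }
  destruct (MVT_gen G 0 h (fun t => df (x + t) - df x - ddf * t)) as (c & Hc & E).
  { intros t Ht. apply DG. unfold Rabs, Rmin, Rmax in *.
    destruct (Rle_dec 0 h), (Rcase_abs t), (Rcase_abs h); lra. }
  { intros t Ht. apply is_derive_continuity_pt with (df (x + t) - df x - ddf * t).
    apply DG. unfold Rabs, Rmin, Rmax in *.
    destruct (Rle_dec 0 h), (Rcase_abs t), (Rcase_abs h); lra. }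
  assert (Hch : Rabs c <= Rabs h).
  { unfold Rabs, Rmin, Rmax in *.
    destruct (Rle_dec 0 h), (Rcase_abs c), (Rcase_abs h); lra. }
  assert (B : Rabs (df (x + c) - df x - ddf * c) <= eps / 2 * Rabs h).
  { destruct (Req_dec c 0) as [->|Hc0].
    - rewrite Rplus_0_r. replace (df x - df x - ddf * 0) with 0 by ring.
      rewrite Rabs_R0. pose proof (Rabs_pos h). nra.
    - specialize (Hdel c Hc0 ltac:(lra)).
      replace (df (x + c) - df x - ddf * c) with
        (((df (x + c) - df x) / c - ddf) * c) by (field; auto).
      rewrite Rabs_mult. apply Rmult_le_compat; auto using Rabs_pos. lra. }
  unfold divided_difference.
  destruct (Req_EM_T (x + h) x) as [Hx|Hx]; [lra|].
  destruct (Req_EM_T x x) as [_|Hx']; [|lra].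
  assert (E0 : G 0 = 0) by (unfold G; rewrite Rplus_0_r, Hf; ring).
  replace ((f (x + h) / (x + h - x) - df x) / h - ddf / 2) with (G h / h ^ 2)
    by (unfold G; field; lra).
  rewrite E0, !Rminus_0_r in E. rewrite E.
  replace ((df (x + c) - df x - ddf * c) * h / h ^ 2) with
    ((df (x + c) - df x - ddf * c) * / h) by (field; auto).
  rewrite Rabs_mult, Rabs_inv.
  assert (Ph : 0 < Rabs h) by (apply Rabs_pos_lt; auto).
  apply Rle_lt_trans with (eps / 2 * Rabs h * / Rabs h).
  - apply Rmult_le_compat_r; auto. left; apply Rinv_0_lt_compat; auto.
  - rewrite Rmult_assoc, Rinv_r by lra. lra.
Qed.

(** At 1 one has [vv = - nn <= 1/4], since [mm] vanishes. *)
Lemma mu_1 : 3 / 16 <= mu 1.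
Proof.
  pose proof mm_1 as M. pose proof Tt_1 as T.
  pose proof (nn_lower 1 ltac:(lra)) as N. pose proof (vv_pos 1 ltac:(lra)) as V.
  unfold mu. rewrite M, T in *. unfold mm in M. nra.
Qed.

(* [Tt / mm], extended across the common zero [y = 1]. *)
Definition zf (y : R) : R :=
  divided_difference Tt (speed 1 * (1 - Tt 1 ^ 2)) 1 y /
  divided_difference mm (speed 1 * mu 1) 1 y.

Lemma zf_eq y : y <> 1 -> mm y <> 0 -> zf y = Tt y / mm y.
Proof.
  intros Hy Hm. unfold zf, divided_difference.
  destruct (Req_EM_T y 1) as [|_]; [contradiction|]. field. split; auto. lra.
Qed.

Lemma zf_1 : zf 1 = 1 / mu 1.
Proof.
  unfold zf, divided_difference. destruct (Req_EM_T 1 1) as [_|]; [|contradiction].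
  rewrite Tt_1. pose proof mu_1. pose proof (speed_pos 1 ltac:(lra)). field. lra.
Qed.

Lemma ex_derive_speed y : 0 < y -> ex_derive speed y.
Proof.
  intros Hy. assert (D := is_derive_Fth y Hy).
  unfold speed. auto_derive. eexists; eauto.
Qed.

Lemma ex_derive_zf_1 : ex_derive zf 1.
Proof.
  pose proof mu_1 as M. pose proof (speed_pos 1 ltac:(lra)) as P.
  assert (D1 := is_derive_Tt 1 ltac:(lra)). assert (D2 := is_derive_mm 1 ltac:(lra)).
  assert (D3 := is_derive_vv 1 ltac:(lra)). assert (D4 := ex_derive_speed 1 ltac:(lra)).
  assert (L : locally 1 (fun y => 0 < y)) by (apply locally_pos; lra).
  assert (E1 : ex_derive (divided_difference Tt (speed 1 * (1 - Tt 1 ^ 2)) 1) 1).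
  { assert (DD : ex_derive (fun y => speed y * (1 - Tt y ^ 2)) 1).
    { auto_derive. repeat split; auto; eexists; eauto. }
    destruct DD as [dd DD].
    eexists; apply (is_derive_divided_difference Tt (fun y => speed y * (1 - Tt y ^ 2)));
      [apply Tt_1| |exact DD].
    apply filter_imp with (2 := L). apply is_derive_Tt. }
  assert (E2 : ex_derive (divided_difference mm (speed 1 * mu 1) 1) 1).
  { assert (DD : ex_derive (fun y => speed y * mu y) 1).
    { unfold mu. auto_derive. repeat split; auto; eexists; eauto. }
    destruct DD as [dd DD].
    eexists; apply (is_derive_divided_difference mm (fun y => speed y * mu y));
      [apply mm_1| |exact DD].
    apply filter_imp with (2 := L). apply is_derive_mm. }
  apply ex_derive_div; auto.
  unfold divided_difference. destruct (Req_EM_T 1 1) as [_|]; [nra|contradiction].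
Qed.

Lemma is_derive_zf y : 1 < y ->
  is_derive zf y (speed y * ((1 - Tt y ^ 2) * mm y - Tt y * mu y) / mm y ^ 2).
Proof.
  intros Hy. assert (D1 := is_derive_Tt y ltac:(lra)). assert (D2 := is_derive_mm y ltac:(lra)).
  pose proof (mm_pos y Hy).
  apply (is_derive_ext_loc (fun y => Tt y / mm y)).
  - assert (L : locally y (fun x => 1 < x)) by (apply (open_gt 1); auto).
    apply filter_imp with (2 := L). intros x Hx. pose proof (mm_pos x Hx).
    symmetry; apply zf_eq; lra.
  - evar_last; [apply is_derive_div; eauto; lra|]. simpl. field. lra.
Qed.

(** All four functions have this shape: [kappa] is 0 for [calX], [wf / 2] for [calY], and [ef] for
    both [calA] and [calB]. *)
Lemma is_derive_shape (f phi kappa : R -> R) :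
  (forall y, 0 < y -> f y = phi y * Xf y) ->
  (forall y, 0 < y -> is_derive phi y (speed y * (- kappa y * Tt y))) ->
  forall y, 0 < y -> is_derive f y (speed y * Xf y * (phi y * mm y - kappa y * Tt y)).
Proof.
  intros Hf Dphi y Hy. apply (is_derive_ext_pos (fun y => phi y * Xf y)); auto.
  { intros; symmetry; auto. }
  evar_last.
  - apply (is_derive_mult phi Xf); [apply Dphi; auto|apply is_derive_Xf; auto|].
    intros; apply Rmult_comm.
  - unfold plus, mult; simpl. ring.
Qed.

(** The derivative of [calX] is a positive multiple of [mm], so the symmetry of [calX] carries
    [mm_pos] over to [y < 1]. *)
Lemma mm_neq_0 y : 0 < y -> y <> 1 -> mm y <> 0.
Proof.
  intros Hy H1. destruct (Rtotal_order y 1) as [H|[H|H]]; [|contradiction|].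
  - assert (Hi : 1 < 1 / y) by (apply one_lt_inv_arg; lra).
    assert (D : forall y, 0 < y -> is_derive calX y (speed y * Xf y * (1 * mm y - 0 * Tt y))).
    { apply (is_derive_shape calX (fun _ => 1) (fun _ => 0)); [apply calX_eq|].
      intros x Hx. evar_last; [apply is_derive_const|unfold zero; simpl; ring]. }
    pose proof (derive_of_inv_symmetric calX y _ Hy calX_inv (D _ (inv_arg_pos y Hy))) as D'.
    pose proof (is_derive_unique _ _ _ D') as U1.
    pose proof (is_derive_unique _ _ _ (D y Hy)) as U2.
    intros E. rewrite U1, E in U2.
    pose proof (speed_pos _ (inv_arg_pos y Hy)). pose proof (Xf_pos _ (inv_arg_pos y Hy)).
    pose proof (mm_pos _ Hi).
    assert (P : 0 < speed (1 / y) * Xf (1 / y) * (1 * mm (1 / y) - 0 * Tt (1 / y)) / y ^ 2).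
    { apply Rdiv_lt_0_compat; [|apply pow_lt; auto].
      rewrite Rmult_0_l, Rminus_0_r, Rmult_1_l.
      apply Rmult_lt_0_compat; auto. apply Rmult_lt_0_compat; auto. }
    unfold Rdiv in *. rewrite Ropp_mult_distr_l_reverse in U2. lra.
  - pose proof (mm_pos y H). lra.
Qed.

Lemma Derive_shape (f phi kappa : R -> R) :
  (forall y, 0 < y -> f y = phi y * Xf y) ->
  (forall y, 0 < y -> is_derive phi y (speed y * (- kappa y * Tt y))) ->
  forall y, 0 < y -> y <> 1 ->
  Derive f y = speed y * Xf y * mm y * (phi y - kappa y * zf y).
Proof.
  intros Hf Dphi y Hy H1. pose proof (mm_neq_0 y Hy H1).
  rewrite (is_derive_unique _ _ _ (is_derive_shape f phi kappa Hf Dphi y Hy)).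
  rewrite zf_eq by auto. field. auto.
Qed.

(** [mm] and [Tt] vanish at 1, so only the terms with their derivatives survive; by
    [zf 1 = 1 / mu 1] the last factor is the same as in [Derive_shape]. *)
Lemma Derive_n_2_shape (f phi kappa : R -> R) :
  (forall y, 0 < y -> f y = phi y * Xf y) ->
  (forall y, 0 < y -> is_derive phi y (speed y * (- kappa y * Tt y))) ->
  ex_derive kappa 1 ->
  Derive_n f 2 1 = speed 1 ^ 2 * Xf 1 * mu 1 * (phi 1 - kappa 1 * zf 1).
Proof.
  intros Hf Dphi Dk. pose proof mu_1.
  transitivity (Derive (fun y => speed y * Xf y * (phi y * mm y - kappa y * Tt y)) 1).
  - simpl. apply Derive_ext_loc.
    apply filter_imp with (2 := locally_pos 1 ltac:(lra)). intros y Hy.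
    apply (is_derive_unique f). apply is_derive_shape; auto.
  - assert (D1 := is_derive_Tt 1 ltac:(lra)). assert (D2 := is_derive_mm 1 ltac:(lra)).
    assert (D3 := ex_derive_speed 1 ltac:(lra)). assert (D4 := is_derive_Xf 1 ltac:(lra)).
    assert (D5 := Dphi 1 ltac:(lra)).
    apply is_derive_unique. auto_derive; [repeat split; auto; eexists; eauto|].
    rewrite (is_derive_unique (fun x : R => Tt x) _ _ D1),
      (is_derive_unique (fun x : R => mm x) _ _ D2).
    rewrite zf_1, mm_1, Tt_1. field. lra.
Qed.

(** The prefactors cancel, and the value prescribed at 1 falls under the same formula as the other
    points. *)
Lemma derive_quotient_shape (F G phi kappa psi lam : R -> R) :
  (forall y, 0 < y -> F y = phi y * Xf y) ->
  (forall y, 0 < y -> is_derive phi y (speed y * (- kappa y * Tt y))) ->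
  ex_derive kappa 1 ->
  (forall y, 0 < y -> G y = psi y * Xf y) ->
  (forall y, 0 < y -> is_derive psi y (speed y * (- lam y * Tt y))) ->
  ex_derive lam 1 ->
  forall y, 0 < y -> psi y - lam y * zf y <> 0 ->
  derive_quotient F G y = (phi y - kappa y * zf y) / (psi y - lam y * zf y).
Proof.
  intros HF Dphi Dk HG Dpsi Dl y Hy HN.
  pose proof (speed_pos y Hy). pose proof (Xf_pos y Hy).
  unfold derive_quotient. destruct (Req_EM_T y 1) as [->|H1].
  - rewrite (Derive_n_2_shape F phi kappa), (Derive_n_2_shape G psi lam) by auto.
    pose proof mu_1. field. repeat split; lra.
  - rewrite (Derive_shape F phi kappa), (Derive_shape G psi lam) by auto.
    pose proof (mm_neq_0 y Hy H1). field. repeat split; lra.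
Qed.

Lemma is_derive_one y : 0 < y -> is_derive (fun _ => 1) y (speed y * (- 0 * Tt y)).
Proof. intros Hy. evar_last; [apply is_derive_const|unfold zero; simpl; ring]. Qed.

Lemma is_derive_one_plus (f : R -> R) (y l : R) : is_derive f y l ->
  is_derive (fun y => 1 + f y) y l.
Proof.
  intros D. evar_last.
  - apply (is_derive_plus (fun _ => 1) f); [apply is_derive_const|exact D].
  - unfold plus, zero; simpl. ring.
Qed.

(** * Slopes and denominators of the two quotients *)

Definition Den (y : R) : R := 1 + sf y - ef y * zf y.

Lemma is_derive_sf_minus_ef_zf y : 1 < y -> is_derive (fun y => sf y - ef y * zf y) y
  (speed y * (ef y / mm y ^ 2) *
    (Gam y + Tt y ^ 2 * mm y * (1 / 2 - gth y * kth y / (gth y + kth y) ^ 2))).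
Proof.
  intros Hy. assert (D1 := is_derive_sf y ltac:(lra)). assert (D2 := is_derive_ef y ltac:(lra)).
  assert (D3 := is_derive_zf y Hy). pose proof (mm_pos y Hy).
  pose proof (gk_sum_pos y ltac:(lra)).
  auto_derive; [repeat split; eexists; eauto|].
  rewrite (is_derive_unique (fun x : R => sf x) _ _ D1),
    (is_derive_unique (fun x : R => ef x) _ _ D2),
    (is_derive_unique (fun x : R => zf x) _ _ D3).
  rewrite zf_eq by lra. unfold Gam. field. lra.
Qed.

(** The term added to [Gam] is nonnegative by [2 g k <= (g + k)^2]. *)
Lemma sf_minus_ef_zf_slope_pos y : 1 < y ->
  0 < speed y * (ef y / mm y ^ 2) *
    (Gam y + Tt y ^ 2 * mm y * (1 / 2 - gth y * kth y / (gth y + kth y) ^ 2)).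
Proof.
  intros Hy. pose proof (speed_pos y ltac:(lra)). pose proof (mm_pos y Hy) as Pm.
  pose proof (gth_pos y ltac:(lra)) as Pg. pose proof (kth_pos y ltac:(lra)) as Pk.
  pose proof (Gam_pos y Hy). pose proof (pow_lt _ 2 Pm).
  assert (Pe : 0 < ef y) by (apply Rdiv_lt_0_compat; nra).
  assert (Q : gth y * kth y / (gth y + kth y) ^ 2 <= 1 / 2).
  { apply Rmult_le_reg_r with ((gth y + kth y) ^ 2); [nra|].
    unfold Rdiv at 1. rewrite Rmult_assoc, Rinv_l by nra. nra. }
  apply Rmult_lt_0_compat; [apply Rmult_lt_0_compat; auto; apply Rdiv_lt_0_compat; auto|].
  apply Rplus_lt_le_0_compat; auto.
  apply Rmult_le_pos; [apply Rmult_le_pos; [apply pow2_ge_0|lra]|lra].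
Qed.

Lemma ex_derive_sf_minus_ef_zf_1 : ex_derive (fun y => sf y - ef y * zf y) 1.
Proof.
  assert (D1 := is_derive_sf 1 ltac:(lra)). assert (D2 := is_derive_ef 1 ltac:(lra)).
  assert (D3 := ex_derive_zf_1).
  auto_derive. repeat split; auto; eexists; eauto.
Qed.

Lemma Den_eq y : Den y = 1 + (sf y - ef y * zf y).
Proof. unfold Den; ring. Qed.

(** [Den] increases beyond 1, and at 1, where [gth = kth < 1], the bound [mu_1] gives
    [Den 1 >= 1/2 - gth 1 / 3]. *)
Lemma Den_pos y : 1 <= y -> 0 < Den y.
Proof.
  assert (H1 : 0 < Den 1).
  { pose proof mu_1. unfold Den. rewrite zf_1. unfold sf, ef.
    pose proof (kth_inv 1 ltac:(lra)) as E. replace (1 / 1) with 1 in E by field.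
    rewrite E. pose proof (gth_pos 1 ltac:(lra)) as Pg.
    pose proof (gk_sq 1 ltac:(lra)) as G. rewrite E in G.
    replace (gth 1 * gth 1 / (2 * (gth 1 + gth 1))) with (gth 1 / 4) by (field; lra).
    assert (1 / mu 1 <= 16 / 3).
    { unfold Rdiv at 1. rewrite Rmult_1_l. replace (16 / 3) with (/ (3 / 16)) by field.
      apply Rinv_le_contravar; lra. }
    assert (gth 1 < 1) by nra. nra. }
  intros [Hy|<-]; auto.
  rewrite Den_eq in *.
  set (f := fun y => sf y - ef y * zf y). fold (f y). fold (f 1) in H1.
  destruct (mean_value f (Derive f) 1 y Hy) as (c & Hc & E).
  - intros x Hx. apply Derive_correct. destruct (Req_dec x 1) as [->|Hx1].
    + apply ex_derive_sf_minus_ef_zf_1.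
    + eexists; apply is_derive_sf_minus_ef_zf; lra.
  - rewrite (is_derive_unique f _ _ (is_derive_sf_minus_ef_zf c ltac:(lra))) in E.
    pose proof (sf_minus_ef_zf_slope_pos c ltac:(lra)). nra.
Qed.

Lemma is_derive_one_plus_sf y : 0 < y ->
  is_derive (fun y => 1 + sf y) y (speed y * (- ef y * Tt y)).
Proof. intros Hy. apply is_derive_one_plus, is_derive_sf; auto. Qed.

Lemma is_derive_one_plus_wf y : 0 < y ->
  is_derive (fun y => 1 + wf y) y (speed y * (- (wf y / 2) * Tt y)).
Proof. intros Hy. apply is_derive_one_plus, is_derive_wf; auto. Qed.

Lemma ex_derive_ef_1 : ex_derive ef 1.
Proof. eexists; apply is_derive_ef; lra. Qed.

Lemma ex_derive_half_wf_1 : ex_derive (fun y => wf y / 2) 1.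
Proof.
  assert (D := is_derive_wf 1 ltac:(lra)). auto_derive. repeat split; eexists; eauto.
Qed.

Lemma derive_neq_0_of_inv_symmetric (f : R -> R) : (forall x, 0 < x -> f (1 / x) = f x) ->
  (forall x, 0 < x -> ex_derive f x) -> (forall y, 1 < y -> Derive f y <> 0) ->
  forall y, 0 < y -> y <> 1 -> Derive f y <> 0.
Proof.
  intros Hf D Hgt y Hy H1. destruct (Rtotal_order y 1) as [H|[H|H]]; auto.
  assert (Hi : 1 < 1 / y).
  { apply Rmult_lt_reg_r with y; [lra|]. replace (1 / y * y) with 1 by (field; lra). lra. }
  pose proof (derive_of_inv_symmetric f y _ Hy Hf
    (Derive_correct _ _ (D _ (inv_arg_pos y Hy)))) as E.
  apply is_derive_unique in E. rewrite E. specialize (Hgt _ Hi).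
  unfold Rdiv. apply Rmult_integral_contrapositive_currified; [lra|].
  apply Rinv_neq_0_compat. pose proof (pow_lt y 2 Hy). lra.
Qed.

Lemma Derive_calX_neq_0 y : 0 < y -> y <> 1 -> Derive calX y <> 0.
Proof.
  intros Hy H1. rewrite (Derive_shape calX (fun _ => 1) (fun _ => 0));
    auto using calX_eq, is_derive_one.
  pose proof (speed_pos y Hy). pose proof (Xf_pos y Hy). pose proof (mm_neq_0 y Hy H1).
  rewrite Rmult_0_l, Rminus_0_r, Rmult_1_r.
  apply Rmult_integral_contrapositive_currified; [|lra].
  apply Rmult_integral_contrapositive_currified; lra.
Qed.

Lemma Derive_n_calX_neq_0 : Derive_n calX 2 1 <> 0.
Proof.
  rewrite (Derive_n_2_shape calX (fun _ => 1) (fun _ => 0));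
    auto using calX_eq, is_derive_one.
  2:{ apply ex_derive_const. }
  pose proof (pow_lt _ 2 (speed_pos 1 ltac:(lra))). pose proof (Xf_pos 1 ltac:(lra)).
  pose proof mu_1. rewrite Rmult_0_l, Rminus_0_r, Rmult_1_r.
  apply Rmult_integral_contrapositive_currified; [|lra].
  apply Rmult_integral_contrapositive_currified; lra.
Qed.

Lemma ex_derive_calX y : 0 < y -> ex_derive calX y.
Proof.
  intros Hy. eexists. apply (is_derive_shape calX (fun _ => 1) (fun _ => 0));
    auto using calX_eq, is_derive_one.
Qed.

Lemma ex_derive_calY y : 0 < y -> ex_derive calY y.
Proof.
  intros Hy. eexists. apply (is_derive_shape calY _ _ calY_eq is_derive_one_plus_wf); auto.
Qed.

Lemma ex_derive_calA y : 0 < y -> ex_derive calA y.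
Proof.
  intros Hy. eexists. apply (is_derive_shape calA _ _ calA_eq is_derive_one_plus_sf); auto.
Qed.

Lemma ex_derive_calB y : 0 < y -> ex_derive calB y.
Proof.
  intros Hy. eexists. apply (is_derive_shape calB _ _ calB_eq is_derive_sf); auto.
Qed.

Lemma Derive_calA_eq y : 0 < y -> y <> 1 ->
  Derive calA y = speed y * Xf y * mm y * Den y.
Proof. apply (Derive_shape calA _ _ calA_eq is_derive_one_plus_sf). Qed.

Lemma Derive_calA_neq_0 y : 0 < y -> y <> 1 -> Derive calA y <> 0.
Proof.
  revert y. apply derive_neq_0_of_inv_symmetric; auto using calA_inv, ex_derive_calA.
  intros y Hy. rewrite Derive_calA_eq by lra.
  pose proof (speed_pos y ltac:(lra)). pose proof (Xf_pos y ltac:(lra)).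
  pose proof (mm_pos y Hy). pose proof (Den_pos y ltac:(lra)).
  apply Rmult_integral_contrapositive_currified; [|lra].
  apply Rmult_integral_contrapositive_currified; [|lra].
  apply Rmult_integral_contrapositive_currified; lra.
Qed.

Lemma Derive_n_calA_neq_0 : Derive_n calA 2 1 <> 0.
Proof.
  rewrite (Derive_n_2_shape calA _ _ calA_eq is_derive_one_plus_sf ex_derive_ef_1).
  fold (Den 1).
  pose proof (pow_lt _ 2 (speed_pos 1 ltac:(lra))). pose proof (Xf_pos 1 ltac:(lra)).
  pose proof mu_1. pose proof (Den_pos 1 ltac:(lra)).
  apply Rmult_integral_contrapositive_currified; [|lra].
  apply Rmult_integral_contrapositive_currified; [|lra].
  apply Rmult_integral_contrapositive_currified; lra.
Qed.

(** For [y < 1] this is read off from the derivative of the symmetric function [calA]. *)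
Lemma Den_neq_0 y : 0 < y -> Den y <> 0.
Proof.
  intros Hy. destruct (Req_dec y 1) as [->|H1].
  - pose proof (Den_pos 1 ltac:(lra)). lra.
  - intros E. apply (Derive_calA_neq_0 y Hy H1). rewrite Derive_calA_eq, E by auto. ring.
Qed.

Lemma derive_quotient_YX y : 0 < y ->
  derive_quotient calY calX y = 1 + wf y - wf y / 2 * zf y.
Proof.
  intros Hy.
  rewrite (derive_quotient_shape calY calX _ _ (fun _ => 1) (fun _ => 0)
    calY_eq is_derive_one_plus_wf ex_derive_half_wf_1 calX_eq is_derive_one
    (ex_derive_const _ _) y Hy); [field|]; lra.
Qed.

Lemma derive_quotient_BA y : 0 < y ->
  derive_quotient calB calA y = (sf y - ef y * zf y) / (1 + (sf y - ef y * zf y)).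
Proof.
  intros Hy. pose proof (Den_neq_0 y Hy) as N. rewrite <- Den_eq. unfold Den in *.
  apply (derive_quotient_shape calB calA _ _ _ _ calB_eq is_derive_sf ex_derive_ef_1
    calA_eq is_derive_one_plus_sf ex_derive_ef_1 y Hy N).
Qed.

Theorem theorem1p5 :
  (* (i) *)
  ((* the quotient is well defined on (0, oo) and differentiable there *)
   (forall y : R, 0 < y -> y <> 1 -> Derive calX y <> 0) /\
   Derive_n calX 2 1 <> 0 /\
   (forall y : R, 0 < y -> ex_derive (derive_quotient calY calX) y) /\
   (* y = 1 is the only critical point *)
   (forall y : R, 0 < y ->
      (is_derive (derive_quotient calY calX) y 0 <-> y = 1)) /\
   (forall y : R, 0 < y < 1 -> Derive (derive_quotient calY calX) y < 0) /\
   (forall y : R, 1 < y -> Derive (derive_quotient calY calX) y > 0))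
  /\
  (* (ii) *)
  ((forall y : R, 0 < y -> y <> 1 -> Derive calA y <> 0) /\
   Derive_n calA 2 1 <> 0 /\
   (forall y : R, 0 < y -> ex_derive (derive_quotient calB calA) y) /\
   (forall y : R, 0 < y ->
      (is_derive (derive_quotient calB calA) y 0 <-> y = 1)) /\
   (forall y : R, 0 < y < 1 -> Derive (derive_quotient calB calA) y < 0) /\
   (forall y : R, 1 < y -> Derive (derive_quotient calB calA) y > 0)).
Proof.
  split; (split; [|split]); auto using Derive_calX_neq_0, Derive_n_calX_neq_0,
    Derive_calA_neq_0, Derive_n_calA_neq_0; apply inv_symmetric_valley.
  - apply derive_quotient_inv;
      auto using calY_inv, calX_inv, ex_derive_calY, ex_derive_calX.
  - assert (D1 := is_derive_wf 1 ltac:(lra)). assert (D2 := ex_derive_zf_1).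
    assert (D : ex_derive (fun y => 1 + wf y - wf y / 2 * zf y) 1).
    { auto_derive. repeat split; auto; eexists; eauto. }
    destruct D as [d D]. exists d. apply (is_derive_ext_pos _ _ 1 d) with (3 := D); [lra|].
    intros x Hx; symmetry; apply derive_quotient_YX; auto.
  (* [Gam] is what remains of the [tau] derivative of [1 + wf - wf / 2 * zf] once [wf / (2 mm^2)] is
     factored out. *)
  - intros y Hy. exists (speed y * wf y * Gam y / (2 * mm y ^ 2)).
    pose proof (mm_pos y Hy) as Pm. pose proof (pow_lt _ 2 Pm).
    split.
    + apply (is_derive_ext_pos (fun y => 1 + wf y - wf y / 2 * zf y)); [lra| |].
      { intros x Hx; symmetry; apply derive_quotient_YX; auto. }
      assert (D1 := is_derive_wf y ltac:(lra)). assert (D2 := is_derive_zf y Hy).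
      auto_derive; [repeat split; eexists; eauto|].
      rewrite (is_derive_unique (fun x : R => wf x) _ _ D1),
        (is_derive_unique (fun x : R => zf x) _ _ D2).
      rewrite zf_eq by lra. unfold Gam. field. lra.
    + pose proof (speed_pos y ltac:(lra)). pose proof (Gam_pos y Hy).
      assert (0 < wf y).
      { apply sqrt_lt_R0, Rmult_lt_0_compat; [apply gth_pos|apply kth_pos]; lra. }
      apply Rdiv_lt_0_compat; [|lra]. repeat (apply Rmult_lt_0_compat; auto).
  - apply derive_quotient_inv;
      auto using calB_inv, calA_inv, ex_derive_calB, ex_derive_calA.
  - destruct ex_derive_sf_minus_ef_zf_1 as [d D].
    assert (D' : ex_derive (fun y => (sf y - ef y * zf y) / (1 + (sf y - ef y * zf y))) 1).
    { apply ex_derive_div; [eexists; exact D|eexists; apply is_derive_one_plus, D|].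
      rewrite <- Den_eq. apply Den_neq_0; lra. }
    destruct D' as [d' D']. exists d'.
    apply (is_derive_ext_pos _ _ 1 d') with (3 := D'); [lra|].
    intros x Hx; symmetry; apply derive_quotient_BA; auto.
  - intros y Hy. pose proof (Den_neq_0 y ltac:(lra)) as N.
    pose proof (is_derive_sf_minus_ef_zf y Hy) as D.
    pose proof (sf_minus_ef_zf_slope_pos y Hy) as P.
    set (d := speed y * _ * _) in D, P.
    (* The quotient is [u / (1 + u)] with [1 + u = Den] and [u' = d]. *)
    exists (d / Den y ^ 2). split.
    + apply (is_derive_ext_pos
        (fun y => (sf y - ef y * zf y) / (1 + (sf y - ef y * zf y)))); [lra| |].
      { intros x Hx; symmetry; apply derive_quotient_BA; auto. }
      evar_last.
      { apply is_derive_div; [exact D|apply is_derive_one_plus, D|]. rewrite <- Den_eq; auto. }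
      rewrite Den_eq in *. field. auto.
    + apply Rdiv_lt_0_compat; auto.
      pose proof (Rsqr_pos_lt _ N) as Q. rewrite Rsqr_pow2 in Q. auto.
Qed.
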